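(* Let $G$ be a subgroup of finite index of $\mathrm{SL}_2(\mathbb{Z})$, let $D\in\mathbb{Z}_{\ge1}$, $k\in\frac1D\mathbb{Z}$, and let $\chi$ be a multiplier system for $G$ of weight $k$ of cover index $D$ (not assumed to be of finite order). Let $f$ be a nonzero meromorphic modular form of weight $k$ for $G$ with character $\chi$, and let $m=[\overline{\mathrm{SL}_2(\mathbb{Z})}:\overline{G}]$. Then $$\deg(\operatorname{div} f)=\frac{1}{12}mk.$$
   Context: Notation: $e(x)=\exp(2\pi i x)$, $q=e(\tau)$ for $\tau$ in the upper half plane $\mathbb{H}$; for $z\in\mathbb{C}^\times$, $r\in\mathbb{Q}$, $z^r=\exp(r\log z)$ with $-\pi<\operatorname{Im}\log z\le\pi$. The $D$-cover $\widetilde{\mathrm{GL}_2^+(\mathbb{R})}^D$ is the group of pairs $(M,\phi)$ with $M\in\mathrm{GL}_2^+(\mathbb{R})$ and $\phi(\tau)=\varepsilon(c'\tau+d')^{1/D}$, where $\varepsilon^D=1$ and $\begin{pmatrix}a'&b'\\c'&d'\end{pmatrix}=(\det M)^{-1/2}M$; the product is $(M_1,\phi_1)(M_2,\phi_2)=(M_1M_2,\phi_1(M_2\tau)\phi_2(\tau))$. For a subgroup $G$, $\widetilde G^D$ denotes its preimage; for $\gamma=\begin{pmatrix}a&b\\c&d\end{pmatrix}\in\mathrm{SL}_2(\mathbb{R})$, $\widetilde\gamma=(\gamma,(c\tau+d)^{1/D})$. For $k\in\frac1D\mathbb{Z}$ and $f$ meromorphic on $\mathbb{H}$, $(f|_k(M,\phi))(\tau)=\phi(\tau)^{-Dk}f(M\tau)$.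 A multiplier system for $G$ of weight $k$ of cover index $D$ is a unitary character $\chi:\widetilde G^D\to\mathbb{C}^\times$ with $\chi(I,e(1/D))=e(-k)$ and, if $-I\in G$, $\chi(\widetilde{-I})=e(-k/2)$. A meromorphic modular form of weight $k$ for $G$ with character $\chi$ is a meromorphic $f$ on $\mathbb{H}$ with $f|_k\gamma=\chi(\gamma)f$ for all $\gamma\in\widetilde G^D$ such that for every $\gamma\in\mathrm{SL}_2(\mathbb{Z})$, $f|_k\widetilde\gamma$ has no poles for $\operatorname{Im}\tau$ large and there equals a series $\sum_n c_nq^n$ over exponents $n$ in a set of the form $\kappa+\frac1h\mathbb{Z}$, with only finitely many $n<0$ having $c_n\ne0$; $\operatorname{ord}_{i\infty}(f|_k\widetilde\gamma)$ is the least $n$ with $c_n\neq0$. For $g\in \mathrm{SL}_2(\mathbb{Z})$-subgroups, $\overline{H}$ denotes the image in $\mathrm{PSL}_2(\mathbb{Z})$ and $\overline{H}_x$ the stabilizer of $x$. Divisor: $\operatorname{div} f$ is the $\mathbb{Q}$-valued function on $G\backslash(\mathbb{H}\cup\mathbb{P}^1(\mathbb{Q}))$ given by $\operatorname{div}_{G\tau}(f)=n_0/|\overline{G}_\tau|$ for $\tau\in\mathbb{H}$, $n_0$ the order of $f$ at $\tau$; and for a cusp $x=\gamma(i\infty)$, $\gamma\in\mathrm{SL}_2(\mathbb{Z})$, $\operatorname{div}_{Gx}(f)=\operatorname{ord}_{i\infty}(f|_k\widetilde\gamma)\cdot w_x$, with width $w_x=[\overline{\mathrm{SL}_2(\mathbb{Z})}_x:\overline{G}_x]$.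 Its degree is the (finite) sum of all its values. *)

(* Defs.v *)
From Stdlib Require Import Reals ZArith List.
From Coquelicot Require Import Coquelicot.
Set Implicit Arguments.
Open Scope R_scope.

Record mat := Mat { ma : Z; mb : Z; mc : Z; md : Z }.

Definition mmul (A B : mat) : mat :=
  Mat (ma A * ma B + mb A * mc B)%Z (ma A * mb B + mb A * md B)%Z
      (mc A * ma B + md A * mc B)%Z (mc A * mb B + md A * md B)%Z.
Definition mdet (A : mat) : Z := (ma A * md A - mb A * mc A)%Z.
Definition mI : mat := Mat 1 0 0 1.
Definition mneg (A : mat) : mat := Mat (- ma A) (- mb A) (- mc A) (- md A).
Definition minv (A : mat) : mat := Mat (md A) (- mb A) (- mc A) (ma A).
Definition SL2Z (A : mat) : Prop := mdet A = 1%Z.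

Definition is_subgroup (G : mat -> Prop) : Prop :=
  (forall A, G A -> SL2Z A) /\ G mI /\
  (forall A B, G A -> G B -> G (mmul A B)) /\ (forall A, G A -> G (minv A)).

(* [K : H] = n (H a subgroup of the group K): right cosets H r_0, ..., H r_(n-1)
   partition K *)
Definition is_index (H K : mat -> Prop) (n : nat) : Prop :=
  exists r : nat -> mat, (forall i, (i < n)%nat -> K (r i)) /\
    forall A, K A -> exists! i, (i < n)%nat /\ H (mmul A (minv (r i))).

(* +-G : the preimage in SL_2(Z) of the image \bar G of G in PSL_2(Z) *)
Definition pmG (G : mat -> Prop) (A : mat) : Prop := G A \/ G (mneg A).

Definition ZtoC (z : Z) : C := RtoC (IZR z).
Definition cexp (z : C) : C := (exp (Re z) * cos (Im z), exp (Re z) * sin (Im z)).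
Definition eC (z : C) : C := cexp (Cmult (0, 2 * PI) z).
Definition ee (x : R) : C := eC (RtoC x).
(* principal argument in (-pi, pi] *)
Definition carg (z : C) : R :=
  if Rle_dec 0 (Im z) then acos (Re z / Cmod z) else - acos (Re z / Cmod z).
Definition Clog (z : C) : C := (ln (Cmod z), carg z).
Definition Cpowr (z : C) (r : R) : C := cexp (Cmult (RtoC r) (Clog z)).
Fixpoint cpown (z : C) (n : nat) : C :=
  match n with O => RtoC 1 | S n => Cmult z (cpown z n) end.
Definition czpow (z : C) (n : Z) : C :=
  match n with
  | Z0 => RtoC 1
  | Zpos p => cpown z (Pos.to_nat p)
  | Zneg p => Cinv (cpown z (Pos.to_nat p))
  end.

Definition mob (A : mat) (t : C) : C :=
  Cdiv (Cplus (Cmult (ZtoC (ma A)) t) (ZtoC (mb A)))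
       (Cplus (Cmult (ZtoC (mc A)) t) (ZtoC (md A))).

Definition is_order (f : C -> C) (t0 : C) (n : Z) : Prop :=
  exists r : R, 0 < r /\ r <= Im t0 /\ exists g : C -> C,
    (forall t, Cmod (Cminus t t0) < r -> ex_derive (K:=C_AbsRing) (V:=C_NormedModule) g t) /\
    g t0 <> RtoC 0 /\
    forall t, 0 < Cmod (Cminus t t0) < r -> f t = Cmult (czpow (Cminus t t0) n) (g t).

Definition locally_zero (f : C -> C) (t0 : C) : Prop :=
  exists r : R, 0 < r /\ r <= Im t0 /\
    forall t, 0 < Cmod (Cminus t t0) < r -> f t = RtoC 0.

Definition meromorphic (f : C -> C) : Prop :=
  forall t0, 0 < Im t0 -> locally_zero f t0 \/ exists n, is_order f t0 n.

(* equality of meromorphic functions on H (values at poles are irrelevant) *)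
Definition mero_eq (f g : C -> C) : Prop :=
  forall t0, 0 < Im t0 -> exists r : R, 0 < r /\ r <= Im t0 /\
    forall t, 0 < Cmod (Cminus t t0) < r -> f t = g t.

Definition mero_nonzero (f : C -> C) : Prop := ~ mero_eq f (fun _ => RtoC 0).

(* For gamma in SL_2(R) (here SL_2(Z)) and eps a D-th root of unity, the cover
   element (gamma, phi) with phi(t) = eps (c t + d)^(1/D). *)
Definition root_of_unity (D : nat) (eps : C) : Prop := cpown eps D = RtoC 1.
Definition cphi (D : nat) (A : mat) (eps : C) (t : C) : C :=
  Cmult eps (Cpowr (Cplus (Cmult (ZtoC (mc A)) t) (ZtoC (md A))) (/ INR D)).

(* slash operator of weight k = kn / D : (f|_k (A,phi))(t) = phi(t)^(-D k) f(A t) *)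
Definition slash (D : nat) (kn : Z) (A : mat) (eps : C) (f : C -> C) (t : C) : C :=
  Cmult (czpow (cphi D A eps t) (- kn)) (f (mob A t)).

Definition weight (D : nat) (kn : Z) : R := IZR kn / INR D.

(* chi : a function on pairs (A, eps), i.e. on elements (A, cphi D A eps) of the
   cover; only its values on the preimage of G matter. *)
Definition multiplier_system (G : mat -> Prop) (D : nat) (kn : Z)
    (chi : mat -> C -> C) : Prop :=
  (forall A eps, G A -> root_of_unity D eps -> Cmod (chi A eps) = 1) /\
  (* character for the group law (M1,phi1)(M2,phi2) = (M1 M2, phi1(M2 t) phi2(t)) *)
  (forall A1 e1 A2 e2 e3, G A1 -> G A2 -> root_of_unity D e1 ->
     root_of_unity D e2 -> root_of_unity D e3 ->
     (forall t, 0 < Im t -> Cmult (cphi D A1 e1 (mob A2 t)) (cphi D A2 e2 t)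
                            = cphi D (mmul A1 A2) e3 t) ->
     chi (mmul A1 A2) e3 = Cmult (chi A1 e1) (chi A2 e2)) /\
  chi mI (ee (/ INR D)) = ee (- weight D kn) /\
  (* if -I in G then chi(~(-I)) = e(-k/2); ~(-I) = (-I, (0 t - 1)^(1/D)) *)
  (G (mneg mI) -> chi (mneg mI) (RtoC 1) = ee (- weight D kn / 2)).

Definition qterm (kappa : R) (h : nat) (c : Z -> C) (t : C) (j : Z) : C :=
  Cmult (c j) (eC (Cmult (RtoC (kappa + IZR j / INR h)) t)).

Definition qexp (g : C -> C) (kappa : R) (h : nat) (c : Z -> C) : Prop :=
  (0 < h)%nat /\
  (exists L : list Z, forall j, kappa + IZR j / INR h < 0 -> c j <> RtoC 0 -> In j L) /\
  exists Y : R, forall t, Y < Im t ->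
    exists S1 S2 : C,
      is_series (K:=C_AbsRing) (V:=C_NormedModule)
        (fun n : nat => qterm kappa h c t (Z.of_nat n)) S1 /\
      is_series (K:=C_AbsRing) (V:=C_NormedModule)
        (fun n : nat => qterm kappa h c t (- Z.of_nat (S n))%Z) S2 /\
      g t = Cplus S1 S2.

Definition has_qexp (g : C -> C) : Prop := exists kappa h c, qexp g kappa h c.

Definition ord_infty (g : C -> C) (r : R) : Prop :=
  exists kappa h c, qexp g kappa h c /\
    (exists j, c j <> RtoC 0 /\ r = kappa + IZR j / INR h) /\
    (forall j, c j <> RtoC 0 -> r <= kappa + IZR j / INR h).

Definition mero_modular_form (G : mat -> Prop) (D : nat) (kn : Z)
    (chi : mat -> C -> C) (f : C -> C) : Prop :=
  meromorphic f /\
  (forall A eps, G A -> root_of_unity D eps ->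
     mero_eq (slash D kn A eps f) (fun t => Cmult (chi A eps) (f t))) /\
  (* ~gamma = (gamma, (c t + d)^(1/D)), i.e. eps = 1 *)
  (forall A, SL2Z A -> has_qexp (slash D kn A (RtoC 1) f)).

Definition H_equiv (G : mat -> Prop) (t t' : C) : Prop :=
  exists A, G A /\ mob A t = t'.

(* |\bar G_t| = n : number of elements of \bar G (classes {A, -A}, A in +-G) fixing t *)
Definition stab_card (G : mat -> Prop) (t : C) (n : nat) : Prop :=
  exists r : nat -> mat, (forall i, (i < n)%nat -> pmG G (r i) /\ mob (r i) t = t) /\
    forall A, pmG G A -> mob A t = t ->
      exists! i, (i < n)%nat /\ (A = r i \/ A = mneg (r i)).

(* cusps: points of P^1(Q) in homogeneous integer coordinates (p : q);
   gamma(i infinity) = (a : c) *)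
Definition cusp_of (A : mat) : Z * Z := (ma A, mc A).
Definition pact (A : mat) (x : Z * Z) : Z * Z :=
  (ma A * fst x + mb A * snd x, mc A * fst x + md A * snd x)%Z.
Definition proj_eq (x y : Z * Z) : Prop := (fst x * snd y = fst y * snd x)%Z.
Definition cusp_equiv (G : mat -> Prop) (x y : Z * Z) : Prop :=
  exists A, G A /\ proj_eq (pact A x) y.
Definition cusp_stab (x : Z * Z) (A : mat) : Prop := SL2Z A /\ proj_eq (pact A x) x.
(* width w_x = [\bar SL_2(Z)_x : \bar G_x], computed as the index of
   (+-G)_x in SL_2(Z)_x (both contain -I) *)
Definition cusp_width (G : mat -> Prop) (x : Z * Z) (w : nat) : Prop :=
  is_index (fun A => pmG G A /\ cusp_stab x A) (cusp_stab x) w.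

Fixpoint rsum (N : nat) (F : nat -> R) : R :=
  match N with O => 0 | S N => rsum N F + F N end.

(* A description of div f by representatives: points t_0..t_(N-1) of H, pairwise
   G-inequivalent, meeting every orbit on which f has nonzero order (orbits not met
   carry value 0), with orders ordt i and stabilizer orders st i; and cusp
   representatives gamma_0(i oo), ..., gamma_(M-1)(i oo), one for each G-orbit of
   cusps, with orders ordc j of f|_k ~gamma_j at i oo and widths wd j. *)
Definition div_repr (G : mat -> Prop) (D : nat) (kn : Z) (f : C -> C)
    (N : nat) (tau : nat -> C) (ordt : nat -> Z) (st : nat -> nat)
    (M : nat) (gam : nat -> mat) (ordc : nat -> R) (wd : nat -> nat) : Prop :=
  (forall i, (i < N)%nat ->
     0 < Im (tau i) /\ is_order f (tau i) (ordt i) /\ stab_card G (tau i) (st i)) /\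
  (forall i j, (i < N)%nat -> (j < N)%nat -> i <> j -> ~ H_equiv G (tau i) (tau j)) /\
  (forall t n, 0 < Im t -> is_order f t n -> n <> 0%Z ->
     exists i, (i < N)%nat /\ H_equiv G t (tau i)) /\
  (forall j, (j < M)%nat ->
     SL2Z (gam j) /\ ord_infty (slash D kn (gam j) (RtoC 1) f) (ordc j) /\
     cusp_width G (cusp_of (gam j)) (wd j)) /\
  (forall i j, (i < M)%nat -> (j < M)%nat -> i <> j ->
     ~ cusp_equiv G (cusp_of (gam i)) (cusp_of (gam j))) /\
  (forall A, SL2Z A -> exists j, (j < M)%nat /\ cusp_equiv G (cusp_of A) (cusp_of (gam j))).

Definition div_degree (N : nat) (ordt : nat -> Z) (st : nat -> nat)
    (M : nat) (ordc : nat -> R) (wd : nat -> nat) : R :=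
  rsum N (fun i => IZR (ordt i) / INR (st i)) + rsum M (fun j => ordc j * INR (wd j)).

(* Main.v *)
Require Import Defs.
From Stdlib Require Import Reals Ranalysis5 ZArith List FinFun Permutation Lra Lia Classical ClassicalEpsilon.
From Coquelicot Require Import Coquelicot.
Open Scope R_scope.

(** The argument principle in flux form.  Let r_1, ..., r_m represent the cosets of +-G.  The
product F of the f|r_i has |F(z+1)| = |F(z)| and |F(-1/z)| = |z|^(mk) |F(z)|, so as far as
absolute values are concerned it behaves like a form of weight mk for SL_2(Z).  On a rectangle
containing the truncated fundamental domain, F is a finite product of powers (z - t)^n times
exp H with H holomorphic, so log |F| has an explicit conjugate function along each piece of the
boundary.  Its increments cancel on the two vertical sides, the inversion makes the increment
on the arc equal to mk pi/6, and the expansion at infinity gives the increment on the top.  The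
increment of the argument of z - t around the domain is 2 pi times the normalised angle w(t) of
the domain at t: 1 inside, 1/2 on an edge, 1/6 at a corner, 0 outside.  This remains true for
zeros on the boundary, since there the conjugate function of log |z - t| is constant along the
piece through t.  The sum of w over an SL_2(Z)-orbit, counted with group elements, is 2, and
regrouping zeros and cusps by G-orbits gives the formula. *)

(** * Complex derivatives *)

(** The character may have infinite order and the slash operator involves branches of a D-th root.
    Both disappear in absolute values, because the character is unitary, so the symmetries are
    applied to log |F| alone. They equate normal derivatives of log |F| at corresponding boundary
    points; by Cauchy-Riemann these are the tangential derivatives of the conjugate function. Thus
    increments can be compared without following a branch of arg F, and a derivative that vanishes
    off a finite set, together with continuity, does the work of contour integrals. Values of a
    meromorphic function on a discrete set are arbitrary, so identities are stated on punctured
    neighbourhoods and extended by continuity once the function has been factored. The top side is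
    controlled only up to an error: its increment differs from 2 pi r by less than v, for every
    small v > 0, with a height depending on v. The arc from exp(i pi/3) to exp(2 i pi/3) has length
    pi/3. Inversion reverses it, so it carries half of mk times this length, that is mk pi/6;
    division by 2 pi gives 1/12. *)

Definition near (z : C) (P : C -> Prop) : Prop :=
  exists d, 0 < d /\ forall w, Cmod (w - z) < d -> P w.
(** Meromorphic functions are compared on punctured neighbourhoods, since their values on a discrete
    set are arbitrary; [pnear_near] and [pnear_pnear] lead back to full neighbourhoods. *)
Definition pnear (z : C) (P : C -> Prop) : Prop :=
  exists d, 0 < d /\ forall w, 0 < Cmod (w - z) < d -> P w.
Definition ccont (f : C -> C) (z : C) : Prop :=
  forall e, 0 < e -> near z (fun w => Cmod (f w - f z) < e).
Definition rcont (u : C -> R) (z : C) : Prop :=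
  forall e, 0 < e -> near z (fun w => Rabs (u w - u z) < e).
(* Caratheodory's form of the complex derivative *)
Definition cder (f : C -> C) (z l : C) : Prop :=
  exists p : C -> C, ccont p z /\ p z = l /\
    near z (fun w => f w = (f z + p w * (w - z))%C).
Definition hol (f : C -> C) (z : C) : Prop := exists l, cder f z l.

Lemma Cminus_diag (z : C) : (z - z = 0)%C.
Proof. ring. Qed.

Lemma Cmod_minus_sym (a b : C) : Cmod (a - b) = Cmod (b - a).
Proof. rewrite <- Cmod_opp. f_equal. ring. Qed.

Lemma Cmod_minus_pos (a b : C) : a <> b -> 0 < Cmod (a - b).
Proof.
intros H. apply Cmod_gt_0. intros E. apply H.
replace a with (a - b + b)%C by ring. rewrite E. ring.
Qed.

Lemma near_self z P : near z P -> P z.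
Proof. intros [d [Hd H]]. apply H. rewrite Cminus_diag, Cmod_0. exact Hd. Qed.

Lemma near_imp z (P Q : C -> Prop) : (forall w, P w -> Q w) -> near z P -> near z Q.
Proof. intros H [d [Hd HP]]. exists d. split; [exact Hd|]. auto. Qed.

Lemma near_and z (P Q : C -> Prop) : near z P -> near z Q -> near z (fun w => P w /\ Q w).
Proof.
intros [d [Hd HP]] [e [He HQ]]. exists (Rmin d e). split.
- apply Rmin_glb_lt; assumption.
- intros w Hw. split; [apply HP|apply HQ]; eapply Rlt_le_trans; eauto using Rmin_l, Rmin_r.
Qed.

Lemma near_all z (P : C -> Prop) : (forall w, P w) -> near z P.
Proof. intros H. exists 1. split; [lra|auto]. Qed.

Lemma pnear_imp z (P Q : C -> Prop) : (forall w, P w -> Q w) -> pnear z P -> pnear z Q.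
Proof. intros H [d [Hd HP]]. exists d. split; [exact Hd|]. auto. Qed.

Lemma pnear_and z (P Q : C -> Prop) : pnear z P -> pnear z Q -> pnear z (fun w => P w /\ Q w).
Proof.
intros [d [Hd HP]] [e [He HQ]]. exists (Rmin d e). split.
- apply Rmin_glb_lt; assumption.
- intros w Hw. pose proof (Rmin_l d e). pose proof (Rmin_r d e).
  split; [apply HP|apply HQ]; lra.
Qed.

Lemma near_pnear z P : near z P -> pnear z P.
Proof. intros [d [Hd HP]]. exists d. split; [exact Hd|]. intros w [_ Hw]; auto. Qed.

Lemma pnear_near z (P : C -> Prop) : P z -> pnear z P -> near z P.
Proof.
intros Hz [d [Hd HP]]. exists d. split; [exact Hd|]. intros w Hw.
destruct (Ceq_dec w z) as [->|Hn]; [exact Hz|].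
apply HP. split; [apply Cmod_minus_pos; exact Hn|exact Hw].
Qed.

Lemma pnear_neq z : pnear z (fun w => w <> z).
Proof.
exists 1. split; [lra|]. intros w [H _] ->. rewrite Cminus_diag, Cmod_0 in H. lra.
Qed.

Lemma near_near z P : near z P -> near z (fun w => near w P).
Proof.
intros [d [Hd HP]]. exists (d/2). split; [lra|]. intros w Hw.
exists (d/2). split; [lra|]. intros v Hv. apply HP.
replace (v - z)%C with ((v - w) + (w - z))%C by ring.
eapply Rle_lt_trans; [apply Cmod_triangle|lra].
Qed.

Lemma pnear_pnear z P : pnear z P -> pnear z (fun w => near w P).
Proof.
intros [d [Hd HP]]. exists (d/2). split; [lra|]. intros w [Hw1 Hw2].
exists (Rmin (d/2) (Cmod (w - z))). split; [apply Rmin_glb_lt; lra|].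
intros v Hv. pose proof (Rmin_l (d/2) (Cmod (w - z))). pose proof (Rmin_r (d/2) (Cmod (w - z))).
apply HP. split.
- apply Cmod_minus_pos. intros ->.
  rewrite Cmod_minus_sym in Hv. lra.
- replace (v - z)%C with ((v - w) + (w - z))%C by ring.
  eapply Rle_lt_trans; [apply Cmod_triangle|lra].
Qed.

Lemma pnear_ex z P : pnear z P -> exists w, w <> z /\ P w.
Proof.
intros [d [Hd HP]]. exists (z + RtoC (d/2))%C.
assert (E : (z + RtoC (d/2) - z)%C = RtoC (d/2)) by ring.
assert (M : Cmod (z + RtoC (d/2) - z) = d/2).
{ rewrite E, Cmod_R, Rabs_pos_eq; lra. }
split.
- intros E1. rewrite E1, Cminus_diag, Cmod_0 in M. lra.
- apply HP. rewrite M. lra.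
Qed.

Lemma Cmod_triangle3 (a b c : C) : Cmod (a + b + c) <= Cmod a + Cmod b + Cmod c.
Proof. eapply Rle_trans; [apply Cmod_triangle|]. pose proof (Cmod_triangle a b). lra. Qed.

(** Passage to the limit: the form in which continuity extends relations to the centre of a
    punctured neighbourhood. *)
Lemma rcont_pnear_le u v z :
  rcont u z -> rcont v z -> pnear z (fun w => u w <= v w) -> u z <= v z.
Proof.
intros Hu Hv H. apply Rnot_lt_le. intros Hlt.
set (e := (u z - v z) / 2). assert (He : 0 < e) by (unfold e; lra).
destruct (pnear_ex _ _ (pnear_and _ _ _ H (near_pnear _ _ (near_and _ _ _ (Hu e He) (Hv e He)))))
  as [w [_ [H1 [H2 H3]]]].
apply Rabs_def2 in H2. apply Rabs_def2 in H3. unfold e in *. lra.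
Qed.

Lemma rcont_pnear_eq u v z :
  rcont u z -> rcont v z -> pnear z (fun w => u w = v w) -> u z = v z.
Proof.
intros Hu Hv H. apply Rle_antisym; apply rcont_pnear_le; auto;
  revert H; apply pnear_imp; intros w ->; lra.
Qed.

Lemma Rabs_Cmod_sub a b : Rabs (Cmod a - Cmod b) <= Cmod (a - b).
Proof.
apply Rabs_le.
pose proof (Cmod_triangle (a - b) b) as H1. replace (a - b + b)%C with a in H1 by ring.
pose proof (Cmod_triangle (b - a) a) as H2. replace (b - a + a)%C with b in H2 by ring.
rewrite (Cmod_minus_sym b a) in H2. lra.
Qed.

Lemma rcont_Cmod f z : ccont f z -> rcont (fun w => Cmod (f w)) z.
Proof.
intros H e He. generalize (H e He). apply near_imp. intros w Hw.
eapply Rle_lt_trans; [apply Rabs_Cmod_sub|exact Hw].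
Qed.

Lemma rcont_Re f z : ccont f z -> rcont (fun w => Re (f w)) z.
Proof.
intros H e He. generalize (H e He). apply near_imp. intros w Hw.
eapply Rle_lt_trans; [|exact Hw]. apply (re_le_Cmod (f w - f z)).
Qed.

Lemma im_le_Cmod (c : C) : Rabs (Im c) <= Cmod c.
Proof.
eapply Rle_trans; [|apply Rmax_Cmod]. apply Rmax_r.
Qed.

Lemma rcont_Im f z : ccont f z -> rcont (fun w => Im (f w)) z.
Proof.
intros H e He. generalize (H e He). apply near_imp. intros w Hw.
eapply Rle_lt_trans; [|exact Hw]. apply (im_le_Cmod (f w - f z)).
Qed.

Lemma Cmod_le_Re_Im (c : C) : Cmod c <= Rabs (Re c) + Rabs (Im c).
Proof.
unfold Cmod. fold (Re c). fold (Im c). apply Rsqr_incr_0_var.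
- rewrite Rsqr_sqrt; [|nra]. unfold Rsqr.
  pose proof (Rabs_pos (Re c)). pose proof (Rabs_pos (Im c)).
  assert (Rabs (Re c) * Rabs (Re c) = Re c * Re c) by (rewrite <- Rabs_mult; apply Rabs_pos_eq; nra).
  assert (Rabs (Im c) * Rabs (Im c) = Im c * Im c) by (rewrite <- Rabs_mult; apply Rabs_pos_eq; nra).
  simpl. nra.
- pose proof (Rabs_pos (Re c)). pose proof (Rabs_pos (Im c)). lra.
Qed.

Lemma ccont_ReIm f z : rcont (fun w => Re (f w)) z -> rcont (fun w => Im (f w)) z -> ccont f z.
Proof.
intros H1 H2 e He. assert (He2 : 0 < e/2) by lra.
generalize (near_and _ _ _ (H1 _ He2) (H2 _ He2)). apply near_imp. intros w [A B].
eapply Rle_lt_trans; [apply Cmod_le_Re_Im|]. unfold Re, Im in *. simpl in *.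
unfold Rminus in *. lra.
Qed.

Lemma ccont_const c z : ccont (fun _ => c) z.
Proof. intros e He. apply near_all. intros w. rewrite Cminus_diag, Cmod_0. exact He. Qed.

Lemma ccont_id z : ccont (fun w => w) z.
Proof. intros e He. exists e. auto. Qed.

Lemma ccont_plus f g z : ccont f z -> ccont g z -> ccont (fun w => f w + g w)%C z.
Proof.
intros H1 H2 e He. assert (He2 : 0 < e/2) by lra.
generalize (near_and _ _ _ (H1 _ He2) (H2 _ He2)). apply near_imp. intros w [A B].
replace (f w + g w - (f z + g z))%C with ((f w - f z) + (g w - g z))%C by ring.
eapply Rle_lt_trans; [apply Cmod_triangle|lra].
Qed.

Lemma ccont_opp f z : ccont f z -> ccont (fun w => - f w)%C z.
Proof.
intros H e He. generalize (H e He). apply near_imp. intros w Hw.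
replace (- f w - - f z)%C with (- (f w - f z))%C by ring. now rewrite Cmod_opp.
Qed.

Lemma ccont_minus f g z : ccont f z -> ccont g z -> ccont (fun w => f w - g w)%C z.
Proof. intros H1 H2. apply ccont_plus; [exact H1|]. now apply ccont_opp. Qed.

Lemma ccont_mult f g z : ccont f z -> ccont g z -> ccont (fun w => f w * g w)%C z.
Proof.
intros H1 H2 e He.
set (M := 1 + Cmod (f z) + Cmod (g z)).
pose proof (Cmod_ge_0 (f z)). pose proof (Cmod_ge_0 (g z)).
assert (HM : 0 < M) by (unfold M; lra).
set (d := Rmin 1 (e / (2 * M))).
assert (He2 : 0 < d).
{ unfold d. apply Rmin_glb_lt; [lra|]. apply Rdiv_lt_0_compat; lra. }
assert (Hd1 : d <= 1) by apply Rmin_l.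
assert (Hd2 : d * (2 * M) <= e).
{ apply Rle_trans with (e / (2 * M) * (2 * M)).
  - apply Rmult_le_compat_r; [lra|]. apply Rmin_r.
  - right. field. lra. }
generalize (near_and _ _ _ (H1 _ He2) (H2 _ He2)). apply near_imp. intros w [A B].
replace (f w * g w - f z * g z)%C
  with ((f w - f z) * (g w - g z) + (f w - f z) * g z + f z * (g w - g z))%C by ring.
eapply Rle_lt_trans; [apply Cmod_triangle3|]. rewrite !Cmod_mult.
pose proof (Cmod_ge_0 (f w - f z)). pose proof (Cmod_ge_0 (g w - g z)).
unfold M in Hd2.
apply Rle_lt_trans with (d * 1 + d * Cmod (g z) + Cmod (f z) * d); [|nra].
apply Rplus_le_compat; [apply Rplus_le_compat|]; apply Rmult_le_compat; lra.
Qed.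

Lemma ccont_neq0 f z : ccont f z -> f z <> 0 -> near z (fun w => f w <> 0).
Proof.
intros H Hz. generalize (H (Cmod (f z)) (proj1 (Cmod_gt_0 _) Hz)). apply near_imp.
intros w Hw E. rewrite E in Hw. replace (0 - f z)%C with (- f z)%C in Hw by ring.
rewrite Cmod_opp in Hw. lra.
Qed.

Lemma ccont_inv f z : ccont f z -> f z <> 0 -> ccont (fun w => / f w)%C z.
Proof.
intros H Hz e He. set (M := Cmod (f z)).
assert (HM : 0 < M) by now apply Cmod_gt_0.
set (d := Rmin (M/2) (e * (M * M) / 2)).
assert (Hd : 0 < d) by (unfold d; apply Rmin_glb_lt; [lra|]; assert (0 < M*M) by nra; nra).
generalize (near_and _ _ _ (ccont_neq0 _ _ H Hz) (H _ Hd)). apply near_imp. intros w [A B].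
assert (B1 : Cmod (f w - f z) < M / 2) by (eapply Rlt_le_trans; [exact B|apply Rmin_l]).
assert (B2 : Cmod (f w - f z) < e * (M*M) / 2) by (eapply Rlt_le_trans; [exact B|apply Rmin_r]).
assert (HW : M / 2 < Cmod (f w)).
{ pose proof (Cmod_triangle (f w) (f z - f w)) as T.
  replace (f w + (f z - f w))%C with (f z) in T by ring. rewrite Cmod_minus_sym in T.
  fold M in T. lra. }
replace (/ f w - / f z)%C with (- (f w - f z) / (f w * f z))%C by (field; auto).
rewrite Cmod_div by (apply Cmult_neq_0; auto). rewrite Cmod_opp, Cmod_mult. fold M.
apply Rmult_lt_reg_r with (Cmod (f w) * M); [nra|].
unfold Rdiv. rewrite Rmult_assoc, Rinv_l by nra. rewrite Rmult_1_r.
apply Rlt_le_trans with (1 := B2).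
replace (e * (M*M)/2) with (e * (M/2 * M)) by field.
apply Rmult_le_compat_l; [lra|]. nra.
Qed.

Lemma ccont_comp f g z : ccont f (g z) -> ccont g z -> ccont (fun w => f (g w)) z.
Proof.
intros Hf Hg e He. destruct (Hf e He) as [d [Hd H]].
generalize (Hg d Hd). apply near_imp. intros w Hw. now apply H.
Qed.

Lemma near_ccont f z (P : C -> Prop) : ccont f z -> near (f z) P -> near z (fun w => P (f w)).
Proof. intros Hf [d [Hd H]]. generalize (Hf d Hd). apply near_imp. auto. Qed.

Lemma ccont_ext f g z : near z (fun w => f w = g w) -> ccont f z -> ccont g z.
Proof.
intros E H e He. generalize (near_and _ _ _ E (H e He)). apply near_imp.
intros w [<- Hw]. rewrite <- (near_self _ _ E). exact Hw.
Qed.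

Lemma ccont_pnear_eq f g z :
  ccont f z -> ccont g z -> pnear z (fun w => f w = g w) -> f z = g z.
Proof.
intros Hf Hg H.
assert (E : Cmod (f z - g z) = 0).
{ apply (rcont_pnear_eq (fun w => Cmod (f w - g w)) (fun _ => 0)).
  - apply rcont_Cmod. now apply ccont_minus.
  - intros e He. apply near_all. intros. rewrite Rminus_diag, Rabs_R0. exact He.
  - revert H. apply pnear_imp. intros w ->. now rewrite Cminus_diag, Cmod_0. }
apply Cmod_eq_0 in E. replace (f z) with (f z - g z + g z)%C by ring. rewrite E. ring.
Qed.

Lemma cder_cont f z l : cder f z l -> ccont f z.
Proof.
intros [p [Hp [_ E]]]. apply ccont_ext with (fun w => f z + p w * (w - z))%C.
- revert E. apply near_imp. auto.
- apply ccont_plus; [apply ccont_const|]. apply ccont_mult; [exact Hp|].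
  apply ccont_minus; [apply ccont_id|apply ccont_const].
Qed.

Lemma hol_cont f z : hol f z -> ccont f z.
Proof. intros [l H]. eapply cder_cont; eauto. Qed.

Lemma cder_ext f g z l : near z (fun w => f w = g w) -> cder f z l -> cder g z l.
Proof.
intros E [p [Hp [Hl H]]]. exists p. split; [exact Hp|]. split; [exact Hl|].
generalize (near_and _ _ _ E H). apply near_imp. intros w [<- ->]. now rewrite (near_self _ _ E).
Qed.

Lemma hol_ext f g z : near z (fun w => f w = g w) -> hol f z -> hol g z.
Proof. intros E [l H]. exists l. eapply cder_ext; eauto. Qed.

Lemma cder_const c z : cder (fun _ => c) z 0.
Proof.
exists (fun _ => 0%C). split; [apply ccont_const|]. split; [reflexivity|].
apply near_all. intros. ring.
Qed.

Lemma cder_id z : cder (fun w => w) z 1.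
Proof.
exists (fun _ => 1%C). split; [apply ccont_const|]. split; [reflexivity|].
apply near_all. intros. ring.
Qed.

Lemma cder_plus f g z l m : cder f z l -> cder g z m -> cder (fun w => f w + g w)%C z (l + m).
Proof.
intros [p [Hp [<- E]]] [q [Hq [<- F]]]. exists (fun w => p w + q w)%C.
split; [now apply ccont_plus|]. split; [reflexivity|].
generalize (near_and _ _ _ E F). apply near_imp. intros w [-> ->]. ring.
Qed.

Lemma cder_mult f g z l m :
  cder f z l -> cder g z m -> cder (fun w => f w * g w)%C z (l * g z + f z * m).
Proof.
intros Hf [q [Hq [<- F]]]. assert (Cf := Hf). apply cder_cont in Cf.
destruct Hf as [p [Hp [<- E]]].
exists (fun w => p w * g z + f w * q w)%C. split; [|split; [reflexivity|]].
- apply ccont_plus; apply ccont_mult; auto. apply ccont_const.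
- generalize (near_and _ _ _ E F). apply near_imp. intros w [-> ->]. ring.
Qed.

Lemma cder_opp f z l : cder f z l -> cder (fun w => - f w)%C z (- l).
Proof.
intros [p [Hp [<- E]]]. exists (fun w => - p w)%C.
split; [now apply ccont_opp|]. split; [reflexivity|].
revert E. apply near_imp. intros w ->. ring.
Qed.

Lemma cder_inv f z l : cder f z l -> f z <> 0 -> cder (fun w => / f w)%C z (- l / (f z * f z)).
Proof.
intros Hf Hz. assert (Cf := Hf). apply cder_cont in Cf.
destruct Hf as [p [Hp [<- E]]]. exists (fun w => - p w * / (f w * f z))%C.
split; [|split; [reflexivity|]].
- apply ccont_mult; [now apply ccont_opp|]. apply ccont_inv.
  + apply ccont_mult; [exact Cf|apply ccont_const].
  + now apply Cmult_neq_0.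
- generalize (near_and _ _ _ E (ccont_neq0 _ _ Cf Hz)). apply near_imp. intros w [H1 H2].
  assert (H3 : (p w * (w - z) = f w - f z)%C) by (rewrite H1; ring).
  replace (- p w * / (f w * f z) * (w - z))%C with (- (p w * (w - z)) / (f w * f z))%C
    by (field; auto).
  rewrite H3. field. auto.
Qed.

Lemma cder_comp f g z l m :
  cder f (g z) l -> cder g z m -> cder (fun w => f (g w)) z (l * m).
Proof.
intros [p [Hp [<- E]]] Hg. assert (Cg := Hg). apply cder_cont in Cg.
destruct Hg as [q [Hq [<- F]]]. exists (fun w => p (g w) * q w)%C.
split; [|split; [reflexivity|]].
- apply ccont_mult; [|exact Hq]. now apply ccont_comp.
- generalize (near_and _ _ _ (near_ccont _ _ _ Cg E) F). apply near_imp. intros w [-> H2].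
  rewrite H2 at 2. ring.
Qed.

Lemma hol_const c z : hol (fun _ => c) z.
Proof. eexists. apply cder_const. Qed.
Lemma hol_id z : hol (fun w => w) z.
Proof. eexists. apply cder_id. Qed.
Lemma hol_plus f g z : hol f z -> hol g z -> hol (fun w => f w + g w)%C z.
Proof. intros [l H] [m K]. eexists. now apply cder_plus; eauto. Qed.
Lemma hol_opp f z : hol f z -> hol (fun w => - f w)%C z.
Proof. intros [l H]. eexists. now apply cder_opp; eauto. Qed.
Lemma hol_minus f g z : hol f z -> hol g z -> hol (fun w => f w - g w)%C z.
Proof. intros. apply hol_plus; auto. now apply hol_opp. Qed.
Lemma hol_mult f g z : hol f z -> hol g z -> hol (fun w => f w * g w)%C z.
Proof. intros [l H] [m K]. eexists. now apply cder_mult; eauto. Qed.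
Lemma hol_inv f z : hol f z -> f z <> 0 -> hol (fun w => / f w)%C z.
Proof. intros [l H] Hz. eexists. apply cder_inv; eauto. Qed.
Lemma hol_div f g z : hol f z -> hol g z -> g z <> 0 -> hol (fun w => f w / g w)%C z.
Proof. intros. apply hol_mult; auto. now apply hol_inv. Qed.
Lemma hol_comp f g z : hol f (g z) -> hol g z -> hol (fun w => f (g w)) z.
Proof. intros [l H] [m K]. eexists. now apply cder_comp; eauto. Qed.

(** The quotient (f w - f z)/(w - z), completed by l at z, is the slope function that [cder] asks
    for. The form with e connects to the derivatives of the library and to real differentials. *)
Lemma cder_eps f z l :
  cder f z l <->
  forall e, 0 < e -> near z (fun w => Cmod (f w - f z - l * (w - z)) <= e * Cmod (w - z)).
Proof.
split.
- intros [p [Hp [<- E]]] e He. generalize (near_and _ _ _ E (Hp e He)). apply near_imp.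
  intros y [H1 H2]. rewrite H1.
  replace (f z + p y * (y - z) - f z - p z * (y - z))%C with ((p y - p z) * (y - z))%C by ring.
  rewrite Cmod_mult. apply Rmult_le_compat_r; [apply Cmod_ge_0|lra].
- intros H. exists (fun w => if Ceq_dec w z then l else (f w - f z) / (w - z))%C.
  split; [|split].
  + intros e He. assert (He2 : 0 < e / 2) by lra.
    generalize (H _ He2). apply near_imp. intros w Hw.
    destruct (Ceq_dec z z) as [_|]; [|congruence].
    destruct (Ceq_dec w z) as [->|Hn].
    * rewrite Cminus_diag, Cmod_0. exact He.
    * assert (Hn' := Cmod_minus_pos _ _ Hn).
      replace (f w - f z - l * (w - z))%C with (((f w - f z) / (w - z) - l) * (w - z))%C in Hw
        by (field; intros E1; rewrite E1, Cmod_0 in Hn'; lra).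
      rewrite Cmod_mult in Hw. apply Rmult_le_reg_r in Hw; [lra|exact Hn'].
  + destruct (Ceq_dec z z) as [_|]; [reflexivity|congruence].
  + apply near_all. intros w. destruct (Ceq_dec w z) as [->|Hn].
    * rewrite Cminus_diag. ring.
    * field. intros E. apply Hn. replace w with (w - z + z)%C by ring. rewrite E. ring.
Qed.

Lemma hol_ex_derive f z :
  hol f z <-> ex_derive (K:=C_AbsRing) (V:=C_NormedModule) f z.
Proof.
split.
- intros [l Hl]. exists l. split.
  + apply (is_linear_scal_l (K:=C_AbsRing) (V:=C_NormedModule)).
  + intros x Hx.
    apply (is_filter_lim_locally_unique (K:=C_AbsRing) (V:=AbsRing_NormedModule C_AbsRing)) in Hx.
    subst x. intros eps.
    destruct (proj1 (cder_eps f z l) Hl eps (cond_pos eps)) as [d [Hd H]].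
    exists (mkposreal d Hd). intros y Hy. specialize (H y Hy).
    change (Cmod ((f y - f z) - (y - z) * l)%C <= eps * Cmod (y - z)%C).
    rewrite (Cmult_comm (y - z) l). exact H.
- intros [l [_ H]]. specialize (H z (fun P HP => HP)). exists l. apply cder_eps.
  intros e He. destruct (H (mkposreal _ He)) as [d Hd]. exists d. split; [apply cond_pos|].
  intros w Hw. specialize (Hd w Hw).
  change (Cmod ((f w - f z) - (w - z) * l)%C <= e * Cmod (w - z)%C) in Hd.
  now rewrite (Cmult_comm l (w - z)).
Qed.

(** * Exponential, logarithm and powers *)

Lemma rcont_comp (g : R -> R) u z : continuity_pt g (u z) -> rcont u z -> rcont (fun w => g (u w)) z.
Proof.
intros Hg Hu e He. destruct (Hg e He) as [d [Hd H]].
generalize (Hu d Hd). apply near_imp. intros w Hw.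
destruct (Req_dec (u w) (u z)) as [E|E].
- rewrite E, Rminus_diag, Rabs_R0. exact He.
- apply H. split; [split; [exact I|auto]|exact Hw].
Qed.

Lemma rcont_const c z : rcont (fun _ => c) z.
Proof. intros e He. apply near_all. intros. rewrite Rminus_diag, Rabs_R0. exact He. Qed.

Lemma rcont_plus u v z : rcont u z -> rcont v z -> rcont (fun w => u w + v w) z.
Proof.
intros H1 H2 e He. assert (He2 : 0 < e/2) by lra.
generalize (near_and _ _ _ (H1 _ He2) (H2 _ He2)). apply near_imp. intros w [A B].
replace (u w + v w - (u z + v z)) with ((u w - u z) + (v w - v z)) by ring.
eapply Rle_lt_trans; [apply Rabs_triang|lra].
Qed.

Lemma ccont_RtoC u z : rcont u z -> ccont (fun w => RtoC (u w)) z.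
Proof.
intros H e He. generalize (H e He). apply near_imp. intros w Hw.
rewrite <- RtoC_minus, Cmod_R. exact Hw.
Qed.

Lemma rcont_mult u v z : rcont u z -> rcont v z -> rcont (fun w => u w * v w) z.
Proof.
intros H1 H2 e He. apply ccont_RtoC in H1. apply ccont_RtoC in H2.
generalize (ccont_mult _ _ _ H1 H2 e He). apply near_imp. intros w Hw.
rewrite <- !RtoC_mult, <- RtoC_minus, Cmod_R in Hw. exact Hw.
Qed.

Lemma rcont_inv u z : rcont u z -> u z <> 0 -> rcont (fun w => / u w) z.
Proof.
intros H1 H2. apply (rcont_comp Rinv); [|exact H1].
apply continuity_pt_inv; [|exact H2]. apply derivable_continuous_pt, derivable_pt_id.
Qed.

Lemma cexp_add (a b : C) : cexp (a + b) = (cexp a * cexp b)%C.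
Proof.
destruct a as [a1 a2], b as [b1 b2]. unfold cexp, Cmult, Cplus. simpl.
rewrite exp_plus, cos_plus, sin_plus. f_equal; ring.
Qed.

Lemma cexp_0 : cexp 0 = 1%C.
Proof. unfold cexp. simpl. rewrite exp_0, cos_0, sin_0. unfold RtoC. f_equal; ring. Qed.

Lemma Cmod_cexp z : Cmod (cexp z) = exp (Re z).
Proof.
unfold cexp, Cmod. simpl. pose proof (sin2_cos2 (Im z)) as H. unfold Rsqr in H.
replace (exp (Re z) * cos (Im z) * (exp (Re z) * cos (Im z) * 1) +
   exp (Re z) * sin (Im z) * (exp (Re z) * sin (Im z) * 1))
  with ((exp (Re z)) * exp (Re z) * (sin (Im z) * sin (Im z) + cos (Im z) * cos (Im z))) by ring.
rewrite H, Rmult_1_r. apply sqrt_square. left. apply exp_pos.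
Qed.

Lemma cexp_neq0 z : cexp z <> 0.
Proof. apply Cmod_gt_0. rewrite Cmod_cexp. apply exp_pos. Qed.

(** Total real differentiability with the Cauchy-Riemann equations for the derivative a + ib. The
    library measures increments by the larger coordinate, which [Cmod] dominates; each component
    takes e/2. *)
Lemma cder_CR f x y a b :
  differentiable_pt_lim (fun u v => Re (f (u, v))) x y a (- b) ->
  differentiable_pt_lim (fun u v => Im (f (u, v))) x y b a ->
  cder f (x, y) (a, b).
Proof.
intros H1 H2. apply cder_eps. intros e He.
assert (He2 : 0 < e / 2) by lra.
destruct (H1 (mkposreal _ He2)) as [d1 D1]. destruct (H2 (mkposreal _ He2)) as [d2 D2].
exists (Rmin d1 d2). split; [apply Rmin_glb_lt; apply cond_pos|].
intros [u v] Hw.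
assert (M := Rmax_Cmod ((u, v) - (x, y))%C). simpl in M.
assert (Mu : Rabs (u - x) <= Cmod ((u, v) - (x, y))%C) by (eapply Rle_trans; [apply Rmax_l|exact M]).
assert (Mv : Rabs (v - y) <= Cmod ((u, v) - (x, y))%C) by (eapply Rle_trans; [apply Rmax_r|exact M]).
pose proof (Rmin_l d1 d2). pose proof (Rmin_r d1 d2).
assert (A1 : Rabs (u - x) < d1) by lra. assert (A2 : Rabs (v - y) < d1) by lra.
assert (B1 : Rabs (u - x) < d2) by lra. assert (B2 : Rabs (v - y) < d2) by lra.
specialize (D1 u v A1 A2). specialize (D2 u v B1 B2). simpl in D1, D2.
assert (M' : Rmax (Rabs (u - x)) (Rabs (v - y)) <= Cmod ((u, v) - (x, y))%C) by exact M.
eapply Rle_trans; [apply Cmod_le_Re_Im|].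
replace (Re (f (u, v) - f (x, y) - (a, b) * ((u, v) - (x, y)))%C)
  with (Re (f (u, v)) - Re (f (x, y)) - (a * (u - x) + - b * (v - y)))
  by (unfold Re; simpl; ring).
replace (Im (f (u, v) - f (x, y) - (a, b) * ((u, v) - (x, y)))%C)
  with (Im (f (u, v)) - Im (f (x, y)) - (b * (u - x) + a * (v - y)))
  by (unfold Im; simpl; ring).
nra.
Qed.

Lemma differentiable_snd (h : R -> R) x y h' :
  is_derive h y h' -> differentiable_pt_lim (fun _ v => h v) x y 0 h'.
Proof.
intros Hh eps.
destruct (proj1 (is_derive_Reals _ _ _) Hh eps (cond_pos eps)) as [d Hd].
exists d. intros u v _ Hv.
destruct (Req_dec v y) as [->|N].
- replace (h y - h y - (0 * (u - x) + h' * (y - y))) with 0 by ring. rewrite Rabs_R0.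
  apply Rmult_le_pos; [left; apply cond_pos|]. eapply Rle_trans; [|apply Rmax_l]. apply Rabs_pos.
- assert (N' : v - y <> 0) by lra. specialize (Hd (v - y) N' Hv).
  replace (y + (v - y)) with v in Hd by ring.
  apply Rle_trans with (eps * Rabs (v - y)).
  + replace (h v - h y - (0 * (u - x) + h' * (v - y)))
      with (((h v - h y) / (v - y) - h') * (v - y)) by (field; exact N').
    rewrite Rabs_mult. apply Rmult_le_compat_r; [apply Rabs_pos|lra].
  + apply Rmult_le_compat_l; [left; apply cond_pos|apply Rmax_r].
Qed.

Lemma differentiable_mult x y : differentiable_pt_lim (fun a b => a * b) x y y x.
Proof.
intros eps. exists eps. intros u v Hu Hv.
replace (u * v - x * y - (y * (u - x) + x * (v - y))) with ((u - x) * (v - y)) by ring.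
rewrite Rabs_mult. apply Rmult_le_compat; try apply Rabs_pos; [lra|apply Rmax_r].
Qed.

Lemma differentiable_prod (g h : R -> R) x y g' h' :
  is_derive g x g' -> is_derive h y h' ->
  differentiable_pt_lim (fun u v => g u * h v) x y (g' * h y) (g x * h').
Proof.
intros Hg Hh.
replace (g' * h y) with (h y * g' + g x * 0) by ring.
replace (g x * h') with (h y * 0 + g x * h') by ring.
apply (differentiable_pt_lim_comp (fun a b => a * b) (fun u v => g u) (fun u v => h v)).
- apply differentiable_mult.
- apply (differentiable_pt_lim_proj1_0 g). exact (proj1 (is_derive_Reals _ _ _) Hg).
- now apply differentiable_snd.
Qed.

Lemma cder_differentiable f x y a b :
  cder f (x, y) (a, b) ->
  differentiable_pt_lim (fun u v => Re (f (u, v))) x y a (- b) /\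
  differentiable_pt_lim (fun u v => Im (f (u, v))) x y b a.
Proof.
intros H.
assert (K : forall eps : posreal, locally_2d (fun u v =>
   Cmod (f (u, v) - f (x, y) - (a, b) * ((u, v) - (x, y)))%C
     <= eps * Rmax (Rabs (u - x)) (Rabs (v - y))) x y).
{ intros eps. assert (He : 0 < eps / 2) by (pose proof (cond_pos eps); lra).
  destruct (proj1 (cder_eps _ _ _) H _ He) as [d [Hd D]].
  assert (Hd2 : 0 < d / 2) by lra. exists (mkposreal _ Hd2). simpl. intros u v Hu Hv.
  assert (M : Cmod ((u, v) - (x, y))%C <= Rabs (u - x) + Rabs (v - y)) by apply Cmod_le_Re_Im.
  eapply Rle_trans; [apply D; lra|].
  pose proof (Rmax_l (Rabs (u - x)) (Rabs (v - y))).
  pose proof (Rmax_r (Rabs (u - x)) (Rabs (v - y))). nra. }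
split; intros eps; destruct (K eps) as [d D]; exists d; intros u v Hu Hv;
  specialize (D u v Hu Hv); (eapply Rle_trans; [|exact D]).
- eapply Rle_trans; [|apply re_le_Cmod]. right. f_equal. unfold Re; simpl; ring.
- eapply Rle_trans; [|apply im_le_Cmod]. right. f_equal. unfold Im; simpl; ring.
Qed.

(** Both the normal derivative of Re H and the tangential derivative of Im H on the boundary are
    read off from l times the velocity of a curve. *)
Lemma cder_curve f (x y : R -> R) s u v l :
  cder f (x s, y s) l -> is_derive x s u -> is_derive y s v ->
  is_derive (fun s => Re (f (x s, y s))) s (Re (l * (u, v))%C) /\
  is_derive (fun s => Im (f (x s, y s))) s (Im (l * (u, v))%C).
Proof.
destruct l as [a b]. intros H Hx Hy. apply cder_differentiable in H. destruct H as [H1 H2].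
apply is_derive_Reals in Hx. apply is_derive_Reals in Hy.
split; apply is_derive_Reals.
- generalize (derivable_pt_lim_comp_2d _ _ _ _ _ _ _ _ H1 Hx Hy).
  unfold Re; simpl. intros E. replace (a * u - b * v) with (a * u + - b * v) by ring. exact E.
- generalize (derivable_pt_lim_comp_2d _ _ _ _ _ _ _ _ H2 Hx Hy).
  unfold Im; simpl. intros E. replace (a * v + b * u) with (b * u + a * v) by ring. exact E.
Qed.

Lemma cder_cexp z : cder cexp z (cexp z).
Proof.
destruct z as [x y]. unfold cexp at 2. simpl. apply cder_CR.
- unfold cexp; simpl. replace (- (exp x * sin y)) with (exp x * - sin y) by ring.
  apply differentiable_prod; [apply is_derive_exp|apply is_derive_cos].
- unfold cexp; simpl. apply differentiable_prod; [apply is_derive_exp|apply is_derive_sin].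
Qed.

Lemma hol_cexp z : hol cexp z.
Proof. eexists. apply cder_cexp. Qed.

(** A continuous right inverse of [cexp] is holomorphic: the slope function of [cexp] at L z,
    composed with L, is nonzero near z, and its reciprocal is a slope function of L. *)
Lemma cder_inverse (L : C -> C) (z : C) :
  z <> 0 -> ccont L z -> near z (fun w => cexp (L w) = w) -> cder L z (/ z).
Proof.
intros Hz HL E. destruct (cder_cexp (L z)) as [p [Hp [Hpz F]]].
rewrite (near_self _ _ E) in Hpz.
exists (fun w => / p (L w))%C. split; [|split; [now rewrite Hpz|]].
- apply ccont_inv; [now apply ccont_comp|rewrite Hpz; exact Hz].
- assert (N : near z (fun w => p (L w) <> 0)).
  { apply (ccont_neq0 (fun w => p (L w))); [now apply ccont_comp|rewrite Hpz; exact Hz]. }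
  generalize (near_and _ _ _ N (near_and _ _ _ E (near_ccont _ _ _ HL F))).
  apply near_imp. intros w [H1 [H2 H3]]. rewrite H2 in H3. rewrite (near_self _ _ E) in H3.
  assert (H4 : (w - z = p (L w) * (L w - L z))%C).
  { remember (p (L w) * (L w - L z))%C as X eqn:EX. clear EX. rewrite H3. ring. }
  rewrite H4. field. exact H1.
Qed.

(* A branch of the logarithm on the half plane Re z > 0. *)
Definition Lg (z : C) : C := (ln (Cmod z), atan (Im z / Re z)).

Lemma cos_sin_atan x : cos (atan x) = / sqrt (1 + x²) /\ sin (atan x) = x / sqrt (1 + x²).
Proof.
split; [rewrite cos_atan; unfold Rdiv; ring|apply sin_atan].
Qed.

Lemma Cmod_sq (z : C) : Cmod z * Cmod z = Re z * Re z + Im z * Im z.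
Proof. unfold Cmod. rewrite sqrt_sqrt; [unfold Re, Im; ring|]. nra. Qed.

Lemma sqrt_ratio x r y : 0 < x -> 0 < r -> r * r = x * x + y * y -> sqrt (1 + (y / x)²) = r / x.
Proof.
intros Hx Hr E. apply sqrt_lem_1.
- unfold Rsqr. nra.
- apply Rlt_le, Rdiv_lt_0_compat; lra.
- unfold Rsqr. field_simplify; [|lra|lra]. f_equal. nra.
Qed.

Lemma cexp_Lg z : 0 < Re z -> cexp (Lg z) = z.
Proof.
destruct z as [x y]. unfold Re; simpl. intros Hx.
assert (Hm : 0 < Cmod (x, y)).
{ apply Cmod_gt_0. intros E. injection E. lra. }
assert (E := Cmod_sq (x, y)). unfold Re, Im in E; simpl in E.
unfold cexp, Lg, Re, Im; simpl. rewrite exp_ln by exact Hm.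
destruct (cos_sin_atan (y / x)) as [-> ->].
rewrite (sqrt_ratio x (Cmod (x, y)) y) by assumption. f_equal; field; lra.
Qed.

Lemma rcont_fst z : rcont Re z.
Proof. apply (rcont_Re (fun w => w)), ccont_id. Qed.
Lemma rcont_snd z : rcont Im z.
Proof. apply (rcont_Im (fun w => w)), ccont_id. Qed.

Lemma rcont_ln u z : rcont u z -> 0 < u z -> rcont (fun w => ln (u w)) z.
Proof.
intros H Hu. apply (rcont_comp ln); [|exact H].
apply derivable_continuous_pt. exists (/ u z). now apply derivable_pt_lim_ln.
Qed.

Lemma rcont_atan u z : rcont u z -> rcont (fun w => atan (u w)) z.
Proof.
intros H. apply (rcont_comp atan); [|exact H].
apply derivable_continuous_pt. eexists. apply derivable_pt_lim_atan.
Qed.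

Lemma ccont_Lg z : 0 < Re z -> ccont Lg z.
Proof.
intros Hz. apply ccont_ReIm.
- apply (rcont_ln Cmod).
  + apply (rcont_Cmod (fun w => w)), ccont_id.
  + pose proof (re_le_Cmod z). pose proof (Rle_abs (Re z)). lra.
- apply (rcont_atan (fun w => Im w / Re w)). apply rcont_mult; [apply rcont_snd|].
  apply rcont_inv; [apply rcont_fst|lra].
Qed.

Lemma near_rcont_pos u z : rcont u z -> 0 < u z -> near z (fun w => 0 < u w).
Proof.
intros H Hu. generalize (H _ Hu). apply near_imp. intros w Hw. apply Rabs_def2 in Hw. lra.
Qed.

Lemma hol_Lg z : 0 < Re z -> hol Lg z.
Proof.
intros Hz. exists (/ z)%C. apply cder_inverse.
- intros ->. simpl in Hz. lra.
- now apply ccont_Lg.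
- generalize (near_rcont_pos _ _ (rcont_fst z) Hz). apply near_imp. apply cexp_Lg.
Qed.

(** The principal argument is defined by [acos], which hides its smoothness. Rotation by -i carries
    the upper half plane to the right one, where [Lg] is visibly smooth. *)
Lemma Clog_upper z : 0 < Im z -> Clog z = ((0, (PI / 2)%R) + Lg ((0, -1) * z))%C.
Proof.
destruct z as [x y]. unfold Im; simpl. intros Hy.
unfold Clog, Lg, Cplus. simpl. f_equal.
- rewrite Cmod_mult. replace (Cmod (0, -1)) with 1.
  + rewrite Rmult_1_l. ring.
  + unfold Cmod; simpl. replace (0 * (0 * 1) + -1 * (-1 * 1)) with 1 by ring. now rewrite sqrt_1.
- unfold carg, Im, Re; simpl. destruct (Rle_dec 0 y) as [_|N]; [|lra].
  replace ((0 * y + -1 * x) / (0 * x - -1 * y)) with (- (x / y)) by (field; lra).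
  rewrite atan_opp.
  assert (Hm : 0 < Cmod (x, y)). { apply Cmod_gt_0. intros E. injection E. lra. }
  assert (E := Cmod_sq (x, y)). unfold Re, Im in E; simpl in E.
  rewrite <- (acos_cos (PI / 2 + - atan (x / y))).
  + f_equal. replace (PI / 2 + - atan (x / y)) with (PI / 2 - atan (x / y)) by ring.
    rewrite cos_shift.
    destruct (cos_sin_atan (x / y)) as [_ ->].
    rewrite (sqrt_ratio y (Cmod (x, y)) x); [field; lra|lra|lra|lra].
  + pose proof (atan_bound (x / y)). lra.
Qed.

Lemma Clog_lower z : Im z < 0 -> Clog z = ((0, (- (PI / 2))%R) + Lg ((0, 1) * z))%C.
Proof.
destruct z as [x y]. unfold Im; simpl. intros Hy.
unfold Clog, Lg, Cplus. simpl. f_equal.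
- rewrite Cmod_mult. change (0, 1) with Ci. rewrite Cmod_Ci, Rmult_1_l. ring.
- unfold carg, Im, Re; simpl. destruct (Rle_dec 0 y) as [N|_]; [lra|].
  replace ((0 * y + 1 * x) / (0 * x - 1 * y)) with (x / - y) by (field; lra).
  assert (Hm : 0 < Cmod (x, y)). { apply Cmod_gt_0. intros E. injection E. lra. }
  assert (E := Cmod_sq (x, y)). unfold Re, Im in E; simpl in E.
  replace (- (PI / 2) + atan (x / - y)) with (- (PI / 2 - atan (x / - y))) by ring. f_equal.
  rewrite <- (acos_cos (PI / 2 - atan (x / - y))).
  + f_equal. rewrite cos_shift. destruct (cos_sin_atan (x / - y)) as [_ ->].
    rewrite (sqrt_ratio (- y) (Cmod (x, y)) x); [field; lra|lra|lra|lra].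
  + pose proof (atan_bound (x / - y)). lra.
Qed.

Lemma cexp_Clog (z : C) : z <> 0 -> cexp (Clog z) = z.
Proof.
intros Hz. assert (Hm : 0 < Cmod z) by now apply Cmod_gt_0.
assert (E := Cmod_sq z).
unfold cexp, Clog. unfold Re at 1 2, Im at 1 2; simpl. rewrite exp_ln by exact Hm.
assert (B : -1 <= Re z / Cmod z <= 1).
{ pose proof (re_le_Cmod z) as H. apply Rabs_le_between in H. split.
  - apply Rmult_le_reg_r with (Cmod z); [lra|]. unfold Rdiv. rewrite Rmult_assoc, Rinv_l; lra.
  - apply Rmult_le_reg_r with (Cmod z); [lra|]. unfold Rdiv. rewrite Rmult_assoc, Rinv_l; lra. }
assert (S : sqrt (1 - (Re z / Cmod z)²) = Rabs (Im z) / Cmod z).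
{ apply sqrt_lem_1.
  - unfold Rsqr. nra.
  - apply Rle_div_r; [lra|]. rewrite Rmult_0_l. apply Rabs_pos.
  - unfold Rsqr. replace (Rabs (Im z) / Cmod z * (Rabs (Im z) / Cmod z))
      with (Rabs (Im z) * Rabs (Im z) / (Cmod z * Cmod z)) by (field; lra).
    rewrite <- Rabs_mult, (Rabs_pos_eq (Im z * Im z)) by nra.
    replace (Im z * Im z) with (Cmod z * Cmod z - Re z * Re z) by lra. field. lra. }
unfold carg. destruct (Rle_dec 0 (Im z)) as [H|H].
- rewrite cos_acos, sin_acos by exact B. rewrite S, Rabs_pos_eq by exact H.
  apply injective_projections; simpl; fold (Re z) (Im z); field; lra.
- rewrite cos_neg, sin_neg, cos_acos, sin_acos by exact B. rewrite S, Rabs_left by lra.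
  apply injective_projections; simpl; fold (Re z) (Im z); field; lra.
Qed.

Lemma hol_Clog z : Im z <> 0 -> hol Clog z.
Proof.
intros Hz. destruct (Rlt_dec 0 (Im z)) as [H|H].
- apply hol_ext with (fun z => (0, (PI / 2)%R) + Lg ((0, -1) * z))%C.
  + generalize (near_rcont_pos _ _ (rcont_snd z) H). apply near_imp.
    intros w Hw. symmetry. now apply Clog_upper.
  + apply hol_plus; [apply hol_const|]. apply (hol_comp Lg).
    * apply hol_Lg. destruct z; unfold Re, Im in *; simpl in *. lra.
    * apply hol_mult; [apply hol_const|apply hol_id].
- apply hol_ext with (fun z => (0, (- (PI / 2))%R) + Lg ((0, 1) * z))%C.
  + assert (N : near z (fun w => 0 < - 1 * Im w)).
    { apply (near_rcont_pos (fun w => - 1 * Im w)); [|lra].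
      apply rcont_mult; [apply rcont_const|apply rcont_snd]. }
    revert N. apply near_imp. intros w Hw. symmetry. apply Clog_lower. lra.
  + apply hol_plus; [apply hol_const|]. apply (hol_comp Lg).
    * apply hol_Lg. destruct z; unfold Re, Im in *; simpl in *. lra.
    * apply hol_mult; [apply hol_const|apply hol_id].
Qed.

Lemma cpown_cexp l n : cpown (cexp l) n = cexp (RtoC (INR n) * l)%C.
Proof.
induction n as [|n IH].
- simpl. replace (RtoC 0 * l)%C with (RtoC 0) by ring. now rewrite cexp_0.
- rewrite S_INR. simpl cpown. rewrite IH, <- cexp_add. f_equal. rewrite RtoC_plus. ring.
Qed.

Lemma cexp_opp z : cexp (- z) = (/ cexp z)%C.
Proof.
assert (H : (cexp (- z) * cexp z)%C = 1%C).
{ rewrite <- cexp_add. replace (- z + z)%C with (RtoC 0) by ring. apply cexp_0. }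
pose proof (cexp_neq0 z).
replace (cexp (- z)) with (cexp (- z) * cexp z / cexp z)%C by (field; auto).
rewrite H. field. auto.
Qed.

Lemma czpow_cexp l n : czpow (cexp l) n = cexp (RtoC (IZR n) * l)%C.
Proof.
destruct n as [|p|p]; simpl czpow.
- replace (RtoC (IZR 0) * l)%C with (RtoC 0) by (simpl; ring). now rewrite cexp_0.
- rewrite cpown_cexp. f_equal. f_equal. f_equal. rewrite INR_IZR_INZ, positive_nat_Z. reflexivity.
- rewrite cpown_cexp, <- cexp_opp. f_equal.
  rewrite INR_IZR_INZ, positive_nat_Z.
  change (Z.neg p) with (- Z.pos p)%Z. rewrite opp_IZR, RtoC_opp. ring.
Qed.

Lemma ex_log (z : C) : z <> 0 -> exists l, cexp l = z.
Proof. exists (Clog z). now apply cexp_Clog. Qed.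

Lemma czpow_neq0 (z : C) n : z <> 0 -> czpow z n <> 0.
Proof. intros H. destruct (ex_log z H) as [l <-]. rewrite czpow_cexp. apply cexp_neq0. Qed.

Lemma czpow_add (z : C) n m : z <> 0 -> czpow z (n + m) = (czpow z n * czpow z m)%C.
Proof.
intros H. destruct (ex_log z H) as [l <-]. rewrite !czpow_cexp, <- cexp_add. f_equal.
rewrite plus_IZR, RtoC_plus. ring.
Qed.

Lemma czpow_mult (z w : C) n : z <> 0 -> w <> 0 -> czpow (z * w) n = (czpow z n * czpow w n)%C.
Proof.
intros H H'. destruct (ex_log z H) as [l <-]. destruct (ex_log w H') as [m <-].
rewrite <- cexp_add, !czpow_cexp, <- cexp_add. f_equal. ring.
Qed.

Lemma czpow_opp (z : C) n : z <> 0 -> czpow z (- n) = (/ czpow z n)%C.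
Proof.
intros H. destruct (ex_log z H) as [l <-]. rewrite !czpow_cexp, <- cexp_opp. f_equal.
rewrite opp_IZR, RtoC_opp. ring.
Qed.

Lemma Cmod_czpow (z : C) n : z <> 0 -> Cmod (czpow z n) = exp (IZR n * ln (Cmod z)).
Proof.
intros H. destruct (ex_log z H) as [l <-]. rewrite czpow_cexp, !Cmod_cexp, ln_exp.
f_equal. destruct l; unfold Re; simpl; ring.
Qed.

Lemma hol_cpown n z : hol (fun w => cpown w n) z.
Proof.
induction n as [|n IH]; simpl; [apply hol_const|]. apply hol_mult; [apply hol_id|exact IH].
Qed.

Lemma hol_czpow n (z : C) : z <> 0 -> hol (fun w => czpow w n) z.
Proof.
intros H. destruct n as [|p|p]; simpl.
- apply hol_const.
- apply hol_cpown.
- apply (hol_inv (fun w => cpown w (Pos.to_nat p))); [apply hol_cpown|].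
  apply (czpow_neq0 z (Z.pos p) H).
Qed.

Lemma Cmod_Cpowr z r : Cmod (Cpowr z r) = exp (r * ln (Cmod z)).
Proof.
unfold Cpowr. rewrite Cmod_cexp. f_equal. unfold Clog, Re; simpl. ring.
Qed.

(** * Orders and Moebius transformations *)

(** The relation [is_order] with its radii absorbed in [near] and [pnear]; the two agree at points
    of H. *)
Definition is_ord (f : C -> C) (t : C) (n : Z) : Prop :=
  exists g, near t (hol g) /\ g t <> 0 /\ pnear t (fun w => f w = (czpow (w - t) n * g w)%C).

Lemma is_order_is_ord f t n : 0 < Im t -> (is_order f t n <-> is_ord f t n).
Proof.
intros Ht. split.
- intros [r [Hr [_ [g [Hg [H0 Hf]]]]]]. exists g. split; [|split; [exact H0|]].
  + exists r. split; [exact Hr|]. intros w Hw. apply hol_ex_derive. now apply Hg.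
  + exists r. split; [exact Hr|]. exact Hf.
- intros [g [[d [Hd Hg]] [H0 [e [He Hf]]]]].
  exists (Rmin (Im t) (Rmin d e)).
  pose proof (Rmin_l (Im t) (Rmin d e)). pose proof (Rmin_r (Im t) (Rmin d e)).
  pose proof (Rmin_l d e). pose proof (Rmin_r d e).
  split; [repeat apply Rmin_glb_lt; assumption|]. split; [assumption|].
  exists g. split; [|split; [exact H0|]].
  + intros w Hw. apply hol_ex_derive, Hg. lra.
  + intros w Hw. apply Hf. lra.
Qed.

Lemma locally_zero_pnear f t : 0 < Im t -> (locally_zero f t <-> pnear t (fun w => f w = 0)).
Proof.
intros Ht. split.
- intros [r [Hr [_ H]]]. exists r. auto.
- intros [d [Hd H]]. exists (Rmin (Im t) d).
  pose proof (Rmin_l (Im t) d). pose proof (Rmin_r (Im t) d).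
  split; [apply Rmin_glb_lt; assumption|]. split; [assumption|]. intros w Hw. apply H. lra.
Qed.

Lemma mero_eq_pnear f g t : 0 < Im t -> mero_eq f g -> pnear t (fun w => f w = g w).
Proof. intros Ht H. destruct (H t Ht) as [r [Hr [_ K]]]. exists r. auto. Qed.

Lemma pnear_sub_neq0 t : pnear t (fun w => (w - t)%C <> 0).
Proof.
generalize (pnear_neq t). apply pnear_imp. intros w Hw E. apply Hw.
replace w with (w - t + t)%C by ring. rewrite E. ring.
Qed.

Lemma is_ord_ext f f' t n : pnear t (fun w => f w = f' w) -> is_ord f t n -> is_ord f' t n.
Proof.
intros E [g [Hg [H0 Hf]]]. exists g. split; [exact Hg|]. split; [exact H0|].
generalize (pnear_and _ _ _ E Hf). apply pnear_imp. intros w [<- H]. exact H.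
Qed.

Lemma ccont_sub t z : ccont (fun w => w - t)%C z.
Proof. apply ccont_minus; [apply ccont_id|apply ccont_const]. Qed.

Lemma hol_sub t z : hol (fun w => w - t)%C z.
Proof. apply hol_minus; [apply hol_id|apply hol_const]. Qed.

(** If n < m, then g = (w - t)^(m-n) h on a punctured neighbourhood, and continuity would give g t =
    0. *)
Lemma is_ord_unique_lt f t n m : is_ord f t n -> is_ord f t m -> ~ (n < m)%Z.
Proof.
intros [g [Hg [H0 Hf]]] [h [Hh [_ Kf]]] Hlt. apply H0.
set (k := Z.to_nat (m - n)).
assert (Hk : (m = n + Z.pos (Pos.of_nat k))%Z) by (unfold k; lia).
rewrite (ccont_pnear_eq g (fun w => cpown (w - t) (Pos.to_nat (Pos.of_nat k)) * h w)%C t).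
- rewrite Cminus_diag. destruct (Pos2Nat.is_succ (Pos.of_nat k)) as [j ->]. simpl. ring.
- apply hol_cont. exact (near_self _ _ Hg).
- apply ccont_mult.
  + apply (ccont_comp (fun z => cpown z _) (fun w => w - t)%C); [|apply ccont_sub].
    apply hol_cont, hol_cpown.
  + apply hol_cont. exact (near_self _ _ Hh).
- generalize (pnear_and _ _ _ (pnear_sub_neq0 t) (pnear_and _ _ _ Hf Kf)). apply pnear_imp.
  intros w [N [E1 E2]]. rewrite E1, Hk, czpow_add in E2 by exact N.
  pose proof (czpow_neq0 _ n N).
  replace (g w) with (czpow (w - t) n * g w / czpow (w - t) n)%C by (field; auto).
  rewrite E2. simpl czpow at 2. field. auto.
Qed.

Lemma is_ord_unique f t n m : is_ord f t n -> is_ord f t m -> n = m.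
Proof.
intros H K. pose proof (is_ord_unique_lt _ _ _ _ H K). pose proof (is_ord_unique_lt _ _ _ _ K H). lia.
Qed.

Lemma is_ord_mult f g t n m :
  is_ord f t n -> is_ord g t m -> is_ord (fun w => f w * g w)%C t (n + m).
Proof.
intros [h [Hh [H0 Hf]]] [k [Hk [K0 Hg]]]. exists (fun w => h w * k w)%C.
split; [|split].
- generalize (near_and _ _ _ Hh Hk). apply near_imp. intros w [A B]. now apply hol_mult.
- now apply Cmult_neq_0.
- generalize (pnear_and _ _ _ (pnear_sub_neq0 t) (pnear_and _ _ _ Hf Hg)). apply pnear_imp.
  intros w [N [-> ->]]. rewrite czpow_add by exact N. ring.
Qed.

Lemma is_ord_hol g t : near t (hol g) -> g t <> 0 -> is_ord g t 0.
Proof.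
intros Hg H0. exists g. split; [exact Hg|]. split; [exact H0|].
apply near_pnear, near_all. intros w. simpl. ring.
Qed.

Lemma is_ord_czpow t n : is_ord (fun w => czpow (w - t) n) t n.
Proof.
exists (fun _ => 1%C). split; [apply near_all; intros; apply hol_const|].
split; [apply C1_nz|]. apply near_pnear, near_all. intros w. ring.
Qed.

Lemma hol_czpow_sub t n w : w <> t -> hol (fun w => czpow (w - t) n) w.
Proof.
intros N. apply (hol_comp (fun z => czpow z n) (fun w => w - t)%C); [|apply hol_sub].
apply hol_czpow. intros E. apply N. replace w with (w - t + t)%C by ring. rewrite E. ring.
Qed.

(** Away from t the power of w - t is itself holomorphic and nonzero. Hence zeros and poles are
    isolated, as the next two lemmas record. *)
Lemma is_ord_form f t n : is_ord f t n ->
  exists g, pnear t (fun w => near w (fun v => f v = g v) /\ near w (hol g) /\ g w <> 0).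
Proof.
intros [g [Hg [H0 Hf]]]. exists (fun w => czpow (w - t) n * g w)%C.
assert (C0 : near t (fun w => g w <> 0)).
{ apply ccont_neq0; [|exact H0]. apply hol_cont. exact (near_self _ _ Hg). }
generalize (pnear_and _ _ _ (pnear_pnear _ _ Hf)
  (pnear_and _ _ _ (near_pnear _ _ (near_and _ _ _ (near_near _ _ Hg) C0))
    (pnear_and _ _ _ (pnear_sub_neq0 t) (pnear_pnear _ _ (pnear_neq t))))).
apply pnear_imp. intros w [A [[B B0] [N N']]]. split; [exact A|]. split.
- generalize (near_and _ _ _ B N'). apply near_imp. intros v [V1 V2].
  apply hol_mult; [now apply hol_czpow_sub|exact V1].
- apply Cmult_neq_0; [now apply czpow_neq0|exact B0].
Qed.

Lemma is_ord_near0 f t n : is_ord f t n -> pnear t (fun w => is_ord f w 0).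
Proof.
intros H. destruct (is_ord_form _ _ _ H) as [g Hg]. revert Hg. apply pnear_imp.
intros w [A [B C0]]. apply is_ord_ext with g.
- apply near_pnear. revert A. apply near_imp. auto.
- now apply is_ord_hol.
Qed.

Lemma is_ord_neq0 f t n : is_ord f t n -> pnear t (fun w => f w <> 0).
Proof.
intros H. destruct (is_ord_form _ _ _ H) as [g Hg]. revert Hg. apply pnear_imp.
intros w [A [_ C0]]. now rewrite (near_self _ _ A).
Qed.

(** With psi w - psi t = (w - t) k w and k t nonzero, the power k^n joins the nonvanishing factor
    and the order is unchanged. For Moebius maps [mob_sub] supplies k. *)
Lemma is_ord_comp f psi k t n :
  is_ord f (psi t) n -> near t (hol psi) -> near t (hol k) -> k t <> 0 ->
  near t (fun w => (psi w - psi t = (w - t) * k w)%C) -> is_ord (fun w => f (psi w)) t n.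
Proof.
intros [g [Hg [H0 Hf]]] Hpsi Hk K0 E.
assert (Cpsi : ccont psi t) by (apply hol_cont; exact (near_self _ _ Hpsi)).
assert (NK : near t (fun w => k w <> 0)).
{ apply ccont_neq0; [|exact K0]. apply hol_cont. exact (near_self _ _ Hk). }
exists (fun w => czpow (k w) n * g (psi w))%C. split; [|split].
- generalize (near_and _ _ _ (near_and _ _ _ Hpsi Hk) (near_and _ _ _ NK (near_ccont _ _ _ Cpsi Hg))).
  apply near_imp. intros w [[A B] [N D]]. apply hol_mult.
  + apply (hol_comp (fun z => czpow z n)); [now apply hol_czpow|exact B].
  + now apply hol_comp.
- apply Cmult_neq_0; [now apply czpow_neq0|exact H0].
- destruct Hf as [d [Hd Hf]].
  generalize (pnear_and _ _ _ (pnear_sub_neq0 t)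
    (near_pnear _ _ (near_and _ _ _ (Cpsi d Hd) (near_and _ _ _ NK E)))).
  apply pnear_imp. intros w [N [A [B D]]].
  rewrite Hf.
  + rewrite D, czpow_mult by assumption. ring.
  + split; [|exact A]. rewrite D. apply Cmod_gt_0. now apply Cmult_neq_0.
Qed.

(** * Moebius transformations and the automorphy factor *)

Definition den (A : mat) (t : C) : C := (ZtoC (mc A) * t + ZtoC (md A))%C.

Lemma mob_den A t : mob A t = ((ZtoC (ma A) * t + ZtoC (mb A)) / den A t)%C.
Proof. reflexivity. Qed.

Lemma ZtoC_mult a b : ZtoC (a * b) = (ZtoC a * ZtoC b)%C.
Proof. unfold ZtoC. now rewrite mult_IZR, RtoC_mult. Qed.
Lemma ZtoC_plus a b : ZtoC (a + b) = (ZtoC a + ZtoC b)%C.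
Proof. unfold ZtoC. now rewrite plus_IZR, RtoC_plus. Qed.
Lemma ZtoC_opp a : ZtoC (- a) = (- ZtoC a)%C.
Proof. unfold ZtoC. now rewrite opp_IZR, RtoC_opp. Qed.

Lemma SL2Z_eq A : SL2Z A -> (ma A * md A - mb A * mc A = 1)%Z.
Proof. auto. Qed.

Lemma SL2Z_C A : SL2Z A -> (ZtoC (ma A) * ZtoC (md A) - ZtoC (mb A) * ZtoC (mc A) = 1)%C.
Proof.
intros H. rewrite <- !ZtoC_mult. unfold ZtoC. rewrite <- RtoC_minus, <- minus_IZR.
rewrite (SL2Z_eq _ H). reflexivity.
Qed.

Lemma Im_den A t : Im (den A t) = IZR (mc A) * Im t.
Proof. destruct t. unfold den, ZtoC, Im; simpl. ring. Qed.
Lemma Re_den A t : Re (den A t) = IZR (mc A) * Re t + IZR (md A).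
Proof. destruct t. unfold den, ZtoC, Re; simpl. ring. Qed.

Lemma den_neq0 A t : SL2Z A -> 0 < Im t -> den A t <> 0.
Proof.
intros HA Ht E. assert (E1 := Im_den A t). assert (E2 := Re_den A t).
rewrite E in E1, E2. simpl in E1, E2.
assert (Hc : IZR (mc A) = 0) by nra. rewrite Hc in E2.
assert (Hd : IZR (md A) = 0) by lra. apply eq_IZR in Hc. apply eq_IZR in Hd.
apply SL2Z_eq in HA. rewrite Hc, Hd in HA. lia.
Qed.

Lemma SL2Z_mmul A B : SL2Z A -> SL2Z B -> SL2Z (mmul A B).
Proof. unfold SL2Z, mdet, mmul; destruct A, B; simpl; intros. nia. Qed.
Lemma SL2Z_minv A : SL2Z A -> SL2Z (minv A).
Proof. unfold SL2Z, mdet, minv; destruct A; simpl; intros. nia. Qed.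
Lemma SL2Z_mI : SL2Z mI.
Proof. reflexivity. Qed.
Lemma SL2Z_mneg A : SL2Z A -> SL2Z (mneg A).
Proof. unfold SL2Z, mdet, mneg; destruct A; simpl; intros. nia. Qed.

Lemma mmul_assoc A B D : mmul A (mmul B D) = mmul (mmul A B) D.
Proof. unfold mmul; simpl. f_equal; ring. Qed.
Lemma mmul_1_l A : mmul mI A = A.
Proof. destruct A. unfold mmul, mI; cbn -[Z.mul Z.add]. f_equal; ring. Qed.
Lemma mmul_1_r A : mmul A mI = A.
Proof. destruct A. unfold mmul, mI; cbn -[Z.mul Z.add]. f_equal; ring. Qed.
Lemma mmul_inv_r A : SL2Z A -> mmul A (minv A) = mI.
Proof. destruct A. unfold SL2Z, mdet, mmul, minv, mI; simpl. intros. f_equal; nia. Qed.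
Lemma mmul_inv_l A : SL2Z A -> mmul (minv A) A = mI.
Proof. destruct A. unfold SL2Z, mdet, mmul, minv, mI; simpl. intros. f_equal; nia. Qed.
Lemma minv_mmul A B : minv (mmul A B) = mmul (minv B) (minv A).
Proof. unfold mmul, minv; simpl. f_equal; ring. Qed.
Lemma minv_inv A : minv (minv A) = A.
Proof. destruct A. unfold minv; simpl. f_equal; ring. Qed.
Lemma mneg_mneg A : mneg (mneg A) = A.
Proof. destruct A. unfold mneg; simpl. f_equal; ring. Qed.
Lemma mmul_mneg_l A B : mmul (mneg A) B = mneg (mmul A B).
Proof. unfold mmul, mneg; simpl. f_equal; ring. Qed.
Lemma mmul_mneg_r A B : mmul A (mneg B) = mneg (mmul A B).
Proof. unfold mmul, mneg; simpl. f_equal; ring. Qed.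
Lemma minv_mneg A : minv (mneg A) = mneg (minv A).
Proof. reflexivity. Qed.

Lemma den_mmul A B t : SL2Z B -> 0 < Im t -> den (mmul A B) t = (den A (mob B t) * den B t)%C.
Proof.
intros HB Ht. pose proof (den_neq0 B t HB Ht) as N. rewrite mob_den. unfold den at 1 2, mmul; simpl.
rewrite !ZtoC_plus, !ZtoC_mult. unfold den in *. field. exact N.
Qed.

Lemma mob_sub A w t : SL2Z A -> 0 < Im w -> 0 < Im t ->
  (mob A w - mob A t = (w - t) * / (den A w * den A t))%C.
Proof.
intros HA Hw Ht. rewrite !mob_den. pose proof (den_neq0 A w HA Hw). pose proof (den_neq0 A t HA Ht).
transitivity ((ZtoC (ma A) * ZtoC (md A) - ZtoC (mb A) * ZtoC (mc A)) * (w - t) / (den A w * den A t))%C.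
- unfold den in *. field. auto.
- rewrite (SL2Z_C _ HA). field. auto.
Qed.

Lemma Im_mob A t : SL2Z A -> 0 < Im t -> Im (mob A t) = Im t / (Cmod (den A t) * Cmod (den A t)).
Proof.
intros HA Ht. assert (N := den_neq0 A t HA Ht).
assert (Np : 0 < Cmod (den A t)) by now apply Cmod_gt_0.
assert (E := Cmod_sq (den A t)). rewrite Im_den, Re_den in E. rewrite E.
assert (E' : IZR (ma A) * IZR (md A) - IZR (mb A) * IZR (mc A) = 1).
{ rewrite <- !mult_IZR, <- minus_IZR. now rewrite (SL2Z_eq _ HA). }
assert (P : 0 < Cmod (den A t) * Cmod (den A t)) by nra. rewrite E in P.
destruct t as [x y]. unfold mob, ZtoC, Cdiv, Cinv, Im, Re in *. simpl in *.
transitivity (y * (IZR (ma A) * IZR (md A) - IZR (mb A) * IZR (mc A)) /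
 ((IZR (mc A) * x + IZR (md A)) * (IZR (mc A) * x + IZR (md A)) + IZR (mc A) * y * (IZR (mc A) * y))).
- field. nra.
- rewrite E'. field. nra.
Qed.

Lemma Im_mob_pos A t : SL2Z A -> 0 < Im t -> 0 < Im (mob A t).
Proof.
intros HA Ht. rewrite Im_mob by assumption.
assert (0 < Cmod (den A t)) by now apply Cmod_gt_0, den_neq0.
apply Rdiv_lt_0_compat; nra.
Qed.

Lemma mob_mmul A B t : SL2Z A -> SL2Z B -> 0 < Im t -> mob (mmul A B) t = mob A (mob B t).
Proof.
intros HA HB Ht. pose proof (den_neq0 B t HB Ht) as N.
pose proof (den_neq0 A _ HA (Im_mob_pos B t HB Ht)) as M.
rewrite (mob_den (mmul A B)), (mob_den A), den_mmul by assumption.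
transitivity ((ZtoC (ma A) * mob B t + ZtoC (mb A)) * den B t / (den A (mob B t) * den B t))%C.
- f_equal. rewrite mob_den. unfold mmul; simpl. rewrite !ZtoC_plus, !ZtoC_mult. unfold den in *. field. exact N.
- field. auto.
Qed.

Lemma mob_mI t : mob mI t = t.
Proof. unfold mob, mI, ZtoC; simpl. field. Qed.

Lemma mob_mneg A t : SL2Z A -> 0 < Im t -> mob (mneg A) t = mob A t.
Proof.
intros HA Ht. pose proof (den_neq0 A t HA Ht) as N. unfold mob, mneg; simpl.
rewrite !ZtoC_opp. unfold den in N. field. split; [exact N|].
intros E. apply N. replace (ZtoC (mc A) * t + ZtoC (md A))%C
  with (- (- ZtoC (mc A) * t + - ZtoC (md A)))%C by ring. rewrite E. ring.
Qed.

Lemma den_mneg A t : den (mneg A) t = (- den A t)%C.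
Proof. unfold den, mneg; simpl. rewrite !ZtoC_opp. ring. Qed.

Lemma mob_minv_l A t : SL2Z A -> 0 < Im t -> mob (minv A) (mob A t) = t.
Proof.
intros HA Ht. rewrite <- mob_mmul by auto using SL2Z_minv. now rewrite mmul_inv_l, mob_mI.
Qed.

Lemma near_Im t : 0 < Im t -> near t (fun w => 0 < Im w).
Proof. apply near_rcont_pos, rcont_snd. Qed.

Lemma hol_den A t : hol (den A) t.
Proof.
unfold den. apply hol_plus; [|apply hol_const]. apply hol_mult; [apply hol_const|apply hol_id].
Qed.

Lemma hol_mob A t : SL2Z A -> 0 < Im t -> hol (mob A) t.
Proof.
intros HA Ht. unfold mob. apply (hol_div (fun t => ZtoC (ma A) * t + ZtoC (mb A))%C (den A)).
- apply hol_plus; [|apply hol_const]. apply hol_mult; [apply hol_const|apply hol_id].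
- apply hol_den.
- now apply den_neq0.
Qed.

Lemma is_ord_mob f A t n : SL2Z A -> 0 < Im t -> is_ord f (mob A t) n -> is_ord (fun w => f (mob A w)) t n.
Proof.
intros HA Ht H. apply (is_ord_comp f (mob A) (fun w => / (den A w * den A t))%C); auto.
- generalize (near_Im t Ht). apply near_imp. intros w Hw. now apply hol_mob.
- generalize (near_Im t Ht). apply near_imp. intros w Hw.
  apply (hol_inv (fun w => den A w * den A t)%C).
  + apply hol_mult; [apply hol_den|apply hol_const].
  + apply Cmult_neq_0; now apply den_neq0.
- intros E. assert (N := den_neq0 A t HA Ht).
  assert (N2 : (den A t * den A t)%C <> 0) by now apply Cmult_neq_0.
  apply C1_nz. rewrite <- (Cinv_r _ N2), E. ring.
- generalize (near_Im t Ht). apply near_imp. intros w Hw. now apply mob_sub.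
Qed.

Lemma pnear_mob A t P : SL2Z A -> 0 < Im t -> pnear (mob A t) P -> pnear t (fun w => P (mob A w)).
Proof.
intros HA Ht [d [Hd HP]].
generalize (pnear_and _ _ _ (pnear_sub_neq0 t) (near_pnear _ _ (near_and _ _ _ (near_Im t Ht)
  (hol_cont _ _ (hol_mob A t HA Ht) d Hd)))).
apply pnear_imp. intros w [N [Hw Hm]]. apply HP. split; [|exact Hm].
rewrite mob_sub by assumption. apply Cmod_gt_0. apply Cmult_neq_0; [exact N|].
apply Cmod_gt_0. rewrite Cmod_inv by (apply Cmult_neq_0; now apply den_neq0).
apply Rinv_0_lt_compat, Cmod_gt_0, Cmult_neq_0; now apply den_neq0.
Qed.

(** On H the denominator ct + d is never real or, when c = 0, constant; in neither case is the cut
    of the principal logarithm crossed. *)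
Lemma hol_Clog_den A t : SL2Z A -> 0 < Im t -> hol (fun t => Clog (den A t)) t.
Proof.
intros HA Ht. destruct (Z.eq_dec (mc A) 0) as [E|E].
- apply hol_ext with (fun _ => Clog (ZtoC (md A))); [|apply hol_const].
  apply near_all. intros w. unfold den. rewrite E. f_equal. unfold ZtoC. simpl. ring.
- apply (hol_comp Clog); [|apply hol_den]. apply hol_Clog. rewrite Im_den.
  apply Rmult_integral_contrapositive. split; [|lra]. intros H. apply E. now apply eq_IZR.
Qed.

Lemma cphi_cexp D A t : cphi D A 1 t = cexp (RtoC (/ INR D) * Clog (den A t)).
Proof. unfold cphi, Cpowr. fold (den A t). ring. Qed.

Lemma is_ord_slash D kn A f t n :
  SL2Z A -> 0 < Im t -> is_ord f (mob A t) n -> is_ord (slash D kn A 1 f) t n.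
Proof.
intros HA Ht H. replace n with (0 + n)%Z by ring. unfold slash. apply is_ord_mult; [|now apply is_ord_mob].
apply is_ord_ext with (fun t => czpow (cexp (RtoC (/ INR D) * Clog (den A t))) (- kn)).
- apply near_pnear, near_all. intros w. now rewrite cphi_cexp.
- apply is_ord_hol.
  + generalize (near_Im t Ht). apply near_imp. intros w Hw.
    apply (hol_comp (fun z => czpow z (- kn))); [apply hol_czpow, cexp_neq0|].
    apply (hol_comp cexp); [apply hol_cexp|]. apply hol_mult; [apply hol_const|].
    now apply hol_Clog_den.
  + apply czpow_neq0, cexp_neq0.
Qed.

(** The root of unity and the branch of the D-th root disappear in absolute value, and only the real
    weight is left. *)
Lemma Cmod_slash D kn A eps f t :
  (1 <= D)%nat -> Cmod eps = 1 -> SL2Z A -> 0 < Im t ->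
  Cmod (slash D kn A eps f t) = exp (- weight D kn * ln (Cmod (den A t))) * Cmod (f (mob A t)).
Proof.
intros HD He HA Ht. unfold slash. rewrite Cmod_mult. f_equal.
assert (E : Cmod (cphi D A eps t) = exp (/ INR D * ln (Cmod (den A t)))).
{ unfold cphi. rewrite Cmod_mult, He, Cmod_Cpowr. fold (den A t). ring. }
rewrite Cmod_czpow.
- rewrite E, ln_exp. f_equal. unfold weight. rewrite opp_IZR.
  assert (INR D <> 0) by (apply not_0_INR; lia). field. assumption.
- apply Cmod_gt_0. rewrite E. apply exp_pos.
Qed.

(** * Factorization on rectangles *)

Lemma near_curve (x y : R -> R) s P :
  continuous x s -> continuous y s -> near (x s, y s) P -> locally s (fun s' => P (x s', y s')).
Proof.
intros Hx Hy [d [Hd H]]. assert (Hd2 : 0 < d / 2) by lra.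
pose proof (proj1 (filterlim_locally _ _) Hx (mkposreal _ Hd2)) as Lx.
pose proof (proj1 (filterlim_locally _ _) Hy (mkposreal _ Hd2)) as Ly.
generalize (filter_and _ _ Lx Ly). apply filter_imp. intros s' [A B].
apply H. eapply Rle_lt_trans; [apply Cmod_le_Re_Im|].
change (Rabs (x s' - x s) < d / 2) in A. change (Rabs (y s' - y s) < d / 2) in B.
unfold Re, Im; simpl. unfold Rminus in *. lra.
Qed.

(** Vanishing identically near a point is an open condition, and so is having an order, since near a
    point of order n the function has order 0. The two exclude each other. *)
Lemma near_transfer (f : C -> C) t : 0 < Im t ->
  pnear t (fun w => f w = 0) \/ (exists n, is_ord f t n) ->
  near t (fun w => pnear w (fun v => f v = 0) <-> pnear t (fun v => f v = 0)).
Proof.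
intros Ht [H|[n H]].
- apply pnear_near; [tauto|]. generalize (pnear_pnear _ _ H). apply pnear_imp.
  intros w Hw. split; [auto|]. intros _. now apply near_pnear.
- assert (N : ~ pnear t (fun v => f v = 0)).
  { intros K. destruct (pnear_ex _ _ (pnear_and _ _ _ K (is_ord_neq0 _ _ _ H))) as [w [_ [A B]]]. auto. }
  apply pnear_near; [tauto|]. generalize (is_ord_near0 _ _ _ H). apply pnear_imp.
  intros w Hw. split; [|tauto]. intros K. exfalso.
  destruct (pnear_ex _ _ (pnear_and _ _ _ K (is_ord_neq0 _ _ _ Hw))) as [v [_ [A B]]]. auto.
Qed.

(** Identity theorem along a segment: if f vanished identically near t1, the indicator of local
    vanishing would be constant on the segment to any t0, and f would be zero. *)
Lemma all_ord f : meromorphic f -> mero_nonzero f -> forall t, 0 < Im t -> exists n, is_ord f t n.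
Proof.
intros Hm Hn.
assert (D : forall t, 0 < Im t -> pnear t (fun w => f w = 0) \/ (exists n, is_ord f t n)).
{ intros t Ht. destruct (Hm t Ht) as [H|[n H]].
  - left. now apply locally_zero_pnear.
  - right. exists n. now apply is_order_is_ord. }
intros t1 Ht1. destruct (D t1 Ht1) as [Z1|]; [exfalso|assumption].
apply Hn. intros t0 Ht0. apply (locally_zero_pnear f t0 Ht0).
set (x := fun s => Re t1 + s * (Re t0 - Re t1)). set (y := fun s => Im t1 + s * (Im t0 - Im t1)).
set (phi := fun s => if excluded_middle_informative (pnear (x s, y s) (fun v => f v = 0)) then 1 else 0).
assert (E0 : (x 0, y 0) = t1) by (unfold x, y; destruct t1; simpl; f_equal; ring).
assert (E1 : (x 1, y 1) = t0) by (unfold x, y; destruct t0, t1; simpl; f_equal; ring).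
assert (E : phi 0 = phi 1).
{ apply (eq_is_derive phi 0 1); [|lra]. intros s Hs.
  assert (Hy : 0 < y s) by (unfold y; nra).
  apply (is_derive_ext_loc (fun _ => phi s)); [|apply @is_derive_const].
  assert (Cx : continuous x s) by (apply @ex_derive_continuous; unfold x; auto_derive; auto).
  assert (Cy : continuous y s) by (apply @ex_derive_continuous; unfold y; auto_derive; auto).
  generalize (near_curve x y s _ Cx Cy (near_transfer f (x s, y s) Hy (D (x s, y s) Hy))).
  apply filter_imp. intros s' Hs'. unfold phi.
  destruct (excluded_middle_informative _), (excluded_middle_informative _); tauto. }
unfold phi in E. rewrite E0, E1 in E.
destruct (excluded_middle_informative _) as [_|]; [|tauto].
destruct (excluded_middle_informative _) as [H|]; [exact H|lra].
Qed.

Definition inR (a b c d : R) (t : C) : Prop := a <= Re t <= b /\ c <= Im t <= d.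

(** Compactness of the rectangle: each of its points has a neighbourhood in which it is the only
    possible point of nonzero order. *)
Lemma finite_zeros F a b c d :
  (forall t, inR a b c d t -> exists n, is_ord F t n) ->
  exists L : list C, NoDup L /\ (forall t, In t L -> inR a b c d t) /\
    forall t, inR a b c d t -> ~ In t L -> is_ord F t 0.
Proof.
intros H.
(* The factor 2 converts the squares of the covering into discs, as [Cmod] is at most |Re| +
   |Im|. *)
assert (Ex : forall u v : R, exists e : posreal, inR a b c d (u, v) ->
   forall w, Cmod (w - (u, v)) < 2 * e -> w = (u, v) \/ is_ord F w 0).
{ intros u v. destruct (classic (inR a b c d (u, v))) as [I|N].
  - destruct (H _ I) as [n Hn]. destruct (is_ord_near0 _ _ _ Hn) as [e [He K]].
    assert (He2 : 0 < e / 2) by lra. exists (mkposreal _ He2). intros _ w Hw. simpl in Hw.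
    destruct (Ceq_dec w (u, v)) as [->|Hne]; [now left|]. right. apply K.
    split; [now apply Cmod_minus_pos|lra].
  - exists (mkposreal _ Rlt_0_1). tauto. }
set (delta := fun z : Compactness.Tn 2 R =>
  proj1_sig (constructive_indefinite_description _ (Ex (fst z) (fst (snd z))))).
assert (Hdelta : forall u v r, inR a b c d (u, v) ->
   forall w, Cmod (w - (u, v)) < 2 * delta (u, (v, r)) -> w = (u, v) \/ is_ord F w 0).
{ intros u v r. unfold delta. simpl. destruct (constructive_indefinite_description _ _). auto. }
destruct (NNPP _ (compactness_list 2 (a, (c, tt)) (b, (d, tt)) delta)) as [l Hl].
set (L0 := map (fun z : Compactness.Tn 2 R => (fst z, fst (snd z)) : C) l).
set (L := filter (fun t => if excluded_middle_informative (inR a b c d t) then true else false)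
   (nodup Ceq_dec L0)).
exists L. split; [apply NoDup_filter, NoDup_nodup|]. split.
- intros t Ht. apply filter_In in Ht. destruct Ht as [_ Ht].
  destruct (excluded_middle_informative _); [assumption|discriminate].
- intros [x y] Ht HN. destruct (Hl (x, (y, tt))) as [[u [v []]] [I1 [I2 I3]]].
  + simpl. unfold inR, Re, Im in Ht; simpl in Ht. intuition lra.
  + simpl in I2, I3.
    assert (I : inR a b c d (u, v)) by (unfold inR, Re, Im; simpl; tauto).
    destruct (Hdelta u v tt I (x, y)) as [E|E]; [|exfalso|exact E].
    * eapply Rle_lt_trans; [apply Cmod_le_Re_Im|]. unfold Re, Im; simpl.
      unfold Rminus in *. lra.
    * apply HN. apply filter_In. split.
      -- apply nodup_In. apply in_map_iff. exists (u, (v, tt)). split; [now symmetry|exact I1].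
      -- destruct (excluded_middle_informative _); [reflexivity|tauto].
Qed.

Definition Pz (L : list C) (o : C -> Z) (w : C) : C :=
  fold_right (fun t acc => (czpow (w - t) (o t) * acc)%C) 1%C L.

Lemma is_ord_Pz_notin L o t : ~ In t L -> is_ord (Pz L o) t 0.
Proof.
induction L as [|a L IH]; simpl; intros N.
- apply is_ord_hol; [apply near_all; intros; apply hol_const|apply C1_nz].
- change (is_ord (fun w => czpow (w - a) (o a) * Pz L o w)%C t (0 + 0)).
  apply is_ord_mult; [|apply IH; tauto].
  assert (Na : t <> a) by (intros E; apply N; now left).
  apply is_ord_hol.
  + assert (M : near t (fun w => (w - a)%C <> 0)).
    { apply (ccont_neq0 (fun w => w - a)%C); [apply ccont_sub|].
      intros E. apply Na. replace t with (t - a + a)%C by ring. rewrite E. ring. }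
    revert M. apply near_imp. intros w Hw. apply hol_czpow_sub. intros E. apply Hw. rewrite E. ring.
  + apply czpow_neq0. intros E. apply Na. replace t with (t - a + a)%C by ring. rewrite E. ring.
Qed.

Lemma is_ord_Pz_in L o t : NoDup L -> In t L -> is_ord (Pz L o) t (o t).
Proof.
induction L as [|a L IH]; simpl; intros HN HI; [tauto|].
inversion HN as [|? ? N1 N2]; subst. destruct HI as [->|HI].
- replace (o t) with (o t + 0)%Z by ring.
  apply (is_ord_mult (fun w => czpow (w - t) (o t)) (Pz L o)); [apply is_ord_czpow|].
  now apply is_ord_Pz_notin.
- replace (o t) with (0 + o t)%Z by ring.
  apply (is_ord_mult (fun w => czpow (w - a) (o a)) (Pz L o)); [|now apply IH].
  generalize (is_ord_Pz_notin (a :: nil) o t). unfold Pz; simpl. intros K.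
  apply is_ord_ext with (fun w => czpow (w - a) (o a) * 1)%C; [|apply K; intros [->|[]]; auto].
  apply near_pnear, near_all. intros. ring.
Qed.

(** All removable singularities are removed at once: a local holomorphic representative is chosen at
    each point and evaluated at its own centre. Neighbouring representatives agree by continuity, so
    this diagonal function is holomorphic. *)
Lemma normalize (Om : C -> Prop) F :
  (forall t, Om t -> is_ord F t 0) -> (forall t, Om t -> near t Om) ->
  exists g, forall t, Om t -> hol g t /\ g t <> 0 /\ pnear t (fun w => F w = g w).
Proof.
intros H HO.
assert (Ex : forall t, exists g, Om t -> near t (hol g) /\ g t <> 0 /\ pnear t (fun w => F w = g w)).
{ intros t. destruct (classic (Om t)) as [I|N]; [|exists (fun _ => 1%C); tauto].
  destruct (H t I) as [g [A [B E]]]. exists g. intros _. split; [exact A|]. split; [exact B|].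
  revert E. apply pnear_imp. intros w ->. simpl. ring. }
set (G := fun t => proj1_sig (constructive_indefinite_description _ (Ex t))).
assert (HG : forall t, Om t -> near t (hol (G t)) /\ G t t <> 0 /\ pnear t (fun w => F w = G t w)).
{ intros t. unfold G. destruct (constructive_indefinite_description _ _). auto. }
exists (fun t => G t t). intros t Ht. destruct (HG t Ht) as [A [B E]].
assert (K : near t (fun w => G t w = G w w)).
{ apply pnear_near; [reflexivity|].
  generalize (pnear_and _ _ _ (pnear_pnear _ _ E)
    (near_pnear _ _ (near_and _ _ _ A (HO t Ht)))).
  apply pnear_imp. intros w [W1 [W2 W3]]. destruct (HG w W3) as [A' [_ E']].
  apply ccont_pnear_eq.
  - now apply hol_cont.
  - apply hol_cont. exact (near_self _ _ A').
  - generalize (pnear_and _ _ _ (near_pnear _ _ W1) E'). apply pnear_imp. intros v [<- ->]. reflexivity. }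
split; [|split; [exact B|]].
- apply hol_ext with (G t); [exact K|exact (near_self _ _ A)].
- generalize (pnear_and _ _ _ E (near_pnear _ _ K)). apply pnear_imp. intros w [-> ->]. reflexivity.
Qed.

Lemma Re_ratio_pos (z p q : C) : z <> 0 -> Cmod (p - z) < Cmod z / 4 -> Cmod (q - z) < Cmod z / 4 ->
  0 < Re (p / q)%C.
Proof.
intros Hz Hp Hq. assert (Mz : 0 < Cmod z) by now apply Cmod_gt_0.
assert (Mq : 3 / 4 * Cmod z < Cmod q).
{ pose proof (Cmod_triangle q (z - q)) as T. replace (q + (z - q))%C with z in T by ring.
  rewrite Cmod_minus_sym in T. lra. }
assert (Nq : q <> 0) by (apply Cmod_gt_0; lra).
assert (Mpq : Cmod (p - q) < Cmod z / 2).
{ replace (p - q)%C with ((p - z) + (z - q))%C by ring.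
  eapply Rle_lt_trans; [apply Cmod_triangle|]. rewrite (Cmod_minus_sym z q). lra. }
assert (M : Cmod (p / q - 1) < 1).
{ replace (p / q - 1)%C with ((p - q) / q)%C by (field; exact Nq).
  rewrite Cmod_div by exact Nq. apply Rmult_lt_reg_r with (Cmod q); [lra|].
  unfold Rdiv. rewrite Rmult_assoc, Rinv_l by lra. lra. }
pose proof (re_le_Cmod (p / q - 1)) as B.
replace (Re (p / q - 1)%C) with (Re (p / q)%C - 1) in B by reflexivity.
apply Rabs_le_between in B. lra.
Qed.

(** A Lebesgue number: the values at two nearby points lie within |g (u, v)|/4 of a common value g
    (u, v), so their ratio lies in the right half plane, the domain of [Lg]. *)
Lemma lebesgue_ratio g a b c d :
  (forall t, inR a b c d t -> ccont g t /\ g t <> 0) ->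
  exists e, 0 < e /\ forall p q, inR a b c d p -> inR a b c d q ->
    Rabs (Re p - Re q) < e -> Rabs (Im p - Im q) < e -> 0 < Re (g p / g q)%C.
Proof.
intros H.
(* Each coordinate contributes e for p and at most a further e for the step from p to q, hence 4
   e. *)
assert (Ex : forall u v : R, exists e : posreal, inR a b c d (u, v) ->
   forall w, Cmod (w - (u, v)) < 4 * e -> Cmod (g w - g (u, v)) < Cmod (g (u, v)) / 4).
{ intros u v. destruct (classic (inR a b c d (u, v))) as [I|N].
  - destruct (H _ I) as [K1 K2].
    assert (M : 0 < Cmod (g (u, v)) / 4) by (apply Cmod_gt_0 in K2; lra).
    destruct (K1 _ M) as [e [He K]]. assert (He2 : 0 < e / 4) by lra.
    exists (mkposreal _ He2). intros _ w Hw. simpl in Hw. apply K. lra.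
  - exists (mkposreal _ Rlt_0_1). tauto. }
set (delta := fun u v => proj1_sig (constructive_indefinite_description _ (Ex u v))).
assert (Hdelta : forall u v, inR a b c d (u, v) ->
   forall w, Cmod (w - (u, v)) < 4 * delta u v -> Cmod (g w - g (u, v)) < Cmod (g (u, v)) / 4).
{ intros u v. unfold delta. destruct (constructive_indefinite_description _ _). auto. }
destruct (compactness_value_2d a b c d delta) as [e He].
exists e. split; [apply cond_pos|]. intros p q Hp Hq H1 H2.
destruct (NNPP _ (He (Re p) (Im p) (proj1 Hp) (proj2 Hp))) as [u [v [U1 [U2 [U3 [U4 U5]]]]]].
assert (I : inR a b c d (u, v)) by (split; assumption).
apply (Re_ratio_pos (g (u, v))).
- now apply H.
- apply Hdelta; [exact I|]. eapply Rle_lt_trans; [apply Cmod_le_Re_Im|].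
  unfold Re, Im in *; simpl in *. fold (Rminus (fst p) u) (Rminus (snd p) v).
  pose proof (Rabs_pos (fst p - u)). lra.
- apply Hdelta; [exact I|]. eapply Rle_lt_trans; [apply Cmod_le_Re_Im|].
  unfold Re, Im in *; simpl in *. fold (Rminus (fst q) u) (Rminus (snd q) v).
  pose proof (Rabs_triang (fst p - u) (- (fst p - fst q))) as T1. rewrite Rabs_Ropp in T1.
  replace (fst p - u + - (fst p - fst q)) with (fst q - u) in T1 by ring.
  pose proof (Rabs_triang (snd p - v) (- (snd p - snd q))) as T2. rewrite Rabs_Ropp in T2.
  replace (snd p - v + - (snd p - snd q)) with (snd q - v) in T2 by ring. lra.
Qed.

Fixpoint csum (N : nat) (F : nat -> C -> C) (p : C) : C :=
  match N with O => 0%C | S N => (csum N F p + F N p)%C end.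

Lemma hol_csum N F p : (forall k, (k < N)%nat -> hol (F k) p) -> hol (csum N F) p.
Proof.
induction N as [|N IH]; intros H; [apply hol_const|].
apply (hol_plus (csum N F) (F N)); [apply IH; intros; apply H; lia|apply H; lia].
Qed.

(* The segment from a corner of the rectangle to p is cut into pieces so short that consecutive
   values of g have a ratio in the right half plane; the branches of the logarithm of these
   ratios add up to a logarithm of g. *)
Lemma hol_log g a b c d :
  a <= b -> c <= d -> (forall t, inR a b c d t -> hol g t /\ g t <> 0) ->
  exists H, forall t, inR a b c d t -> hol H t /\ cexp (H t) = g t.
Proof.
intros Hab Hcd Hg.
destruct (lebesgue_ratio g a b c d) as [e [He Hr]].
{ intros t Ht. destruct (Hg t Ht). split; [now apply hol_cont|assumption]. }
(* Since N e exceeds (b - a) + (d - c), each of N equal steps along a segment from the corner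
   changes either coordinate by less than e. *)
destruct (INR_unbounded ((b - a + (d - c)) / e)) as [N HN].
assert (HN0 : (0 < N)%nat).
{ apply INR_lt. eapply Rle_lt_trans; [|exact HN]. simpl. apply Rle_div_r; [exact He|]. lra. }
assert (HNp : 0 < INR N) by (apply lt_0_INR; exact HN0).
assert (HNe : b - a + (d - c) < INR N * e) by (apply Rlt_div_l in HN; lra).
set (z0 := (a, c) : C).
set (q := fun (k : nat) (p : C) => (z0 + RtoC (INR k / INR N) * (p - z0))%C).
assert (Hq : forall k p, (k <= N)%nat -> inR a b c d p -> inR a b c d (q k p)).
{ intros k [x y] Hk [P1 P2]. unfold Re, Im in *; simpl in *.
  assert (K1 : 0 <= INR k / INR N) by (apply Rle_div_r; [lra|]; rewrite Rmult_0_l; apply pos_INR).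
  assert (K2 : INR k / INR N <= 1).
  { apply Rle_div_l; [lra|]. rewrite Rmult_1_l. now apply le_INR. }
  unfold inR, Re, Im, q, z0; simpl. unfold Rminus in *.
  set (l := INR k / INR N) in *. fold l. split; split; nra. }
assert (Hst : forall k p, (k < N)%nat -> inR a b c d p -> 0 < Re (g (q (S k) p) / g (q k p))%C).
{ intros k p Hk Hp.
  assert (P1 := proj1 Hp). assert (P2 := proj2 Hp).
  assert (D : INR (S k) / INR N = INR k / INR N + / INR N) by (rewrite S_INR; field; lra).
  assert (Hi : 0 < / INR N) by now apply Rinv_0_lt_compat.
  assert (Hi2 : INR N * / INR N = 1) by (apply Rinv_r; lra).
  assert (QR : forall j, Re (q j p) = a + INR j / INR N * (Re p - a)).
  { intros j. unfold q, z0, Re; simpl fst. ring. }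
  assert (QI : forall j, Im (q j p) = c + INR j / INR N * (Im p - c)).
  { intros j. unfold q, z0, Im; simpl snd. ring. }
  apply Hr; [apply Hq; [lia|exact Hp]|apply Hq; [lia|exact Hp]| |].
  - rewrite !QR, D. match goal with |- Rabs ?X < _ => replace X with (/ INR N * (Re p - a)) by ring end.
    rewrite Rabs_pos_eq by nra. apply Rmult_lt_reg_l with (INR N); [lra|]. rewrite <- Rmult_assoc, Hi2. lra.
  - rewrite !QI, D. match goal with |- Rabs ?X < _ => replace X with (/ INR N * (Im p - c)) by ring end.
    rewrite Rabs_pos_eq by nra. apply Rmult_lt_reg_l with (INR N); [lra|]. rewrite <- Rmult_assoc, Hi2. lra. }
exists (fun p => Clog (g z0) + csum N (fun k p => Lg (g (q (S k) p) / g (q k p))%C) p)%C.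
intros p Hp. split.
- apply hol_plus; [apply hol_const|]. apply hol_csum. intros k Hk.
  assert (Hqk : forall j, hol (q j) p).
  { intros j. unfold q. apply hol_plus; [apply hol_const|].
    apply hol_mult; [apply hol_const|]. apply hol_sub. }
  apply (hol_comp Lg (fun p => g (q (S k) p) / g (q k p))%C).
  + apply hol_Lg. now apply Hst.
  + apply (hol_div (fun p => g (q (S k) p)) (fun p => g (q k p))).
    * apply hol_comp; [|apply Hqk]. apply Hg. apply Hq; [lia|exact Hp].
    * apply hol_comp; [|apply Hqk]. apply Hg. apply Hq; [lia|exact Hp].
    * apply Hg. apply Hq; [lia|exact Hp].
- assert (K : forall k, (k <= N)%nat ->
    cexp (Clog (g z0) + csum k (fun k p => Lg (g (q (S k) p) / g (q k p))%C) p) = g (q k p)).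
  { induction k as [|k IH]; intros Hk.
    - simpl csum. rewrite Cplus_0_r. unfold q. simpl INR.
      replace (z0 + RtoC (0 / INR N) * (p - z0))%C with z0.
      + apply cexp_Clog. apply Hg. unfold inR, z0, Re, Im; simpl. lra.
      + replace (0 / INR N) with 0 by (field; lra). ring.
    - simpl csum. rewrite Cplus_assoc, cexp_add, IH by lia.
      rewrite cexp_Lg by (apply Hst; [lia|exact Hp]). field. apply Hg. apply Hq; [lia|exact Hp]. }
  rewrite K by lia. f_equal. unfold q. replace (INR N / INR N) with 1 by (field; lra). ring.
Qed.

(** * Angles of the fundamental domain *)

Lemma atan_cs x : exists k, 0 < k /\ cos (atan x) = k /\ sin (atan x) = x * k.
Proof.
exists (/ sqrt (1 + x²)).
assert (0 < sqrt (1 + x²)) by (apply sqrt_lt_R0; unfold Rsqr; nra).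
split; [now apply Rinv_0_lt_compat|]. split; [rewrite cos_atan|rewrite sin_atan]; unfold Rdiv; ring.
Qed.

(** The brackets are the real and imaginary parts of (1 + ix)(1 + iy)(1 + iz)(1 - iw), which
    determine the sum of arctangents modulo 2 pi. *)
Lemma atan_sum4 x y z w :
  exists k, 0 < k /\
    cos (atan x + atan y + atan z - atan w) =
      k * ((1 - x*y) * (1 + z*w) - (x + y) * (z - w)) /\
    sin (atan x + atan y + atan z - atan w) =
      k * ((x + y) * (1 + z*w) + (1 - x*y) * (z - w)).
Proof.
destruct (atan_cs x) as [k1 [K1 [C1 S1]]]. destruct (atan_cs y) as [k2 [K2 [C2 S2]]].
destruct (atan_cs z) as [k3 [K3 [C3 S3]]]. destruct (atan_cs w) as [k4 [K4 [C4 S4]]].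
exists (k1 * k2 * k3 * k4). split; [repeat apply Rmult_lt_0_compat; assumption|].
replace (atan x + atan y + atan z - atan w) with ((atan x + atan y) + (atan z - atan w)) by ring.
repeat (rewrite cos_plus || rewrite sin_plus || rewrite cos_minus || rewrite sin_minus).
rewrite C1, S1, C2, S2, C3, S3, C4, S4. split; ring.
Qed.

Lemma angle_0 th : - PI < th < 2 * PI -> sin th = 0 -> 0 < cos th -> th = 0.
Proof.
intros H S Cc. destruct (Rtotal_order th 0) as [L|[E|L]]; [|exact E|].
- pose proof (sin_lt_0_var th). lra.
- destruct (Rtotal_order th PI) as [L'|[E|L']].
  + pose proof (sin_gt_0 th). lra.
  + rewrite E, cos_PI in Cc. lra.
  + pose proof (sin_lt_0 th). lra.
Qed.

Lemma angle_PI th : - PI < th < 2 * PI -> sin th = 0 -> cos th < 0 -> th = PI.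
Proof.
intros H S Cc. destruct (Rtotal_order th 0) as [L|[E|L]].
- pose proof (sin_lt_0_var th). lra.
- rewrite E, cos_0 in Cc. lra.
- destruct (Rtotal_order th PI) as [L'|[E|L']]; [|exact E|].
  + pose proof (sin_gt_0 th). lra.
  + pose proof (sin_lt_0 th). lra.
Qed.

Lemma angle_PI2 th : - (PI / 2) < th < 3 * (PI / 2) -> cos th = 0 -> 0 < sin th -> th = PI / 2.
Proof.
intros H Cc S. pose proof PI_RGT_0.
destruct (Rtotal_order th (PI / 2)) as [L|[E|L]]; [|exact E|].
- pose proof (cos_gt_0 th). lra.
- pose proof (cos_lt_0 th). lra.
Qed.

(* The point exp(i theta) with s = tan(theta/2). *)
Definition arcX (s : R) : R := (1 - s * s) / (1 + s * s).
Definition arcY (s : R) : R := 2 * s / (1 + s * s).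
(* t = a + i b in the coordinate w = -i (t-1)/(t+1), which sends exp(i theta) to tan(theta/2) *)
Definition wp (a b : R) : R := 2 * b / ((1 + a) * (1 + a) + b * b).
Definition wq (a b : R) : R := (1 - (a * a + b * b)) / ((1 + a) * (1 + a) + b * b).

(** The jump at the corner exp(i theta), s = tan(theta/2), between the argument of z - (a + ib)
    measured along the arc ([Arc] below) and along the vertical through the corner ([Vert] below).
    The term atan(b/(1 + a)) reconciles the two normalisations. *)
Definition Theta (s a b : R) : R :=
  atan s + atan ((s - wp a b) / wq a b) + atan (b / (1 + a)) - atan ((arcY s - b) / (arcX s - a)).

(** The imaginary part in [atan_sum4] vanishes identically, so the sum is a multiple of pi. The
    signs of two of the arctangents confine it to (-pi, 2 pi), which leaves 0 and pi, and the sign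
    of the real part decides. *)
Lemma Theta_generic s a b : 0 < s -> 0 < b -> 0 < 1 + a -> wq a b <> 0 -> arcX s <> a ->
  Theta s a b = if Rlt_dec 0 (wq a b * (arcX s - a)) then 0 else PI.
Proof.
intros Hs Hb Ha Hq HX. unfold Theta.
pose proof (atan_bound ((s - wp a b) / wq a b)). pose proof (atan_bound s).
pose proof (atan_bound (b / (1 + a))). pose proof (atan_bound ((arcY s - b) / (arcX s - a))).
assert (B1 : 0 < atan s) by (rewrite <- atan_0; apply atan_increasing; lra).
assert (B2 : 0 < atan (b / (1 + a))).
{ rewrite <- atan_0. apply atan_increasing. now apply Rdiv_lt_0_compat. }
destruct (atan_sum4 s ((s - wp a b) / wq a b) (b / (1 + a)) ((arcY s - b) / (arcX s - a)))
  as [k [Hk [Cs Sn]]].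
set (x := (s - wp a b) / wq a b) in *. set (w := (arcY s - b) / (arcX s - a)) in *.
set (z := b / (1 + a)) in *.
assert (N : 0 < (1 + a) * (1 + a) + b * b) by nra.
assert (N1 : 0 < 1 + s * s) by nra.
assert (D : arcX s - a <> 0) by lra.
assert (ES : (s + x) * (1 + z * w) + (1 - s * x) * (z - w) = 0).
{ assert (Hq2 : (1 - (a * a + b * b)) <> 0).
  { intros E. apply Hq. unfold wq. rewrite E. unfold Rdiv. ring. }
  assert (D2 : (1 - s * s) - a * (1 + s * s) <> 0).
  { intros E. apply D. unfold arcX. replace (1 - s * s) with (a * (1 + s * s)) by lra. field. lra. }
  unfold x, w, z, wp, wq, arcX, arcY. field. repeat split; try lra; try exact Hq2. }
assert (EC : (1 - s * x) * (1 + z * w) - (s + x) * (z - w) =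
   (1 + s * s) * ((arcX s - a)^2 + (arcY s - b)^2) / (wq a b * (1 + a) * (arcX s - a))).
{ assert (Hq2 : (1 - (a * a + b * b)) <> 0).
  { intros E. apply Hq. unfold wq. rewrite E. unfold Rdiv. ring. }
  assert (D2 : (1 - s * s) - a * (1 + s * s) <> 0).
  { intros E. apply D. unfold arcX. replace (1 - s * s) with (a * (1 + s * s)) by lra. field. lra. }
  unfold x, w, z, wp, wq, arcX, arcY. field. repeat split; try lra; try exact Hq2. }
assert (P : 0 < (1 + s * s) * ((arcX s - a)^2 + (arcY s - b)^2)).
{ apply Rmult_lt_0_compat; [exact N1|]. pose proof (Rsqr_pos_lt _ D) as Q. rewrite Rsqr_pow2 in Q.
  pose proof (pow2_ge_0 (arcY s - b)). lra. }
assert (E : wq a b * (1 + a) * (arcX s - a) = (1 + a) * (wq a b * (arcX s - a))) by ring.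
rewrite E in EC. clear E.
rewrite ES in Sn. rewrite EC in Cs. rewrite Rmult_0_r in Sn.
destruct (Rlt_dec 0 (wq a b * (arcX s - a))) as [L|L].
- apply angle_0; [lra|exact Sn|]. rewrite Cs. apply Rmult_lt_0_compat; [exact Hk|].
  apply Rdiv_lt_0_compat; [exact P|]. now apply Rmult_lt_0_compat.
- assert (L' : wq a b * (arcX s - a) < 0).
  { apply Rnot_lt_le in L. destruct L as [L|L]; [exact L|].
    apply Rmult_integral in L. tauto. }
  apply angle_PI; [lra|exact Sn|]. rewrite Cs.
  apply Ropp_lt_cancel. rewrite Ropp_0, Ropp_mult_distr_r. apply Rmult_lt_0_compat; [exact Hk|].
  replace (- ((1 + s * s) * ((arcX s - a) ^ 2 + (arcY s - b) ^ 2) / ((1 + a) * (wq a b * (arcX s - a)))))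
   with ((1 + s * s) * ((arcX s - a) ^ 2 + (arcY s - b) ^ 2) / ((1 + a) * - (wq a b * (arcX s - a))))
   by (field; repeat split; lra).
  apply Rdiv_lt_0_compat; [exact P|]. apply Rmult_lt_0_compat; lra.
Qed.

Lemma atan_arg_0 (u v : R) : v = 0 -> atan (u / v) = 0.
Proof. intros ->. unfold Rdiv. rewrite Rinv_0, Rmult_0_r. apply atan_0. Qed.

Lemma wq_0 a b : 0 < b -> (wq a b = 0 <-> a * a + b * b = 1).
Proof.
intros Hb. assert (N : 0 < (1 + a) * (1 + a) + b * b)
  by (pose proof (Rle_0_sqr (1 + a)) as Q; unfold Rsqr in Q; nra).
unfold wq. split; intros H.
- apply Rmult_integral in H. destruct H as [H|H]; [lra|].
  exfalso. revert H. apply Rinv_neq_0_compat. lra.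
- rewrite H. unfold Rdiv. ring.
Qed.

(** The zero is exp(i phi) with z = tan(phi/2), and the chord from it to exp(i theta) has slope
    -cot((theta + phi)/2); the half angles cancel and pi/2 remains. *)
Lemma Theta_on_circle s a b : 0 < s -> 0 < b -> 0 < 1 + a -> wq a b = 0 -> arcX s <> a ->
  Theta s a b = PI / 2.
Proof.
intros Hs Hb Ha Hq HX. unfold Theta. rewrite (atan_arg_0 _ _ Hq).
apply wq_0 in Hq; [|exact Hb].
set (z := b / (1 + a)).
assert (Hz : 0 < z) by now apply Rdiv_lt_0_compat.
assert (Hd : (1 + a) * (1 + a) + b * b = 2 * (1 + a)) by lra.
assert (Ea : a = arcX z).
{ transitivity (((1 + a) * (1 + a) - b * b) / ((1 + a) * (1 + a) + b * b)).
  - rewrite Hd. replace ((1 + a) * (1 + a) - b * b) with (2 * a * (1 + a)) by lra. field. lra.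
  - unfold arcX, z. field. split; lra. }
assert (Eb : b = arcY z).
{ transitivity (2 * b * (1 + a) / ((1 + a) * (1 + a) + b * b)).
  - rewrite Hd. field. lra.
  - unfold arcY, z. field. split; lra. }
assert (Hne : s <> z) by (intros E; apply HX; rewrite E; now symmetry).
set (w := (arcY s - b) / (arcX s - a)).
assert (Ew : w = - ((1 - s * z) / (s + z))).
{ unfold w. rewrite Ea, Eb. unfold arcX, arcY. field. repeat split; try nra. }
rewrite <- atan_0.
destruct (atan_sum4 s 0 z w) as [k [Hk [Cs Sn]]].
pose proof (atan_bound s). pose proof (atan_bound z). pose proof (atan_bound w).
assert (B1 : 0 < atan s) by (rewrite <- atan_0; apply atan_increasing; lra).
assert (B2 : 0 < atan z) by (rewrite <- atan_0; apply atan_increasing; lra).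
pose proof PI_RGT_0.
apply angle_PI2.
- rewrite atan_0. lra.
- rewrite Cs, Ew. field. lra.
- rewrite Sn, Ew. apply Rmult_lt_0_compat; [exact Hk|].
  replace ((s + 0) * (1 + z * - ((1 - s * z) / (s + z))) + (1 - s * 0) * (z - - ((1 - s * z) / (s + z))))
    with ((1 + z * z) * (1 + s * s) / (s + z)) by (field; lra).
  apply Rdiv_lt_0_compat; nra.
Qed.

(** The zero lies on the vertical through the corner, where [Vert] contributes 0. The other three
    arctangents give a product with real part 0 and positive imaginary part. *)
Lemma Theta_on_vertical s b : 0 < s -> 0 < b -> wq (arcX s) b <> 0 -> Theta s (arcX s) b = PI / 2.
Proof.
intros Hs Hb Hq. unfold Theta. rewrite (atan_arg_0 (arcY s - b)) by ring.
set (a := arcX s) in *.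
assert (Ea : 1 + a = 2 / (1 + s * s)) by (unfold a, arcX; field; nra).
assert (Ha : 0 < 1 + a) by (rewrite Ea; apply Rdiv_lt_0_compat; nra).
set (x := (s - wp a b) / wq a b). set (z := b / (1 + a)).
assert (Hz : 0 < z) by now apply Rdiv_lt_0_compat.
assert (N : 0 < (1 + a) * (1 + a) + b * b) by nra.
assert (Hb2 : (1 - (a * a + b * b)) <> 0).
{ intros E. apply Hq. unfold wq. rewrite E. unfold Rdiv. ring. }
assert (F : 1 - (a * a + b * b) = (arcY s - b) * (arcY s + b)).
{ unfold a, arcX, arcY. field. nra. }
assert (Y : 0 < arcY s) by (unfold arcY; apply Rdiv_lt_0_compat; nra).
assert (F2 : arcY s - b <> 0) by (intros E; apply Hb2; rewrite F, E; ring).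
rewrite <- atan_0.
destruct (atan_sum4 s x z 0) as [k [Hk [Cs Sn]]].
pose proof (atan_bound s). pose proof (atan_bound z). pose proof (atan_bound x).
assert (B1 : 0 < atan s) by (rewrite <- atan_0; apply atan_increasing; lra).
assert (B2 : 0 < atan z) by (rewrite <- atan_0; apply atan_increasing; lra).
pose proof PI_RGT_0.
assert (G1 : 1 + s * s <> 0) by nra.
assert (G2 : 2 * s - b * (1 + s * s) <> 0).
{ intros E. apply F2. unfold arcY. replace b with (2 * s / (1 + s * s)).
  - field. exact G1.
  - field_simplify; [|exact G1]. replace (2 * s) with (b * (1 + s * s)) by lra. field. nra. }
assert (G3 : 2 * s + b * (1 + s * s) <> 0) by nra.
assert (Ex : x = (s * ((1 + a) * (1 + a) + b * b) - 2 * b) / ((arcY s - b) * (arcY s + b))).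
{ unfold x, wp, wq. rewrite F. field. repeat split; try lra. }
apply angle_PI2.
- rewrite atan_0. lra.
- rewrite Cs, Ex. unfold z. rewrite Ea. unfold arcY. field.
  repeat split; try assumption.
- rewrite Sn. apply Rmult_lt_0_compat; [exact Hk|].
  replace ((s + x) * (1 + z * 0) + (1 - s * x) * (z - 0))
    with ((1 + s * s) * ((1 + a) * (1 + a) + b * b) / ((arcY s + b) * (1 + a))).
  + apply Rdiv_lt_0_compat; repeat apply Rmult_lt_0_compat; nra.
  + rewrite Ex. unfold z. rewrite Ea. unfold arcY. field. repeat split; try assumption.
Qed.

(** Both degenerate arctangents are 0 and b/(1 + a) = s, so theta itself remains. This is the source
    of the angle pi/3 at the corners of the domain. *)
Lemma Theta_corner s : 0 < s -> Theta s (arcX s) (arcY s) = 2 * atan s.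
Proof.
intros Hs. unfold Theta. rewrite (atan_arg_0 (arcY s - arcY s)) by ring.
assert (Y : 0 < arcY s) by (unfold arcY; apply Rdiv_lt_0_compat; nra).
rewrite (atan_arg_0 (s - wp (arcX s) (arcY s))).
- replace (arcY s / (1 + arcX s)) with s; [ring|]. unfold arcX, arcY. field. nra.
- apply wq_0; [exact Y|]. unfold arcX, arcY. field. nra.
Qed.

Definition sg (x : R) : R := if Rlt_dec 0 x then 1 else if Rlt_dec x 0 then -1 else 0.

Lemma sg_pos x : 0 < x -> sg x = 1.
Proof. intros H. unfold sg. destruct (Rlt_dec 0 x); lra. Qed.
Lemma sg_neg x : x < 0 -> sg x = -1.
Proof. intros H. unfold sg. destruct (Rlt_dec 0 x); [lra|]. destruct (Rlt_dec x 0); lra. Qed.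
Lemma sg_0 x : x = 0 -> sg x = 0.
Proof. intros H. unfold sg. destruct (Rlt_dec 0 x); [lra|]. destruct (Rlt_dec x 0); lra. Qed.

(** One formula for all cases but the corner: since [sg] vanishes at 0, a zero on exactly one of the
    curves receives the mean of 0 and pi. *)
Lemma Theta_sg s a b : 0 < s -> 0 < b -> 0 < 1 + a -> ~ (wq a b = 0 /\ arcX s = a) ->
  Theta s a b = PI / 2 * (1 - sg (wq a b) * sg (arcX s - a)).
Proof.
intros Hs Hb Ha N.
destruct (Req_dec (wq a b) 0) as [Q|Q].
- rewrite Theta_on_circle; auto; try tauto. rewrite (sg_0 _ Q). ring.
- destruct (Req_dec (arcX s) a) as [X|X].
  + rewrite (sg_0 (arcX s - a)) by lra. subst a. rewrite Theta_on_vertical; auto. ring.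
  + rewrite Theta_generic by assumption.
    destruct (Rtotal_order (wq a b) 0) as [L|[E|L]]; [|tauto|];
    destruct (Rtotal_order (arcX s) a) as [L'|[E'|L']]; try tauto;
    [rewrite (sg_neg (wq a b)), (sg_neg (arcX s - a)) by lra|
     rewrite (sg_neg (wq a b)), (sg_pos (arcX s - a)) by lra|
     rewrite (sg_pos (wq a b)), (sg_neg (arcX s - a)) by lra|
     rewrite (sg_pos (wq a b)), (sg_pos (arcX s - a)) by lra];
    destruct (Rlt_dec 0 (wq a b * (arcX s - a))); nra.
Qed.

Lemma sg_wq a b : 0 < b -> sg (wq a b) = sg (1 - (a * a + b * b)).
Proof.
intros Hb. assert (N : 0 < (1 + a) * (1 + a) + b * b)
  by (pose proof (Rle_0_sqr (1 + a)) as Q; unfold Rsqr in Q; nra).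
destruct (Rtotal_order (1 - (a * a + b * b)) 0) as [L|[E|L]].
- rewrite !sg_neg; [reflexivity|exact L|]. unfold wq. now apply Rdiv_neg_pos.
- rewrite !sg_0; [reflexivity|exact E|]. apply wq_0; lra.
- rewrite !sg_pos; [reflexivity|exact L|]. unfold wq. now apply Rdiv_lt_0_compat.
Qed.

(** The right angles at the top corners. For x = 0 division by zero yields 0, the mean of the values
    on the two sides. *)
Lemma atan_compl x y : 0 < y -> atan (y / x) + atan (x / y) = PI / 2 * sg x.
Proof.
intros Hy. destruct (Rtotal_order x 0) as [L|[->|L]].
- rewrite sg_neg by exact L.
  assert (P : 0 < (- x) / y) by (apply Rdiv_lt_0_compat; lra).
  replace (y / x) with (- / ((- x) / y)) by (field; lra). rewrite atan_opp, atan_inv by exact P.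
  replace (x / y) with (- ((- x) / y)) by (field; lra). rewrite atan_opp. lra.
- rewrite sg_0 by reflexivity. rewrite atan_arg_0 by reflexivity.
  unfold Rdiv at 1. rewrite Rmult_0_l, atan_0. lra.
- rewrite sg_pos by exact L. assert (P : 0 < x / y) by (apply Rdiv_lt_0_compat; lra).
  replace (y / x) with (/ (x / y)) by (field; lra). rewrite atan_inv by exact P. lra.
Qed.

(* The angle, divided by 2 pi, of the standard fundamental domain at the point a + i b. *)
Definition wD (a b : R) : R :=
  if Rlt_dec (a * a + b * b) 1 then 0 else
  if Rlt_dec (1/2) a then 0 else if Rlt_dec a (- (1/2)) then 0 else
  if Req_EM_T (a * a + b * b) 1 then
    (if Req_EM_T a (1/2) then 1/6 else if Req_EM_T a (- (1/2)) then 1/6 else 1/2)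
  else (if Req_EM_T a (1/2) then 1/2 else if Req_EM_T a (- (1/2)) then 1/2 else 1).

(* The argument of z - (a + i b) up to a constant, along the arc, a vertical and a horizontal line.
   If the point lies on the line the denominator vanishes and, as x / 0 = 0, the function is
   that of the principal value. *)
Definition Arc (a b s : R) : R := atan s + atan ((s - wp a b) / wq a b).
Definition Vert (a b x y : R) : R := atan ((y - b) / (x - a)).
Definition Hor (a b y x : R) : R := - atan ((x - a) / (y - b)).

Lemma sqrt3_sq : sqrt 3 * sqrt 3 = 3.
Proof. apply sqrt_sqrt. lra. Qed.
Lemma sqrt3_pos : 0 < sqrt 3.
Proof. apply sqrt_lt_R0. lra. Qed.

Lemma arc_sqrt3 : arcX (sqrt 3) = - (1/2) /\ arcY (sqrt 3) = sqrt 3 / 2.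
Proof. unfold arcX, arcY. rewrite sqrt3_sq. split; field. Qed.

Lemma arc_inv_sqrt3 : arcX (/ sqrt 3) = 1/2 /\ arcY (/ sqrt 3) = sqrt 3 / 2.
Proof.
pose proof sqrt3_pos. assert (E := sqrt3_sq).
assert (E2 : / sqrt 3 * / sqrt 3 = / 3) by (rewrite <- Rinv_mult, E; reflexivity).
unfold arcX, arcY. rewrite E2. split; [field|].
replace (/ sqrt 3) with (sqrt 3 / 3); [field|]. rewrite <- E at 2. field. lra.
Qed.

(** The increments are regrouped by corners instead of sides. Each top corner contributes pi/2 times
    a sign by [atan_compl]; the lower corners contribute the two values of [Theta], in whose
    difference atan(b/(1 + a)) cancels. Here 1/sqrt 3 and sqrt 3 are the half-angle tangents of
    exp(i pi/3) and exp(2 i pi/3). *)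
Lemma corner_sum a b Y : 0 < b < Y -> -1 < a ->
  (Vert a b (1/2) Y - Vert a b (1/2) (sqrt 3 / 2)) + (Hor a b Y (- (1/2)) - Hor a b Y (1/2))
  + (Vert a b (- (1/2)) (sqrt 3 / 2) - Vert a b (- (1/2)) Y)
  + (Arc a b (/ sqrt 3) - Arc a b (sqrt 3)) = 2 * PI * wD a b.
Proof.
intros Hb Ha.
pose proof sqrt3_pos as S3. assert (E3 := sqrt3_sq).
assert (S3' : 0 < / sqrt 3) by now apply Rinv_0_lt_compat.
destruct arc_sqrt3 as [X1 Y1]. destruct arc_inv_sqrt3 as [X2 Y2].
transitivity (PI / 2 * (sg (1/2 - a) - sg (- (1/2) - a)) + Theta (/ sqrt 3) a b - Theta (sqrt 3) a b).
{ rewrite Rmult_minus_distr_l, <- (atan_compl (1/2 - a) (Y - b)), <- (atan_compl (- (1/2) - a) (Y - b)) by lra.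
  unfold Theta, Vert, Hor, Arc. rewrite X1, Y1, X2, Y2. ring. }
assert (T6 : atan (/ sqrt 3) = PI / 6).
{ replace (/ sqrt 3) with (1 / sqrt 3) by (field; lra). rewrite <- tan_PI6.
  pose proof PI_RGT_0. rewrite atan_tan; lra. }
assert (T3 : atan (sqrt 3) = PI / 3).
{ rewrite <- tan_PI3. pose proof PI_RGT_0. rewrite atan_tan; lra. }
assert (Cor : forall x, x * x = 1 / 4 -> x * x + b * b = 1 -> b = sqrt 3 / 2).
{ intros x Hx Hx1. assert (Q : (b - sqrt 3 / 2) * (b + sqrt 3 / 2) = 0) by nra.
  apply Rmult_integral in Q. lra. }
destruct (Req_dec (a * a + b * b) 1) as [Q|Q].
- assert (Q' : wq a b = 0) by (apply wq_0; lra).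
  destruct (Req_dec a (1/2)) as [A|A]; [|destruct (Req_dec a (- (1/2))) as [A'|A']].
  + assert (B : b = sqrt 3 / 2) by (apply (Cor a); [subst a; lra|exact Q]).
    rewrite (Theta_sg (sqrt 3)) by lra.
    replace (Theta (/ sqrt 3) a b) with (Theta (/ sqrt 3) (arcX (/ sqrt 3)) (arcY (/ sqrt 3)))
      by (rewrite X2, Y2, A, B; reflexivity).
    rewrite Theta_corner, T6 by exact S3'. rewrite (sg_0 (wq a b)), (sg_0 (1/2 - a)), (sg_neg (-(1/2) - a)) by lra.
    unfold wD. destruct (Rlt_dec (a*a+b*b) 1); [lra|]. destruct (Rlt_dec (1/2) a); [lra|].
    destruct (Rlt_dec a (-(1/2))); [lra|]. destruct (Req_EM_T (a*a+b*b) 1); [|lra].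
    destruct (Req_EM_T a (1/2)); lra.
  + assert (B : b = sqrt 3 / 2) by (apply (Cor a); [subst a; lra|exact Q]).
    rewrite (Theta_sg (/ sqrt 3)) by lra.
    replace (Theta (sqrt 3) a b) with (Theta (sqrt 3) (arcX (sqrt 3)) (arcY (sqrt 3)))
      by (rewrite X1, Y1, A', B; reflexivity).
    rewrite Theta_corner, T3 by exact S3. rewrite (sg_0 (wq a b)), (sg_pos (1/2 - a)), (sg_0 (-(1/2) - a)) by lra.
    unfold wD. destruct (Rlt_dec (a*a+b*b) 1); [lra|]. destruct (Rlt_dec (1/2) a); [lra|].
    destruct (Rlt_dec a (-(1/2))); [lra|]. destruct (Req_EM_T (a*a+b*b) 1); [|lra].
    destruct (Req_EM_T a (1/2)); [lra|]. destruct (Req_EM_T a (-(1/2))); lra.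
  + rewrite !Theta_sg by lra. rewrite (sg_0 (wq a b)) by lra. unfold wD, sg.
    destruct (Rlt_dec (a*a+b*b) 1); [lra|]. destruct (Req_EM_T (a*a+b*b) 1); [|lra].
    destruct (Rlt_dec 0 (1/2 - a)), (Rlt_dec (1/2 - a) 0), (Rlt_dec 0 (-(1/2) - a)), (Rlt_dec (-(1/2) - a) 0),
      (Rlt_dec (1/2) a), (Rlt_dec a (-(1/2))), (Req_EM_T a (1/2)), (Req_EM_T a (-(1/2))); lra.
- assert (Q' : wq a b <> 0) by (rewrite wq_0; lra).
  rewrite !Theta_sg by lra. rewrite sg_wq, X1, X2 by lra. unfold wD, sg.
  destruct (Req_EM_T (a*a+b*b) 1); [lra|].
  destruct (Rlt_dec (a*a+b*b) 1), (Rlt_dec 0 (1 - (a*a+b*b))), (Rlt_dec (1 - (a*a+b*b)) 0); try lra;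
    destruct (Rlt_dec 0 (1/2 - a)), (Rlt_dec (1/2 - a) 0), (Rlt_dec 0 (-(1/2) - a)), (Rlt_dec (-(1/2) - a) 0),
      (Rlt_dec (1/2) a), (Rlt_dec a (-(1/2))), (Req_EM_T a (1/2)), (Req_EM_T a (-(1/2))); lra.
Qed.

(** * Flux through the boundary of the fundamental domain *)

Definition sumL {A : Type} (l : list A) (f : A -> R) : R := fold_right (fun t acc => f t + acc) 0 l.

Lemma sumL_ext {A} (l : list A) f g : (forall t, In t l -> f t = g t) -> sumL l f = sumL l g.
Proof.
induction l as [|a l IH]; simpl; intros H; [reflexivity|]. rewrite H, IH by auto. reflexivity.
Qed.

Lemma sumL_plus {A} (l : list A) f g : sumL l (fun t => f t + g t) = sumL l f + sumL l g.
Proof. induction l as [|a l IH]; simpl; [ring|]. rewrite IH. ring. Qed.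

Lemma sumL_scal {A} (l : list A) k f : sumL l (fun t => k * f t) = k * sumL l f.
Proof. induction l as [|a l IH]; simpl; [ring|]. rewrite IH. ring. Qed.

Lemma is_derive_sumL {A} (l : list A) (f : A -> R -> R) (d : A -> R) x :
  (forall t, In t l -> is_derive (f t) x (d t)) ->
  is_derive (fun x => sumL l (fun t => f t x)) x (sumL l d).
Proof.
induction l as [|a l IH]; simpl; intros H; [apply @is_derive_const|].
apply @is_derive_plus; [apply H; auto|apply IH; auto].
Qed.

(** The substitute for integrating a derivative along a side: zeros on the boundary spoil the
    comparison of derivatives at finitely many parameters only, and continuity carries the function
    across them. *)
Lemma const_off_finite (l : list R) : forall (f : R -> R) a b, a <= b ->
  (forall x, a <= x <= b -> continuous f x) ->
  (forall x, a < x < b -> ~ In x l -> is_derive f x 0) -> f a = f b.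
Proof.
induction l as [|x0 l IH]; intros f a b Hab Hc Hd.
- destruct (MVT_gen f a b (fun _ => 0)) as [c [_ E]].
  + intros x Hx. rewrite Rmin_left, Rmax_right in Hx by exact Hab. apply Hd; auto.
  + intros x Hx. rewrite Rmin_left, Rmax_right in Hx by exact Hab.
    apply continuity_pt_filterlim. now apply Hc.
  + lra.
- destruct (Rlt_dec a x0) as [L1|L1]; [destruct (Rlt_dec x0 b) as [L2|L2]|].
  + transitivity (f x0); apply IH; try lra.
    * intros; apply Hc; lra.
    * intros x Hx N. apply Hd; [lra|]. intros [E|E]; [lra|auto].
    * intros; apply Hc; lra.
    * intros x Hx N. apply Hd; [lra|]. intros [E|E]; [lra|auto].
  + apply IH; auto. intros x Hx N. apply Hd; [lra|]. intros [E|E]; [lra|auto].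
  + apply IH; auto. intros x Hx N. apply Hd; [lra|]. intros [E|E]; [lra|auto].
Qed.

(** Off L this is log |F| for F the product of the (w - t)^(o t) and exp H. The functions [VV], [AA]
    and [HH] are its conjugates along verticals, the arc and horizontals. *)
Definition UU (L : list C) (o : C -> Z) (H : C -> C) (w : C) : R :=
  sumL L (fun t => IZR (o t) * (/ 2 * ln ((Re w - Re t) * (Re w - Re t) + (Im w - Im t) * (Im w - Im t))))
  + Re (H w).
Definition VV L (o : C -> Z) (H : C -> C) (x y : R) : R :=
  sumL L (fun t => IZR (o t) * Vert (Re t) (Im t) x y) + Im (H (x, y)).
Definition AA L (o : C -> Z) (H : C -> C) (s : R) : R :=
  sumL L (fun t => IZR (o t) * Arc (Re t) (Im t) s) + Im (H (arcX s, arcY s)).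
Definition HH L (o : C -> Z) (H : C -> C) (y x : R) : R :=
  sumL L (fun t => IZR (o t) * Hor (Re t) (Im t) y x) + Im (H (x, y)).

Lemma sq_dist_pos (x y : R) (t : C) : (x, y) <> t ->
  0 < (x - Re t) * (x - Re t) + (y - Im t) * (y - Im t).
Proof.
intros N. destruct (Req_dec x (Re t)) as [E|E]; [destruct (Req_dec y (Im t)) as [E'|E']|].
- exfalso. apply N. rewrite E, E'. symmetry. apply surjective_pairing.
- assert (0 < (y - Im t) * (y - Im t)) by (apply Rsqr_pos_lt; lra).
  pose proof (Rle_0_sqr (x - Re t)) as Q. unfold Rsqr in Q. lra.
- assert (0 < (x - Re t) * (x - Re t)) by (apply Rsqr_pos_lt; lra).
  pose proof (Rle_0_sqr (y - Im t)) as Q. unfold Rsqr in Q. lra.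
Qed.

(* Cauchy-Riemann: the conjugate function along a vertical line has the normal derivative of UU
   as derivative, also when zeros lie on the line (Vert is then constant). *)
Lemma dU_vertical L o H x y : ~ In (x, y) L -> hol H (x, y) ->
  exists D, is_derive (fun x => UU L o H (x, y)) x D /\ is_derive (fun y => VV L o H x y) y D.
Proof.
intros N [l Hl].
exists (sumL L (fun t => IZR (o t) * ((x - Re t) / ((x - Re t) * (x - Re t) + (y - Im t) * (y - Im t)))) + Re l).
assert (P : forall t, In t L -> 0 < (x - Re t) * (x - Re t) + (y - Im t) * (y - Im t)).
{ intros t Ht. apply sq_dist_pos. intros E. apply N. now rewrite E. }
split.
- unfold UU. simpl Re. simpl Im. apply @is_derive_plus.
  + apply (is_derive_sumL L (fun t x => IZR (o t) * (/ 2 *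
      ln ((x - Re t) * (x - Re t) + (y - Im t) * (y - Im t))))).
    intros t Ht. specialize (P t Ht). auto_derive; [exact P|]. field. lra.
  + destruct (cder_curve H (fun x => x) (fun _ => y) x 1 0 l) as [A _]; auto.
    * apply @is_derive_id.
    * apply @is_derive_const.
    * replace (Re l) with (Re (l * (1, 0))%C) by (destruct l; unfold Re; simpl; ring). exact A.
- unfold VV. apply @is_derive_plus.
  + apply (is_derive_sumL L (fun t y => IZR (o t) * Vert (Re t) (Im t) x y)).
    intros t Ht. specialize (P t Ht). unfold Vert.
    destruct (Req_dec (x - Re t) 0) as [E|E].
    * apply is_derive_ext with (fun _ => 0).
      -- intros y'. rewrite atan_arg_0 by exact E. now rewrite Rmult_0_r.
      -- rewrite E. match goal with |- is_derive _ _ ?d => replace d with 0 by (unfold Rdiv; ring) end.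
         exact (is_derive_const 0 y).
    * auto_derive; [auto|]. field. split; [|exact E].
      intros Q. apply (Rlt_not_eq _ _ P). rewrite <- Q. ring.
  + destruct (cder_curve H (fun _ => x) (fun y => y) y 0 1 l) as [_ A]; auto.
    * apply @is_derive_const.
    * apply @is_derive_id.
    * replace (Re l) with (Im (l * (0, 1))%C) by (destruct l; unfold Im, Re; simpl; ring). exact A.
Qed.

Lemma arc_norm s : arcX s * arcX s + arcY s * arcY s = 1.
Proof. unfold arcX, arcY. field. nra. Qed.

(** Cauchy-Riemann in polar coordinates: the radial derivative at r = 1 is the derivative of the
    conjugate in theta, and d theta/ds = 2/(1 + s^2). *)
Lemma dU_arc L o H s : 0 < s -> (forall t, In t L -> 0 < Im t) ->
  ~ In (arcX s, arcY s) L -> hol H (arcX s, arcY s) ->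
  exists D, is_derive (fun r => UU L o H (r * arcX s, r * arcY s)) 1 D /\
            is_derive (AA L o H) s (2 / (1 + s * s) * D).
Proof.
intros Hs HL N [l Hl].
set (X := arcX s). set (Y := arcY s).
assert (XY := arc_norm s). fold X Y in XY.
exists (sumL L (fun t => IZR (o t) * ((X * (X - Re t) + Y * (Y - Im t)) /
   ((X - Re t) * (X - Re t) + (Y - Im t) * (Y - Im t)))) + Re (l * (X, Y))%C).
assert (P : forall t, In t L -> 0 < (X - Re t) * (X - Re t) + (Y - Im t) * (Y - Im t)).
{ intros t Ht. apply sq_dist_pos. intros E. apply N. fold X Y. now rewrite E. }
assert (Q1 : 0 < 1 + s * s) by nra.
split.
- unfold UU. simpl Re. simpl Im. apply @is_derive_plus.
  + apply (is_derive_sumL L (fun t r => IZR (o t) * (/ 2 *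
      ln ((r * X - Re t) * (r * X - Re t) + (r * Y - Im t) * (r * Y - Im t))))).
    intros t Ht. specialize (P t Ht). auto_derive; rewrite !Rmult_1_l; [exact P|]. field. lra.
  + assert (DX : is_derive (fun r : R => r * X) 1 X) by (auto_derive; [auto|ring]).
    assert (DY : is_derive (fun r : R => r * Y) 1 Y) by (auto_derive; [auto|ring]).
    destruct (cder_curve H (fun r => r * X) (fun r => r * Y) 1 X Y l) as [A _]; auto.
    rewrite !Rmult_1_l. exact Hl.
- rewrite Rmult_plus_distr_l. unfold AA. apply @is_derive_plus.
  + rewrite <- sumL_scal. apply (is_derive_sumL L (fun t s => IZR (o t) * Arc (Re t) (Im t) s)).
    intros t Ht. specialize (P t Ht). specialize (HL t Ht). unfold Arc.
    set (a := Re t) in *. set (b := Im t) in *.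
    assert (NN : 0 < (1 + a) * (1 + a) + b * b)
      by (pose proof (Rle_0_sqr (1 + a)) as Q; unfold Rsqr in Q; nra).
    (* For |t| = 1 one has Re(z/(z - t)) = 1/2 on the circle, which matches the term atan s =
       theta/2 left in [Arc]. *)
    destruct (Req_dec (wq a b) 0) as [E|E].
    * apply is_derive_ext with (fun s => IZR (o t) * atan s).
      -- intros s'. rewrite (atan_arg_0 (s' - wp a b)) by exact E. now rewrite Rplus_0_r.
      -- auto_derive; [auto|]. apply wq_0 in E; [|exact HL].
         assert (E' : (X - a) * (X - a) + (Y - b) * (Y - b) = 2 * (X * (X - a) + Y * (Y - b))) by lra.
         rewrite E'. rewrite E' in P. unfold Rsqr. field. split; lra.
    (* In the coordinate of [wp] and [wq] the zero is wp + i wq and z is the real number s; |z -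
       t|^2 becomes |s - wp - i wq|^2 up to conformal factors. *)
    * assert (P2 : (X - a) * (X - a) + (Y - b) * (Y - b) =
         ((1 + a) * (1 + a) + b * b) * ((s - wp a b) * (s - wp a b) + wq a b * wq a b) / (1 + s * s)).
      { unfold X, Y, arcX, arcY, wp, wq. field. split; lra. }
      assert (P3 : 0 < (s - wp a b) * (s - wp a b) + wq a b * wq a b).
      { assert (0 < wq a b * wq a b) by (apply Rsqr_pos_lt; exact E).
        pose proof (Rle_0_sqr (s - wp a b)) as Q. unfold Rsqr in Q. lra. }
      auto_derive; [auto|]. rewrite P2.
      transitivity (IZR (o t) * (/ (1 + s * s) + wq a b / ((s - wp a b) * (s - wp a b) + wq a b * wq a b))).
      -- unfold Rsqr. field. repeat split; try lra.
      -- assert (P4 : X * (X - a) + Y * (Y - b) =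
           ((1 + a) * (1 + a) + b * b) * ((s - wp a b) * (s - wp a b) + wq a b * wq a b + (1 + s * s) * wq a b)
             / (2 * (1 + s * s))).
         { unfold X, Y, arcX, arcY, wp, wq. field. split; lra. }
         rewrite P4. field. repeat split; lra.
  + assert (DX : is_derive arcX s (2 / (1 + s * s) * - Y)).
    { unfold arcX, Y, arcY. auto_derive; [lra|]. field. lra. }
    assert (DY : is_derive arcY s (2 / (1 + s * s) * X)).
    { unfold arcY, X, arcX. auto_derive; [lra|]. field. lra. }
    destruct (cder_curve H arcX arcY s _ _ l Hl DX DY) as [_ A].
    replace (2 / (1 + s * s) * Re (l * (X, Y))%C)
      with (Im (l * ((2 / (1 + s * s) * - Y)%R, (2 / (1 + s * s) * X)%R))%C); [exact A|].
    destruct l; unfold Re, Im; simpl. ring.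
Qed.

Lemma continuous_sumL {A} (l : list A) (f : A -> R -> R) x :
  (forall t, In t l -> continuous (f t) x) -> continuous (fun x => sumL l (fun t => f t x)) x.
Proof.
induction l as [|a l IH]; simpl; intros H; [apply continuous_const|].
apply @continuous_plus; [apply H; auto|apply IH; auto].
Qed.

Lemma continuous_curve_Im H (x y : R -> R) s : hol H (x s, y s) ->
  ex_derive x s -> ex_derive y s -> continuous (fun s => Im (H (x s, y s))) s.
Proof.
intros [l Hl] [u Hu] [v Hv]. apply @ex_derive_continuous.
eexists. apply (cder_curve H x y s u v l Hl Hu Hv).
Qed.

Lemma continuous_atan_div (u : R -> R) k x : ex_derive u x -> continuous (fun x => atan (u x / k)) x.
Proof.
intros H. apply @ex_derive_continuous. auto_derive. auto.
Qed.

Lemma continuous_VV L o H x y : hol H (x, y) -> continuous (VV L o H x) y.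
Proof.
intros Hh. apply @continuous_plus.
- apply (continuous_sumL L (fun t y => IZR (o t) * Vert (Re t) (Im t) x y)). intros t _.
  apply (continuous_mult (fun _ => IZR (o t))); [apply continuous_const|].
  unfold Vert. apply (continuous_atan_div (fun y => y - Im t)). auto_derive. auto.
- apply (continuous_curve_Im H (fun _ => x) (fun y => y)); [exact Hh| |]; auto_derive; auto.
Qed.

Lemma continuous_HH L o H y x : hol H (x, y) -> continuous (HH L o H y) x.
Proof.
intros Hh. apply @continuous_plus.
- apply (continuous_sumL L (fun t x => IZR (o t) * Hor (Re t) (Im t) y x)). intros t _.
  apply (continuous_mult (fun _ => IZR (o t))); [apply continuous_const|].
  unfold Hor. apply @continuous_opp. apply (continuous_atan_div (fun x => x - Re t)). auto_derive. auto.
- apply (continuous_curve_Im H (fun x => x) (fun _ => y)); [exact Hh| |]; auto_derive; auto.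
Qed.

Lemma ex_derive_arc s : ex_derive arcX s /\ ex_derive arcY s.
Proof. split; [unfold arcX|unfold arcY]; auto_derive; nra. Qed.

Lemma continuous_AA L o H s : hol H (arcX s, arcY s) -> continuous (AA L o H) s.
Proof.
intros Hh. apply @continuous_plus.
- apply (continuous_sumL L (fun t s => IZR (o t) * Arc (Re t) (Im t) s)). intros t _.
  apply (continuous_mult (fun _ => IZR (o t))); [apply continuous_const|].
  unfold Arc. apply @continuous_plus.
  + apply @ex_derive_continuous. auto_derive. auto.
  + apply (continuous_atan_div (fun s => s - _)). auto_derive. auto.
- apply (continuous_curve_Im H arcX arcY); [exact Hh| |]; apply ex_derive_arc.
Qed.

Lemma arc_Rinv s : 0 < s -> arcX (/ s) = - arcX s /\ arcY (/ s) = arcY s.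
Proof. intros Hs. unfold arcX, arcY. split; field; split; nra. Qed.

(** Translation invariance near the left side equates the horizontal derivatives of [UU] at points
    of equal height, hence the derivatives of the two functions [VV]. The exceptional parameters are
    the heights of the zeros. *)
Lemma flux_sides L o H Y :
  sqrt 3 / 2 <= Y ->
  (forall x y, (x = 1/2 \/ x = - (1/2)) -> sqrt 3 / 2 <= y <= Y -> hol H (x, y)) ->
  (forall y, sqrt 3 / 2 < y < Y -> ~ In (1/2, y) L -> ~ In (- (1/2), y) L ->
     near (- (1/2), y) (fun w => UU L o H (w + 1)%C = UU L o H w)) ->
  VV L o H (1/2) Y - VV L o H (1/2) (sqrt 3 / 2) = VV L o H (- (1/2)) Y - VV L o H (- (1/2)) (sqrt 3 / 2).
Proof.
intros HY Hh HT.
cut (VV L o H (1/2) (sqrt 3 / 2) - VV L o H (- (1/2)) (sqrt 3 / 2)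
   = VV L o H (1/2) Y - VV L o H (- (1/2)) Y); [lra|].
apply (const_off_finite (map Im L) (fun y => VV L o H (1/2) y - VV L o H (- (1/2)) y)); [exact HY| |].
- intros y Hy. apply @continuous_minus; apply continuous_VV; apply Hh; auto.
- intros y Hy N.
  assert (N1 : ~ In (1/2, y) L) by (intros I; apply N; now apply (in_map Im) in I).
  assert (N2 : ~ In (- (1/2), y) L) by (intros I; apply N; now apply (in_map Im) in I).
  destruct (dU_vertical L o H (1/2) y N1) as [D1 [A1 B1]]; [apply Hh; auto; lra|].
  destruct (dU_vertical L o H (- (1/2)) y N2) as [D2 [A2 B2]]; [apply Hh; auto; lra|].
  assert (E : D1 = D2).
  { assert (A3 : is_derive (fun x => UU L o H (x + 1, y)) (- (1/2)) D1).
    { replace D1 with (1 * D1) by ring.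
      apply (is_derive_comp (fun x => UU L o H (x, y)) (fun x => x + 1)).
      - replace (- (1/2) + 1) with (1/2) by lra. exact A1.
      - auto_derive; [auto|ring]. }
    rewrite <- (is_derive_unique _ _ _ A3), <- (is_derive_unique _ _ _ A2).
    apply Derive_ext_loc.
    assert (Cx : continuous (fun x : R => x) (- (1/2))) by apply continuous_id.
    assert (Cy : continuous (fun _ : R => y) (- (1/2))) by apply continuous_const.
    generalize (near_curve (fun x => x) (fun _ => y) (- (1/2)) _ Cx Cy (HT y Hy N1 N2)).
    apply filter_imp. intros x Hx. cbv beta in Hx |- *.
    etransitivity; [|exact Hx]. f_equal. unfold Cplus; simpl. f_equal. ring. }
  replace 0 with (D1 - D2) by lra. apply @is_derive_minus; assumption.
Qed.

(** The map z -> -1/z takes exp(i theta) to exp(i(pi - theta)), that is s to 1/s, and reverses the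
    radial direction, so the radial derivatives satisfy -D2 = K + D1. Therefore AA(s) - AA(1/s) + 2K
    atan s is constant, and s = 1 against s = sqrt 3 gives 2K(pi/3 - pi/4). *)
Lemma flux_arc L o H K :
  (forall t, In t L -> 0 < Im t) ->
  (forall s, / sqrt 3 <= s <= sqrt 3 -> hol H (arcX s, arcY s)) ->
  (forall s, 1 < s < sqrt 3 -> ~ In (arcX s, arcY s) L -> ~ In (arcX (/ s), arcY (/ s)) L ->
     near (arcX s, arcY s) (fun w => UU L o H (- / w)%C = K * ln (Cmod w) + UU L o H w)) ->
  AA L o H (/ sqrt 3) - AA L o H (sqrt 3) = K * PI / 6.
Proof.
intros HL Hh HS.
pose proof sqrt3_pos as S3. assert (E3 := sqrt3_sq).
assert (S31 : 1 < sqrt 3) by nra.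
assert (S3i : / sqrt 3 < 1) by (rewrite <- Rinv_1; apply Rinv_lt_contravar; lra).
assert (Rg : forall s, 1 <= s <= sqrt 3 -> / sqrt 3 <= / s <= sqrt 3).
{ intros s Hs. split; [apply Rinv_le_contravar; lra|].
  apply Rle_trans with 1; [|lra]. rewrite <- Rinv_1. apply Rinv_le_contravar; lra. }
assert (E : AA L o H 1 - AA L o H (/ 1) + 2 * K * atan 1 =
  AA L o H (sqrt 3) - AA L o H (/ sqrt 3) + 2 * K * atan (sqrt 3)).
(* A point t of the arc has parameter Im t/(1 + Re t) = tan(theta/2); the reciprocals account for
   zeros met at 1/s. *)
{ apply (const_off_finite (map (fun t => Im t / (1 + Re t)) L ++ map (fun t => / (Im t / (1 + Re t))) L)
    (fun s => AA L o H s - AA L o H (/ s) + 2 * K * atan s)); [lra| |].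
  - intros s Hs. apply @continuous_plus; [apply @continuous_minus|].
    + apply continuous_AA, Hh. lra.
    + apply (continuous_comp Rinv (AA L o H)).
      * apply @ex_derive_continuous. auto_derive. lra.
      * apply continuous_AA, Hh. now apply Rg.
    + apply @ex_derive_continuous. auto_derive. auto.
  - intros s Hs N.
    assert (P : 0 < 1 + s * s) by nra. assert (Hs0 : 0 < s) by lra.
    assert (Pi : 0 < / s) by (apply Rinv_0_lt_compat; lra).
    assert (P' : 0 < 1 + / s * / s) by nra.
    assert (Hpar : forall s, 0 < s -> arcY s / (1 + arcX s) = s).
    { intros s' Hs'. unfold arcX, arcY. field. split; nra. }
    assert (N1 : ~ In (arcX s, arcY s) L).
    { intros I. apply N, in_or_app. left. apply (in_map (fun t => Im t / (1 + Re t))) in I.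
      simpl in I. rewrite Hpar in I by lra. exact I. }
    assert (N2 : ~ In (arcX (/ s), arcY (/ s)) L).
    { intros I. apply N, in_or_app. right. apply (in_map (fun t => / (Im t / (1 + Re t)))) in I.
      simpl in I. rewrite Hpar, Rinv_inv in I by lra. exact I. }
    destruct (dU_arc L o H s Hs0 HL N1) as [D1 [A1 B1]]; [apply Hh; lra|].
    destruct (dU_arc L o H (/ s) Pi HL N2) as [D2 [A2 B2]]; [apply Hh, Rg; lra|].
    assert (E : - D2 = K + D1).
    { assert (A3 : is_derive (fun r => UU L o H (/ r * arcX (/ s), / r * arcY (/ s))) 1 (- D2)).
      { replace (- D2) with ((- 1) * D2) by ring.
        apply (is_derive_comp (fun r => UU L o H (r * arcX (/ s), r * arcY (/ s))) Rinv).
        - rewrite Rinv_1. exact A2.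
        - auto_derive; [lra|field]. }
      assert (A4 : is_derive (fun r => K * ln r + UU L o H (r * arcX s, r * arcY s)) 1 (K + D1)).
      { apply @is_derive_plus; [|exact A1]. auto_derive; [lra|field]. }
      rewrite <- (is_derive_unique _ _ _ A3), <- (is_derive_unique _ _ _ A4).
      apply Derive_ext_loc.
      assert (Cx : continuous (fun r : R => r * arcX s) 1) by (apply @ex_derive_continuous; auto_derive; auto).
      assert (Cy : continuous (fun r : R => r * arcY s) 1) by (apply @ex_derive_continuous; auto_derive; auto).
      assert (HS' := HS s Hs N1 N2). rewrite <- (Rmult_1_l (arcX s)), <- (Rmult_1_l (arcY s)) in HS'.
      generalize (filter_and _ _ (near_curve (fun r => r * arcX s) (fun r => r * arcY s) 1 _ Cx Cy HS')
        (open_gt 0 1 Rlt_0_1)).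
      apply filter_imp. intros r [Hr Hr0]. cbv beta in Hr.
      assert (XY := arc_norm s).
      assert (M : Cmod (r * arcX s, r * arcY s) = r).
      { unfold Cmod; simpl. replace (r * arcX s * (r * arcX s * 1) + r * arcY s * (r * arcY s * 1))
          with (r * r * (arcX s * arcX s + arcY s * arcY s)) by ring.
        rewrite XY, Rmult_1_r. apply sqrt_square. lra. }
      rewrite M in Hr. cbv beta. etransitivity; [|exact Hr]. f_equal. destruct (arc_Rinv s Hs0) as [-> ->].
      unfold Copp, Cinv; simpl.
      replace (r * arcX s * (r * arcX s * 1) + r * arcY s * (r * arcY s * 1))
          with (r * r * (arcX s * arcX s + arcY s * arcY s)) by ring.
      rewrite XY. f_equal; field; lra. }
    assert (B3 : is_derive (fun s => AA L o H (/ s)) s (- / (s * s) * (2 / (1 + / s * / s) * D2))).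
    { apply (is_derive_comp (AA L o H) Rinv); [exact B2|]. auto_derive; [lra|field; lra]. }
    replace 0 with ((2 / (1 + s * s) * D1 - - / (s * s) * (2 / (1 + / s * / s) * D2)) + 2 * K / (1 + s * s)).
    + apply @is_derive_plus; [apply @is_derive_minus; assumption|].
      auto_derive; [auto|]. unfold Rsqr. field. lra.
    + replace D2 with (- (K + D1)) by lra. field. split; nra. }
rewrite Rinv_1, Rminus_diag, atan_1 in E.
assert (T3 : atan (sqrt 3) = PI / 3).
{ rewrite <- tan_PI3. pose proof PI_RGT_0. rewrite atan_tan; lra. }
rewrite T3 in E. lra.
Qed.

(** The terms Im H telescope over the four corners, so the zero-free factor exp H has no winding,
    and [corner_sum] evaluates the contribution of each power of z - t. *)
Lemma flux_identity L o H Y K :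
  1 <= Y ->
  (forall t, In t L -> 0 < Im t < Y /\ - 1 < Re t) ->
  (forall x y, - (1/2) <= x <= 1/2 -> 1/2 <= y <= Y -> hol H (x, y)) ->
  (forall y, sqrt 3 / 2 < y < Y -> ~ In (1/2, y) L -> ~ In (- (1/2), y) L ->
     near (- (1/2), y) (fun w => UU L o H (w + 1)%C = UU L o H w)) ->
  (forall s, 1 < s < sqrt 3 -> ~ In (arcX s, arcY s) L -> ~ In (arcX (/ s), arcY (/ s)) L ->
     near (arcX s, arcY s) (fun w => UU L o H (- / w)%C = K * ln (Cmod w) + UU L o H w)) ->
  2 * PI * sumL L (fun t => IZR (o t) * wD (Re t) (Im t)) =
    K * PI / 6 + (HH L o H Y (- (1/2)) - HH L o H Y (1/2)).
Proof.
intros HY HL Hh HT HS.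
pose proof sqrt3_pos as S3. assert (E3 := sqrt3_sq).
assert (S31 : 1 < sqrt 3) by nra.
assert (S32 : sqrt 3 < 2) by nra.
assert (F1 := flux_sides L o H Y ltac:(lra)).
assert (F1' : VV L o H (1/2) Y - VV L o H (1/2) (sqrt 3 / 2) = VV L o H (- (1/2)) Y - VV L o H (- (1/2)) (sqrt 3 / 2)).
{ apply F1; [|exact HT]. intros x y Hx Hy. apply Hh; lra. }
assert (F2 : AA L o H (/ sqrt 3) - AA L o H (sqrt 3) = K * PI / 6).
{ apply flux_arc; [intros t Ht; apply HL; exact Ht| |exact HS].
  intros s Hs.
  assert (Hi : 0 < / sqrt 3) by now apply Rinv_0_lt_compat.
  assert (Hii : / sqrt 3 * / sqrt 3 = / 3) by (rewrite <- Rinv_mult, E3; reflexivity).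
  assert (Q1 : / 3 <= s * s <= 3) by nra.
  assert (Q2 : 0 < 1 + s * s) by lra.
  assert (XY := arc_norm s).
  assert (BX : - (1/2) <= arcX s <= 1/2).
  { unfold arcX. split; [apply Rle_div_r|apply Rle_div_l]; lra. }
  assert (BY : 0 < arcY s) by (unfold arcY; apply Rdiv_lt_0_compat; lra).
  apply Hh; [exact BX|]. assert (QX : arcX s * arcX s <= 1/4) by nra. nra. }
rewrite <- sumL_scal.
rewrite (sumL_ext L _ (fun t => IZR (o t) * ((Vert (Re t) (Im t) (1/2) Y - Vert (Re t) (Im t) (1/2) (sqrt 3 / 2))
  + (Hor (Re t) (Im t) Y (- (1/2)) - Hor (Re t) (Im t) Y (1/2))
  + (Vert (Re t) (Im t) (- (1/2)) (sqrt 3 / 2) - Vert (Re t) (Im t) (- (1/2)) Y)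
  + (Arc (Re t) (Im t) (/ sqrt 3) - Arc (Re t) (Im t) (sqrt 3))))).
2:{ intros t Ht. rewrite corner_sum by (destruct (HL t Ht); lra). ring. }
unfold VV, AA, HH in *. destruct arc_sqrt3 as [X1 Y1]. destruct arc_inv_sqrt3 as [X2 Y2].
rewrite X1, Y1, X2, Y2 in F2.
assert (Sp : forall f g h k l m n p : C -> R,
  sumL L (fun t => IZR (o t) * ((f t - g t) + (h t - k t) + (l t - m t) + (n t - p t))) =
  (sumL L (fun t => IZR (o t) * f t) - sumL L (fun t => IZR (o t) * g t))
  + (sumL L (fun t => IZR (o t) * h t) - sumL L (fun t => IZR (o t) * k t))
  + (sumL L (fun t => IZR (o t) * l t) - sumL L (fun t => IZR (o t) * m t))
  + (sumL L (fun t => IZR (o t) * n t) - sumL L (fun t => IZR (o t) * p t))).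
{ intros. clear. induction L as [|a L' IH]; simpl; [ring|]. rewrite IH. ring. }
rewrite (Sp (fun t => Vert (Re t) (Im t) (1/2) Y) (fun t => Vert (Re t) (Im t) (1/2) (sqrt 3 / 2))
  (fun t => Hor (Re t) (Im t) Y (- (1/2))) (fun t => Hor (Re t) (Im t) Y (1/2))
  (fun t => Vert (Re t) (Im t) (- (1/2)) (sqrt 3 / 2)) (fun t => Vert (Re t) (Im t) (- (1/2)) Y)
  (fun t => Arc (Re t) (Im t) (/ sqrt 3)) (fun t => Arc (Re t) (Im t) (sqrt 3))).
lra.
Qed.

(** * The formula for SL_2(Z) *)

Lemma sumL_app {A} (l1 l2 : list A) f : sumL (l1 ++ l2) f = sumL l1 f + sumL l2 f.
Proof. induction l1 as [|a l IH]; simpl; [ring|]. rewrite IH. ring. Qed.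

Lemma sumL_0 {A} (l : list A) f : (forall t, In t l -> f t = 0) -> sumL l f = 0.
Proof. induction l as [|a l IH]; simpl; intros H; [reflexivity|]. rewrite H, IH by auto. ring. Qed.

(** The zeros listed by a factorization depend on the height of truncation; this makes the sum
    independent of the list chosen. *)
Lemma sumL_support {A} (f : A -> R) : forall l1 l2, NoDup l1 -> NoDup l2 ->
  (forall x, f x <> 0 -> (In x l1 <-> In x l2)) -> sumL l1 f = sumL l2 f.
Proof.
induction l1 as [|a l1 IH]; intros l2 N1 N2 H.
- symmetry. apply sumL_0. intros t Ht. destruct (Req_dec (f t) 0) as [E|E]; [exact E|].
  apply (H t) in E. destruct E as [_ E]. destruct (E Ht).
- inversion N1 as [|? ? Na N1']; subst. simpl.
  destruct (Req_dec (f a) 0) as [E|E].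
  + rewrite E, Rplus_0_l. apply IH; auto. intros x Hx. rewrite <- (H x Hx). simpl.
    split; [auto|]. intros [->|]; [tauto|auto].
  + assert (I : In a l2) by (apply H; [exact E|now left]).
    apply in_split in I. destruct I as [p [q ->]].
    rewrite sumL_app. simpl. rewrite (IH (p ++ q)).
    * rewrite sumL_app. ring.
    * exact N1'.
    * now apply NoDup_remove_1 in N2.
    * apply NoDup_remove_2 in N2. intros x Hx. specialize (H x Hx). simpl in H.
      rewrite in_app_iff in *. simpl in H.
      split.
      -- intros I. destruct (proj1 H (or_intror I)) as [K|[K|K]]; auto. subst x. tauto.
      -- intros I. destruct (proj2 H) as [K|K]; [tauto| |exact K].
         subst x. exfalso. exact (N2 I).
Qed.

Lemma pnear_notin (L : list C) t : pnear t (fun w => ~ In w L).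
Proof.
induction L as [|a L IH].
- apply near_pnear, near_all. auto.
- assert (K : pnear t (fun w => w <> a)).
  { destruct (Ceq_dec t a) as [->|N]; [apply pnear_neq|].
    apply near_pnear. exists (Cmod (t - a)). split; [now apply Cmod_minus_pos|].
    intros w Hw ->. rewrite Cmod_minus_sym in Hw. lra. }
  generalize (pnear_and _ _ _ K IH). apply pnear_imp. intros w [A B] [E|E]; auto.
Qed.

Lemma near_notin (L : list C) t : ~ In t L -> near t (fun w => ~ In w L).
Proof. intros H. apply pnear_near; [exact H|]. apply pnear_notin. Qed.

Lemma Pz_opp L o w : ~ In w L -> (Pz L o w * Pz L (fun t => (- o t)%Z) w)%C = 1%C.
Proof.
induction L as [|a L IH]; simpl; intros H; [ring|].
assert (N : (w - a)%C <> 0).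
{ intros E. apply H. left. replace w with (w - a + a)%C by ring. rewrite E. ring. }
rewrite czpow_opp by exact N. pose proof (czpow_neq0 _ (o a) N).
transitivity (Pz L o w * Pz L (fun t => (- o t)%Z) w)%C; [unfold Pz; field; auto|]. apply IH. tauto.
Qed.

Lemma hol_Pz L o w : ~ In w L -> hol (Pz L o) w.
Proof.
induction L as [|a L IH]; simpl; intros H; [apply hol_const|].
apply (hol_mult (fun w => czpow (w - a) (o a)) (Pz L o)); [|apply IH; tauto].
apply hol_czpow_sub. intros E. apply H. now left.
Qed.

Definition Fn L o H (w : C) : C := (Pz L o w * cexp (H w))%C.

Lemma ln_Cmod (z : C) : z <> 0 -> ln (Cmod z) = / 2 * ln (Re z * Re z + Im z * Im z).
Proof.
intros Hz. apply Cmod_gt_0 in Hz. rewrite <- Cmod_sq, ln_mult by assumption. lra.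
Qed.

Lemma Cmod_Fn L o H w : ~ In w L -> Cmod (Fn L o H w) = exp (UU L o H w).
Proof.
intros N. unfold Fn, UU. rewrite Cmod_mult, Cmod_cexp, exp_plus. f_equal.
induction L as [|a L IH]; simpl.
- now rewrite Cmod_1, exp_0.
- rewrite Cmod_mult, exp_plus. f_equal; [|apply IH; simpl in N; tauto].
  assert (Na : (w - a)%C <> 0).
  { intros E. apply N. left. replace w with (w - a + a)%C by ring. rewrite E. ring. }
  rewrite Cmod_czpow, ln_Cmod by exact Na. reflexivity.
Qed.

Lemma UU_ln L o H w : ~ In w L -> UU L o H w = ln (Cmod (Fn L o H w)).
Proof. intros N. now rewrite Cmod_Fn, ln_exp. Qed.

Lemma hol_Fn L o H w : ~ In w L -> hol H w -> hol (Fn L o H) w.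
Proof.
intros N Hh. apply hol_mult; [now apply hol_Pz|]. apply hol_comp; [apply hol_cexp|exact Hh].
Qed.

Lemma near_inR a b c d t : a < Re t < b -> c < Im t < d -> near t (fun w => a < Re w < b /\ c < Im w < d).
Proof.
intros [H1 H2] [H3 H4].
assert (P : forall (u : C -> R) k, rcont u t -> k < u t -> near t (fun w => k < u w)).
{ intros u k Hu Hk. assert (Q : near t (fun w => 0 < u w + - k)).
  { apply (near_rcont_pos (fun w => u w + - k)); [|lra]. apply rcont_plus; [exact Hu|apply rcont_const]. }
  revert Q. apply near_imp. intros; lra. }
assert (P' : forall (u : C -> R) k, rcont u t -> u t < k -> near t (fun w => u w < k)).
{ intros u k Hu Hk. assert (Q : near t (fun w => - k < -1 * u w)).
  { apply (P (fun w => -1 * u w)); [|lra]. apply rcont_mult; [apply rcont_const|exact Hu]. }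
  revert Q. apply near_imp. intros; lra. }
generalize (near_and _ _ _ (near_and _ _ _ (P Re a (rcont_fst t) H1) (P' Re b (rcont_fst t) H2))
  (near_and _ _ _ (P Im c (rcont_snd t) H3) (P' Im d (rcont_snd t) H4))).
apply near_imp. tauto.
Qed.

(** Nested rectangles: zeros and poles are collected on the largest, division by [Pz] leaves a
    nonvanishing holomorphic g on its interior, a logarithm of g is taken on a middle one, and on
    the smallest exp H = g holds in full neighbourhoods. The smallest contains the truncated
    fundamental domain with room on all sides. *)
Lemma factorization F (oF : C -> Z) Y : 1 <= Y ->
  (forall t, 0 < Im t -> is_ord F t (oF t)) ->
  exists L H, NoDup L /\ (forall t, In t L -> inR (-7/8) (7/8) (1/4) (Y+2) t /\ oF t <> 0%Z) /\
    (forall t, inR (-7/8) (7/8) (1/4) (Y+2) t -> oF t <> 0%Z -> In t L) /\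
    forall t, inR (-3/4) (3/4) (1/3) (Y+1) t -> hol H t /\ pnear t (fun w => F w = Fn L oF H w).
Proof.
intros HY Hord.
assert (Hpos : forall t, inR (-7/8) (7/8) (1/4) (Y+2) t -> 0 < Im t) by (intros t [_ H]; lra).
destruct (finite_zeros F (-7/8) (7/8) (1/4) (Y+2)) as [L0 [N0 [I0 Z0]]].
{ intros t Ht. exists (oF t). apply Hord. auto. }
set (L := filter (fun t => negb (Z.eqb (oF t) 0)) L0).
assert (HL1 : forall t, In t L -> inR (-7/8) (7/8) (1/4) (Y+2) t /\ oF t <> 0%Z).
{ intros t Ht. apply filter_In in Ht. destruct Ht as [A B]. split; [auto|].
  intros E. rewrite E in B. discriminate. }
assert (HL2 : forall t, inR (-7/8) (7/8) (1/4) (Y+2) t -> oF t <> 0%Z -> In t L).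
{ intros t Ht E. apply filter_In. split.
  - apply NNPP. intros N. apply E. apply (is_ord_unique F t); auto.
  - destruct (Z.eqb_spec (oF t) 0); [contradiction|reflexivity]. }
exists L.
assert (NL : NoDup L) by now apply NoDup_filter.
set (Om := fun t : C => -7/8 < Re t < 7/8 /\ 1/4 < Im t < Y + 2).
assert (OmR : forall t, Om t -> inR (-7/8) (7/8) (1/4) (Y+2) t) by (unfold Om, inR; intros; lra).
destruct (normalize Om (fun w => F w * Pz L (fun t => (- oF t)%Z) w)%C) as [g Hg].
{ intros t Ht. apply OmR in Ht. replace 0%Z with (oF t + - oF t)%Z by ring.
  apply is_ord_mult; [auto|]. destruct (classic (In t L)) as [I|I].
  - now apply (is_ord_Pz_in L (fun t => (- oF t)%Z)).
  - replace (oF t) with 0%Z; [now apply is_ord_Pz_notin|].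
    apply NNPP. intros E. apply I. apply HL2; auto. }
{ intros t [A B]. now apply near_inR. }
assert (R1Om : forall t, inR (-3/4) (3/4) (1/3) (Y+1) t -> Om t) by (unfold Om, inR; intros; lra).
assert (Hg2 : exists H, forall t, inR (-3/4) (3/4) (1/3) (Y+1) t -> hol H t /\ near t (fun w => cexp (H w) = g w)).
{ destruct (hol_log g (-13/16) (13/16) (7/24) (Y+3/2)) as [H HH]; try lra.
  - intros t Ht. assert (Ot : Om t) by (unfold Om, inR in *; lra).
    destruct (Hg t Ot) as [A [B _]]. auto.
  - exists H. intros t Ht. split; [apply HH; unfold inR in *; lra|].
    assert (N : near t (fun w => -13/16 < Re w < 13/16 /\ 7/24 < Im w < Y+3/2))
      by (apply near_inR; unfold inR in *; lra).
    revert N. apply near_imp. intros w Hw. apply HH. unfold inR; lra. }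
destruct Hg2 as [H HH].
exists H. split; [exact NL|]. split; [exact HL1|]. split; [exact HL2|].
intros t Ht. destruct (HH t Ht) as [A B]. split; [exact A|].
destruct (Hg t (R1Om t Ht)) as [_ [_ E]].
generalize (pnear_and _ _ _ (pnear_notin L t) (pnear_and _ _ _ E (near_pnear _ _ B))).
apply pnear_imp. intros w [W1 [W2 W3]]. unfold Fn. rewrite W3, <- W2.
transitivity (F w * (Pz L oF w * Pz L (fun t => (- oF t)%Z) w))%C; [|ring].
rewrite Pz_opp by exact W1. ring.
Qed.

(** A positive lower bound for |F| excludes a zero, an upper bound a pole. *)
Lemma ord_0_of_bounds F t n m M : 0 < m -> is_ord F t n ->
  near t (fun w => m <= Cmod (F w) <= M) -> n = 0%Z.
Proof.
intros Hm [g [Hg [H0 Hf]]] B.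
assert (Cg : ccont g t) by (apply hol_cont; exact (near_self _ _ Hg)).
assert (Cp : forall k, ccont (fun w => cpown (w - t) k) t).
{ intros k. apply (ccont_comp (fun z => cpown z k) (fun w => w - t)%C); [|apply ccont_sub].
  apply hol_cont, hol_cpown. }
assert (P0 : forall p, cpown (t - t) (Pos.to_nat p) = 0%C).
{ intros p. rewrite Cminus_diag. destruct (Pos2Nat.is_succ p) as [j ->]. simpl. ring. }
destruct n as [|p|p]; [reflexivity|exfalso|exfalso].
- assert (K : m <= Cmod (cpown (t - t) (Pos.to_nat p) * g t)%C).
  { apply (rcont_pnear_le (fun _ => m) (fun w => Cmod (cpown (w - t) (Pos.to_nat p) * g w)%C)).
    - apply rcont_const.
    - apply rcont_Cmod. now apply ccont_mult.
    - generalize (pnear_and _ _ _ Hf (near_pnear _ _ B)). apply pnear_imp. intros w [E [A _]].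
      rewrite E in A. exact A. }
  rewrite P0, Cmult_0_l, Cmod_0 in K. lra.
- apply H0. apply Cmod_eq_0. apply Rle_antisym; [|apply Cmod_ge_0].
  replace 0 with (Cmod (cpown (t - t) (Pos.to_nat p)) * M) by (rewrite P0, Cmod_0; ring).
  apply (rcont_pnear_le (fun w => Cmod (g w)) (fun w => Cmod (cpown (w - t) (Pos.to_nat p)) * M)).
  + now apply rcont_Cmod.
  + apply rcont_mult; [apply rcont_Cmod, Cp|apply rcont_const].
  + generalize (pnear_and _ _ _ (pnear_sub_neq0 t) (pnear_and _ _ _ Hf (near_pnear _ _ B))).
    apply pnear_imp. intros w [N [E [_ A]]].
    pose proof (czpow_neq0 _ (Z.pos p) N) as Np. simpl in Np, E.
    replace (g w) with (cpown (w - t) (Pos.to_nat p) * F w)%C by (rewrite E; field; exact Np).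
    rewrite Cmod_mult. apply Rmult_le_compat_l; [apply Cmod_ge_0|exact A].
Qed.

Lemma eC_cexp z : eC z = cexp ((0, (2 * PI)%R) * z)%C.
Proof. reflexivity. Qed.

Lemma hol_eC (k : C) t : hol (fun w => eC (k * w)%C) t.
Proof.
unfold eC. apply (hol_comp cexp); [apply hol_cexp|]. apply hol_mult; [apply hol_const|].
apply hol_mult; [apply hol_const|apply hol_id].
Qed.

(** Above all zeros each w - t lies in the upper half plane, where the principal argument is pi/2 +
    [Hor]. Hence [HH] is, up to a constant, a continuous argument of F along the top side. *)
Lemma Pz_upper L o w : (forall t, In t L -> Im t < Im w) ->
  exists u, Pz L o w =
   cexp (u, (sumL L (fun t => IZR (o t) * (PI / 2)) + sumL L (fun t => IZR (o t) * Hor (Re t) (Im t) (Im w) (Re w)))%R).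
Proof.
induction L as [|a L IH]; simpl; intros H.
- exists 0. rewrite Rplus_0_r. symmetry. exact cexp_0.
- destruct IH as [u ->]; [intros; apply H; auto|].
  assert (Ha : 0 < Im (w - a)%C) by (specialize (H a (or_introl eq_refl)); unfold Im in *; simpl; lra).
  assert (N : (w - a)%C <> 0) by (intros E; rewrite E in Ha; simpl in Ha; lra).
  exists (IZR (o a) * ln (Cmod (w - a)) + u)%R.
  rewrite <- (cexp_Clog (w - a) N) at 1. rewrite czpow_cexp, <- cexp_add. f_equal.
  assert (Ec : Clog (w - a) = (ln (Cmod (w - a)), (PI / 2 + Hor (Re a) (Im a) (Im w) (Re w))%R)).
  { apply injective_projections; [reflexivity|]. rewrite Clog_upper by exact Ha.
    unfold Lg, Hor, Re, Im in *; simpl in *. f_equal. rewrite <- atan_opp. f_equal. field. lra. }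
  rewrite Ec. unfold Cplus, Cmult, RtoC; simpl. f_equal; ring.
Qed.

Lemma IVT_weak (g : R -> R) a b : a <= b -> (forall x, a <= x <= b -> continuity_pt g x) ->
  g a < 0 -> 0 <= g b -> exists x, a <= x <= b /\ g x = 0.
Proof.
intros Hab Hc Ha Hb. destruct (Req_dec (g b) 0) as [E|E]; [exists b; lra|].
assert (Hlt : a < b) by (destruct (Req_dec a b) as [->|]; lra).
destruct (IVT_interv g a b Hc Hlt Ha ltac:(lra)) as [x Hx]. now exists x.
Qed.

(** If the curve turned by v or more, the intermediate value theorem would give a point B turned by
    exactly v or -v from the start A. Then |Im(conj(A) (B - A))| = |A| |B| sin v, but it is at most
    |A| |B - A|, where |B - A| is at most 2 e; this contradicts 4 e < |c| sin v. *)
Lemma small_turn (psi : R -> R) (N0 : R) (c : C) e v a b : a <= b -> 0 < v < PI ->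
  0 < e -> 4 * e < Cmod c * sin v ->
  (forall x, a <= x <= b -> continuous psi x) ->
  (forall x, a <= x <= b -> exists u, Cmod (cexp (u, (psi x + N0)%R) - c) <= e) ->
  Rabs (psi b - psi a) < v.
Proof.
intros Hab Hv He Hc Hcont H. apply Rnot_le_lt. intros Hge.
assert (Sv : 0 < sin v) by (apply sin_gt_0; lra).
assert (Sv1 : sin v <= 1) by apply SIN_bound.
assert (Ex : exists x s, a <= x <= b /\ (s = 1 \/ s = -1) /\ psi x = psi a + s * v).
{ destruct (Rle_dec 0 (psi b - psi a)) as [P|P].
  - rewrite Rabs_pos_eq in Hge by exact P.
    destruct (IVT_weak (fun x => psi x - (psi a + v)) a b) as [x [Hx E]]; try lra.
    + intros x Hx. apply continuity_pt_minus; [apply continuity_pt_filterlim; now apply Hcont|].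
      apply continuity_pt_const. intros p q. reflexivity.
    + exists x, 1. split; [exact Hx|]. split; [now left|]. lra.
  - rewrite Rabs_left in Hge by lra.
    destruct (IVT_weak (fun x => (psi a - v) - psi x) a b) as [x [Hx E]]; try lra.
    + intros x Hx. apply continuity_pt_minus; [|apply continuity_pt_filterlim; now apply Hcont].
      apply continuity_pt_const. intros p q. reflexivity.
    + exists x, (-1). split; [exact Hx|]. split; [now right|]. lra. }
destruct Ex as [x [s [Hx [Hs E]]]].
destruct (H a ltac:(lra)) as [u1 A1]. destruct (H x Hx) as [u2 A2].
set (A := cexp (u1, (psi a + N0)%R)) in *. set (B := cexp (u2, (psi x + N0)%R)) in *.
assert (MA : 0 < Cmod A) by apply Cmod_gt_0, cexp_neq0.
assert (MB : Cmod c - e <= Cmod B).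
{ pose proof (Cmod_triangle B (c - B)) as T. replace (B + (c - B))%C with c in T by ring.
  rewrite (Cmod_minus_sym c B) in T. lra. }
assert (D : Cmod (B - A) <= 2 * e).
{ replace (B - A)%C with ((B - c) + (c - A))%C by ring.
  eapply Rle_trans; [apply Cmod_triangle|]. rewrite (Cmod_minus_sym c A). lra. }
assert (I1 : Im (Cconj A * (B - A))%C = Cmod A * Cmod B * (s * sin v)).
{ unfold A, B. rewrite !Cmod_cexp. unfold cexp, Cconj, Im, Re; simpl. rewrite E.
  replace (psi a + s * v + N0) with (s * v + (psi a + N0)) by ring.
  set (q := psi a + N0). rewrite sin_plus, cos_plus.
  assert (S1 : sin (s * v) = s * sin v).
  { destruct Hs as [-> | ->]; [now rewrite !Rmult_1_l|].
    replace (-1 * v) with (- v) by ring. rewrite sin_neg. ring. }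
  rewrite S1. pose proof (sin2_cos2 q) as Q. unfold Rsqr in Q.
  transitivity (exp u1 * exp u2 * (s * sin v) * (sin q * sin q + cos q * cos q)); [ring|].
  rewrite Q. ring. }
pose proof (im_le_Cmod (Cconj A * (B - A))) as I2. rewrite I1, Cmod_mult, Cmod_conj in I2.
assert (Sab : Rabs (s * sin v) = sin v).
{ destruct Hs as [-> | ->]; [rewrite Rmult_1_l; apply Rabs_pos_eq; lra|].
  replace (-1 * sin v) with (- sin v) by ring. rewrite Rabs_Ropp. apply Rabs_pos_eq; lra. }
rewrite Rabs_mult, (Rabs_mult (Cmod A)), Sab, (Rabs_pos_eq (Cmod A)), (Rabs_pos_eq (Cmod B)) in I2
  by apply Cmod_ge_0.
rewrite Rmult_assoc in I2. apply Rmult_le_reg_l in I2; [|exact MA].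
nra.
Qed.

Definition mT : mat := Mat 1 1 0 1.
Definition mS : mat := Mat 0 (-1) 1 0.

Lemma mob_mT w : mob mT w = (w + 1)%C.
Proof. unfold mob, mT, ZtoC; simpl. field. Qed.

Lemma mob_mS (w : C) : w <> 0 -> mob mS w = (- / w)%C.
Proof. intros H. unfold mob, mS, ZtoC; simpl.
replace (RtoC (-1)) with (- RtoC 1)%C by (rewrite <- RtoC_opp; f_equal; lra). field. auto. Qed.

Lemma Im_neq0 (w : C) : 0 < Im w -> w <> 0.
Proof. intros H E. rewrite E in H. simpl in H. lra. Qed.

(** The leading behaviour c e(rw), uniform in Re w. It multiplies easily, whereas expansions with
    different kappa and h do not. *)
Definition asympt (F : C -> C) (r : R) (c : C) : Prop :=
  forall e, 0 < e -> exists Y, forall w, Y < Im w -> Cmod (F w * eC (RtoC (- r) * w) - c) < e.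

Lemma is_ord_eC F t n (k : C) : is_ord F t n -> is_ord (fun w => F w * eC (k * w))%C t n.
Proof.
intros H. replace n with (n + 0)%Z by ring. apply is_ord_mult; [exact H|].
apply is_ord_hol; [apply near_all; intros; apply hol_eC|apply cexp_neq0].
Qed.

Lemma asympt_ord_0 F r (c : C) : c <> 0 -> asympt F r c ->
  exists Y, forall t n, Y < Im t -> is_ord F t n -> n = 0%Z.
Proof.
intros Hc HA. assert (Mc : 0 < Cmod c) by now apply Cmod_gt_0.
destruct (HA (Cmod c / 2)) as [Y HY]; [lra|]. exists Y. intros t n Ht Hn.
apply (ord_0_of_bounds _ t n (Cmod c / 2) (2 * Cmod c) ltac:(lra) (is_ord_eC _ _ _ (RtoC (- r)) Hn)).
assert (N : near t (fun w => 0 < Im w + - Y)).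
{ apply (near_rcont_pos (fun w => Im w + - Y)); [|lra].
  apply rcont_plus; [apply rcont_snd|apply rcont_const]. }
revert N. apply near_imp. intros w Hw. specialize (HY w ltac:(lra)).
pose proof (Rabs_Cmod_sub (F w * eC (RtoC (- r) * w)) c) as B. apply Rabs_le_between in B. lra.
Qed.

(** The defect X of the formula, times 2 pi, is shown to be smaller than every v in (0, pi). For
    given v the domain is cut at a height above which F has no zeros or poles and F(z) e(-rz) is
    e-close to c; by [small_turn] the top side then contributes 2 pi r up to an error below v. *)
Lemma level_one (F : C -> C) (oF : C -> Z) K r (c : C) :
  (forall t, 0 < Im t -> is_ord F t (oF t)) ->
  (forall t, 0 < Im t -> pnear t (fun w => Cmod (F (mob mT w)) = Cmod (F w))) ->
  (forall t, 0 < Im t -> pnear t (fun w => Cmod (F (mob mS w)) = exp (K * ln (Cmod w)) * Cmod (F w))) ->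
  c <> 0 -> asympt F r c ->
  forall Z : list C, NoDup Z ->
  (forall t, 0 < Im t -> wD (Re t) (Im t) <> 0 -> oF t <> 0%Z -> In t Z) ->
  (forall t, In t Z -> 0 < Im t) ->
  sumL Z (fun t => IZR (oF t) * wD (Re t) (Im t)) + r = K / 12.
Proof.
intros Hord HT HS Hc HA Z NZ HZ HZpos.
assert (Mc : 0 < Cmod c) by now apply Cmod_gt_0.
destruct (asympt_ord_0 F r c Hc HA) as [Y0 HY0].
set (X := 2 * PI * (sumL Z (fun t => IZR (oF t) * wD (Re t) (Im t)) + r - K / 12)).
cut (forall v, 0 < v < PI -> Rabs X < v).
{ intros Hv. pose proof PI_RGT_0 as Pi. destruct (Req_dec X 0) as [E|E].
  - unfold X in E. apply Rmult_integral in E. lra.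
  - exfalso. assert (P := Rabs_pos_lt _ E). pose proof (Hv (Rmin (PI/2) (Rabs X))) as Q.
    pose proof (Rmin_l (PI/2) (Rabs X)). pose proof (Rmin_r (PI/2) (Rabs X)).
    assert (0 < Rmin (PI/2) (Rabs X)) by (apply Rmin_glb_lt; lra). lra. }
intros v Hv.
assert (Sv : 0 < sin v) by (apply sin_gt_0; lra).
(* The 5 leaves room for the strict inequality 4 e < |c| sin v of [small_turn]. *)
set (e := Cmod c * sin v / 5). assert (He : 0 < e) by (unfold e; nra).
destruct (HA e He) as [Y1 HY1].
set (Y := 1 + Rmax 0 (Rmax Y0 Y1)).
assert (BY : 1 <= Y /\ Y0 < Y /\ Y1 < Y).
{ unfold Y. pose proof (Rmax_l 0 (Rmax Y0 Y1)). pose proof (Rmax_r 0 (Rmax Y0 Y1)).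
  pose proof (Rmax_l Y0 Y1). pose proof (Rmax_r Y0 Y1). lra. }
destruct BY as [BY [BY0 BY1]].
destruct (factorization F oF Y BY Hord) as [L [H [NL [L1 [L2 L3]]]]].
assert (Lpos : forall t, In t L -> 0 < Im t < Y /\ - 1 < Re t).
{ intros t Ht. destruct (L1 t Ht) as [[A B] D]. split; [|lra]. split; [lra|].
  apply Rnot_le_lt. intros Q. apply D. apply (HY0 t); [lra|]. apply Hord. lra. }
assert (S32 : 1 < sqrt 3 < 2) by (pose proof sqrt3_pos; pose proof sqrt3_sq; split; nra).
assert (R1 : forall x y, - (1/2) <= x <= 1/2 -> 1/2 <= y <= Y -> inR (-3/4) (3/4) (1/3) (Y+1) (x, y)).
{ intros x y Hx Hy. unfold inR, Re, Im; simpl. lra. }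
assert (Good : forall t, inR (-3/4) (3/4) (1/3) (Y+1) t -> ~ In t L ->
   ccont (Fn L oF H) t).
{ intros t Ht N. apply hol_cont, hol_Fn; [exact N|]. now apply L3. }
assert (FI := flux_identity L oF H Y K BY Lpos).
assert (FI' : 2 * PI * sumL L (fun t => IZR (oF t) * wD (Re t) (Im t)) =
    K * PI / 6 + (HH L oF H Y (- (1/2)) - HH L oF H Y (1/2))).
{ apply FI; clear FI.
  - intros x y Hx Hy. apply L3. now apply R1.
  - intros y Hy N1 N2. set (z := (- (1/2), y) : C).
    assert (Iz : 0 < Im z) by (unfold z, Im; simpl; lra).
    assert (Ez : mob mT z = (1/2, y)).
    { rewrite mob_mT. unfold z, Cplus; simpl. f_equal; lra. }
    assert (Rz : inR (-3/4) (3/4) (1/3) (Y+1) z) by (apply R1; lra).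
    assert (Rz' : inR (-3/4) (3/4) (1/3) (Y+1) (mob mT z)) by (rewrite Ez; apply R1; lra).
    assert (Cm : ccont (mob mT) z) by (apply hol_cont, hol_mob; [reflexivity|exact Iz]).
    (* The relation is known for F on punctured neighbourhoods only. Since [Fn] is continuous off L,
       it extends to a full neighbourhood, as the comparison of normal derivatives requires. *)
    assert (Q : pnear z (fun w => Cmod (Fn L oF H (mob mT w)) = Cmod (Fn L oF H w))).
    { generalize (pnear_and _ _ _ (HT z Iz) (pnear_and _ _ _ (proj2 (L3 z Rz))
        (pnear_mob mT z _ eq_refl Iz (proj2 (L3 _ Rz'))))).
      apply pnear_imp. intros w [A [<- <-]]. exact A. }
    assert (Q' : near z (fun w => Cmod (Fn L oF H (mob mT w)) = Cmod (Fn L oF H w))).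
    { apply pnear_near; [|exact Q].
      apply (rcont_pnear_eq (fun w => Cmod (Fn L oF H (mob mT w))) (fun w => Cmod (Fn L oF H w))); [| |exact Q].
      - apply (rcont_Cmod (fun w => Fn L oF H (mob mT w))). apply ccont_comp; [|exact Cm].
        apply Good; [exact Rz'|]. now rewrite Ez.
      - apply rcont_Cmod. now apply Good. }
    assert (N1' : ~ In (mob mT z) L) by now rewrite Ez.
    generalize (near_and _ _ _ Q' (near_and _ _ _ (near_notin L z N2)
      (near_ccont _ _ _ Cm (near_notin L _ N1')))).
    apply near_imp. intros w [A [B D]]. rewrite <- mob_mT, !UU_ln, A by assumption. reflexivity.
  - intros s Hs N1 N2. set (z := (arcX s, arcY s) : C).
    assert (XY := arc_norm s).
    assert (Hs0 : 0 < s) by lra.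
    assert (SQ : 1 < s * s < 3) by (pose proof sqrt3_sq; split; nra).
    assert (BX : - (1/2) <= arcX s <= 0).
    { unfold arcX. split; [apply Rle_div_r|apply Rle_div_l]; lra. }
    assert (BYs : 0 < arcY s) by (unfold arcY; apply Rdiv_lt_0_compat; lra).
    assert (BYs' : 1/2 <= arcY s <= 1) by (assert (QX : arcX s * arcX s <= 1/4) by nra; split; nra).
    assert (Iz : 0 < Im z) by exact BYs.
    assert (Ez : mob mS z = (arcX (/ s), arcY (/ s))).
    { rewrite mob_mS by now apply Im_neq0. destruct (arc_Rinv s Hs0) as [-> ->].
      unfold z, Copp, Cinv; simpl.
      replace (arcX s * (arcX s * 1) + arcY s * (arcY s * 1)) with 1 by lra. f_equal; field. }
    assert (Rz : inR (-3/4) (3/4) (1/3) (Y+1) z) by (apply R1; lra).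
    assert (Rz' : inR (-3/4) (3/4) (1/3) (Y+1) (mob mS z)).
    { rewrite Ez. destruct (arc_Rinv s Hs0) as [-> ->]. apply R1; lra. }
    assert (Cm : ccont (mob mS) z) by (apply hol_cont, hol_mob; [reflexivity|exact Iz]).
    assert (Q : pnear z (fun w => Cmod (Fn L oF H (mob mS w)) = exp (K * ln (Cmod w)) * Cmod (Fn L oF H w))).
    { generalize (pnear_and _ _ _ (HS z Iz) (pnear_and _ _ _ (proj2 (L3 z Rz))
        (pnear_mob mS z _ eq_refl Iz (proj2 (L3 _ Rz'))))).
      apply pnear_imp. intros w [A [<- <-]]. exact A. }
    assert (Q' : near z (fun w => Cmod (Fn L oF H (mob mS w)) = exp (K * ln (Cmod w)) * Cmod (Fn L oF H w))).
    { apply pnear_near; [|exact Q].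
      apply (rcont_pnear_eq (fun w => Cmod (Fn L oF H (mob mS w)))
        (fun w => exp (K * ln (Cmod w)) * Cmod (Fn L oF H w))); [| |exact Q].
      - apply (rcont_Cmod (fun w => Fn L oF H (mob mS w))). apply ccont_comp; [|exact Cm].
        apply Good; [exact Rz'|]. now rewrite Ez.
      - apply rcont_mult; [|apply rcont_Cmod; now apply Good].
        apply (rcont_comp exp (fun w => K * ln (Cmod w))).
        + apply derivable_continuous_pt, derivable_pt_exp.
        + apply rcont_mult; [apply rcont_const|]. apply (rcont_ln Cmod).
          * apply (rcont_Cmod (fun w => w)), ccont_id.
          * apply Cmod_gt_0. now apply Im_neq0. }
    assert (N2' : ~ In (mob mS z) L) by now rewrite Ez.
    generalize (near_and _ _ _ (near_Im z Iz) (near_and _ _ _ Q' (near_and _ _ _ (near_notin L z N1)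
      (near_ccont _ _ _ Cm (near_notin L _ N2'))))).
    apply near_imp. intros w [Iw [A [B D]]]. rewrite <- mob_mS by now apply Im_neq0.
    rewrite !UU_ln, A by assumption. rewrite ln_mult, ln_exp; [reflexivity|apply exp_pos|].
    rewrite Cmod_Fn by exact B. apply exp_pos. }
clear FI.
assert (ES : sumL L (fun t => IZR (oF t) * wD (Re t) (Im t)) = sumL Z (fun t => IZR (oF t) * wD (Re t) (Im t))).
{ apply sumL_support; [exact NL|exact NZ|]. intros t Hne.
  assert (Ow : oF t <> 0%Z) by (intros E; apply Hne; rewrite E; ring).
  assert (Ww : wD (Re t) (Im t) <> 0) by (intros E; apply Hne; rewrite E; ring).
  split; intros I.
  - apply HZ; auto. now apply Lpos.
  - specialize (HZpos t I). apply L2; [|exact Ow]. split.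
    + unfold wD in Ww. destruct (Rlt_dec (Re t * Re t + Im t * Im t) 1); [lra|].
      destruct (Rlt_dec (1/2) (Re t)); [lra|]. destruct (Rlt_dec (Re t) (-(1/2))); lra.
    + unfold wD in Ww. destruct (Rlt_dec (Re t * Re t + Im t * Im t) 1); [lra|].
      destruct (Rlt_dec (1/2) (Re t)); [lra|]. destruct (Rlt_dec (Re t) (-(1/2))); [lra|].
      split; [nra|]. apply Rnot_lt_le. intros Q. apply Ow, (HY0 t); [lra|]. now apply Hord. }
rewrite ES in FI'. clear ES.
(* Up to a constant, the argument of F(z) e(-rz) on the top side. *)
set (psi := fun x => HH L oF H Y x - 2 * PI * r * x).
assert (ST : Rabs (psi (1/2) - psi (- (1/2))) < v).
{ apply (small_turn psi (sumL L (fun t => IZR (oF t) * (PI / 2))) c e); [lra|exact Hv|exact He| | |].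
  - unfold e. assert (0 < Cmod c * sin v) by nra. lra.
  - intros x Hx. apply @continuous_minus; [apply continuous_HH; apply L3, R1; lra|].
    apply @ex_derive_continuous. auto_derive. auto.
  - intros x Hx. set (z := (x, Y) : C).
    assert (Rz : inR (-3/4) (3/4) (1/3) (Y+1) z) by (apply R1; lra).
    assert (Nz : ~ In z L).
    { intros I. apply Lpos in I. unfold z, Im in I; simpl in I. lra. }
    assert (B : Cmod (Fn L oF H z * eC (RtoC (- r) * z) - c) <= e).
    { apply (rcont_pnear_le (fun w => Cmod (Fn L oF H w * eC (RtoC (- r) * w) - c)) (fun _ => e)).
      - apply (rcont_Cmod (fun w => Fn L oF H w * eC (RtoC (- r) * w) - c)%C).
        apply ccont_minus; [|apply ccont_const]. apply ccont_mult; [now apply Good|].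
        apply hol_cont, hol_eC.
      - apply rcont_const.
      - assert (N : near z (fun w => 0 < Im w + - Y1)).
        { apply (near_rcont_pos (fun w => Im w + - Y1)); [|unfold z, Im; simpl; lra].
          apply rcont_plus; [apply rcont_snd|apply rcont_const]. }
        generalize (pnear_and _ _ _ (proj2 (L3 z Rz)) (near_pnear _ _ N)). apply pnear_imp.
        intros w [<- Hw]. left. apply HY1. lra. }
    destruct (Pz_upper L oF z) as [u Hu].
    { intros t Ht. unfold z, Im at 2; simpl. now apply Lpos. }
    exists (u + Re (H z) + 2 * PI * r * Y). eapply Rle_trans; [|exact B]. right. f_equal. f_equal.
    unfold Fn. rewrite Hu, eC_cexp, <- !cexp_add. f_equal.
    unfold psi, HH. rewrite (surjective_pairing (H z)).
    unfold Cplus, Cmult, RtoC, z, Re, Im; simpl. f_equal; ring. }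
unfold psi in ST. unfold X. apply Rabs_def2 in ST. apply Rabs_def1; lra.
Qed.

(** * Reduction to the fundamental domain *)

Definition w (t : C) : R := wD (Re t) (Im t).

Lemma wD_neq0 a b : wD a b <> 0 <-> 1 <= a * a + b * b /\ - (1/2) <= a <= 1/2.
Proof.
unfold wD. destruct (Rlt_dec (a*a+b*b) 1); [split; lra|]. destruct (Rlt_dec (1/2) a); [split; lra|].
destruct (Rlt_dec a (-(1/2))); [split; lra|]. split; [lra|]. intros _.
destruct (Req_EM_T (a*a+b*b) 1), (Req_EM_T a (1/2)), (Req_EM_T a (-(1/2))); lra.
Qed.

Lemma wD_opp a b : wD (- a) b = wD a b.
Proof.
unfold wD. replace (- a * - a) with (a * a) by ring.
destruct (Rlt_dec (a*a+b*b) 1); [lra|].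
destruct (Rlt_dec (1/2) (-a)), (Rlt_dec (-a) (-(1/2))), (Rlt_dec (1/2) a), (Rlt_dec a (-(1/2))); try lra;
destruct (Req_EM_T (a*a+b*b) 1), (Req_EM_T a (1/2)), (Req_EM_T a (-(1/2))),
  (Req_EM_T (-a) (1/2)), (Req_EM_T (-a) (-(1/2))); lra.
Qed.

Lemma Cmod_den_sq A t : Cmod (den A t) * Cmod (den A t) =
  IZR (mc A) * IZR (mc A) * (Re t * Re t + Im t * Im t) + 2 * (IZR (mc A) * IZR (md A)) * Re t
  + IZR (md A) * IZR (md A).
Proof. rewrite Cmod_sq, Re_den, Im_den. ring. Qed.

(** For t in the domain |ct + d|^2 = c^2 |t|^2 + 2cd Re t + d^2 is at least c^2 - |cd| + d^2, a
    positive integer. *)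
Lemma den_ge_1 A t : SL2Z A -> w t <> 0 -> 1 <= Cmod (den A t) * Cmod (den A t).
Proof.
intros HA Ht. apply wD_neq0 in Ht. rewrite Cmod_den_sq. apply SL2Z_eq in HA.
set (N := Re t * Re t + Im t * Im t) in *. set (a := Re t) in *. destruct Ht as [HN Ha].
assert (Z1 : (1 <= mc A * mc A - Z.abs (mc A * md A) + md A * md A)%Z).
{ assert ((mc A <> 0 \/ md A <> 0)%Z) by (destruct (Z.eq_dec (mc A) 0), (Z.eq_dec (md A) 0); [exfalso; nia|auto|auto|auto]).
  rewrite Z.abs_mul. pose proof (Z.abs_square (mc A)). pose proof (Z.abs_square (md A)).
  assert (0 <= Z.abs (mc A))%Z by lia. assert (0 <= Z.abs (md A))%Z by lia. nia. }
apply IZR_le in Z1. rewrite plus_IZR, minus_IZR, abs_IZR, !mult_IZR in Z1.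
assert (B : - Rabs (IZR (mc A) * IZR (md A)) <= 2 * (IZR (mc A) * IZR (md A)) * a).
{ pose proof (Rabs_pos (IZR (mc A) * IZR (md A))) as P.
  pose proof (Rle_abs (IZR (mc A) * IZR (md A))) as P1.
  pose proof (Rle_abs (- (IZR (mc A) * IZR (md A)))) as P2. rewrite Rabs_Ropp in P2. nra. }
pose proof (Rle_0_sqr (IZR (mc A))) as S. unfold Rsqr in S. nra.
Qed.

Lemma mob_unit_den A t : SL2Z A -> 0 < Im t -> Cmod (den A t) * Cmod (den A t) = 1 ->
  Im (mob A t) = Im t /\
  Re (mob A t) = IZR (ma A) * IZR (mc A) * (Re t * Re t + Im t * Im t)
     + (IZR (ma A) * IZR (md A) + IZR (mb A) * IZR (mc A)) * Re t + IZR (mb A) * IZR (md A).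
Proof.
intros HA Ht E. split; [rewrite Im_mob, E by assumption; field|].
assert (N := den_neq0 A t HA Ht).
assert (Ec : (/ den A t)%C = Cconj (den A t)).
{ replace (Cconj (den A t)) with (den A t * Cconj (den A t) / den A t)%C by (field; exact N).
  replace (den A t * Cconj (den A t))%C with (RtoC 1); [field; exact N|].
  rewrite Cmod_sq in E. set (z := den A t) in *. clearbody z. destruct z as [z1 z2].
  unfold Re, Im in E; simpl in E. unfold RtoC, Cconj, Cmult; simpl. f_equal; lra. }
rewrite mob_den. unfold Cdiv. rewrite Ec. unfold den, ZtoC, Cconj, Re, Im; destruct t; simpl. ring.
Qed.

(** The denominators of A at t and of its inverse at A t both have modulus at least 1, and their
    product is 1. *)
Lemma both_in_D A t : SL2Z A -> 0 < Im t -> w t <> 0 -> w (mob A t) <> 0 ->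
  Cmod (den A t) * Cmod (den A t) = 1.
Proof.
intros HA Ht H1 H2. assert (D1 := den_ge_1 A t HA H1).
assert (D2 := den_ge_1 (minv A) (mob A t) (SL2Z_minv A HA) H2).
assert (E : (den (minv A) (mob A t) * den A t)%C = 1%C).
{ rewrite <- den_mmul by assumption. rewrite mmul_inv_l by assumption. unfold den, mI, ZtoC; simpl. ring. }
apply (f_equal Cmod) in E. rewrite Cmod_mult, Cmod_1 in E.
set (u := Cmod (den (minv A) (mob A t))) in *. set (v := Cmod (den A t)) in *.
assert (0 <= u) by apply Cmod_ge_0. assert (0 <= v) by apply Cmod_ge_0.
assert (EE : (u * u) * (v * v) = 1) by (transitivity ((u * v) * (u * v)); [ring|rewrite E; ring]). nra.
Qed.

Lemma small_row A t : SL2Z A -> w t <> 0 -> Cmod (den A t) * Cmod (den A t) = 1 ->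
  (-1 <= mc A <= 1 /\ -1 <= md A <= 1)%Z.
Proof.
intros HA Ht E. apply wD_neq0 in Ht. rewrite Cmod_den_sq in E.
set (N := Re t * Re t + Im t * Im t) in *. set (a := Re t) in *. destruct Ht as [HN Ha].
assert (B : - Rabs (IZR (mc A) * IZR (md A)) <= 2 * (IZR (mc A) * IZR (md A)) * a).
{ pose proof (Rabs_pos (IZR (mc A) * IZR (md A))) as P.
  pose proof (Rle_abs (IZR (mc A) * IZR (md A))) as P1.
  pose proof (Rle_abs (- (IZR (mc A) * IZR (md A)))) as P2. rewrite Rabs_Ropp in P2. nra. }
pose proof (Rle_0_sqr (IZR (mc A))) as S. unfold Rsqr in S.
assert (Q : IZR (mc A * mc A - Z.abs (mc A * md A) + md A * md A) <= IZR 1).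
{ rewrite plus_IZR, minus_IZR, abs_IZR, !mult_IZR. nra. }
apply le_IZR in Q. rewrite Z.abs_mul in Q.
pose proof (Z.abs_square (mc A)). pose proof (Z.abs_square (md A)).
assert (0 <= Z.abs (mc A))%Z by lia. assert (0 <= Z.abs (md A))%Z by lia.
assert (Z.abs (mc A) <= 1 /\ Z.abs (md A) <= 1)%Z by (split; nia). lia.
Qed.

(** The inverse has bottom row (-c, a), so the bound on bottom rows also reaches a. *)
Lemma small_entries A t : SL2Z A -> 0 < Im t -> w t <> 0 -> w (mob A t) <> 0 ->
  ((-1 <= mc A <= 1) /\ (-1 <= md A <= 1) /\ (-1 <= ma A <= 1))%Z.
Proof.
intros HA Ht H1 H2. assert (E := both_in_D A t HA Ht H1 H2).
destruct (small_row A t HA H1 E) as [B1 B2].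
assert (HI := SL2Z_minv A HA). assert (Ht' := Im_mob_pos A t HA Ht).
assert (E' : Cmod (den (minv A) (mob A t)) * Cmod (den (minv A) (mob A t)) = 1).
{ apply both_in_D; auto. now rewrite mob_minv_l. }
destruct (small_row (minv A) (mob A t) HI H2 E') as [B3 B4]. simpl in B4. auto.
Qed.

(* The elements of SL_2(Z) moving a point t of the fundamental domain within it; all images of t
   have the weight of t. *)
Definition stab_list (t : C) : list mat :=
  let a := Re t in let N := Re t * Re t + Im t * Im t in
  if Req_EM_T N 1 then
    if Req_EM_T a (1/2) then
      mI :: mneg mI :: mS :: mneg mS :: Mat 1 (-1) 0 1 :: Mat (-1) 1 0 (-1) ::
      Mat 1 (-1) 1 0 :: Mat (-1) 1 (-1) 0 :: Mat 0 (-1) 1 (-1) :: Mat 0 1 (-1) 1 ::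
      Mat (-1) 0 1 (-1) :: Mat 1 0 (-1) 1 :: nil
    else if Req_EM_T a (- (1/2)) then
      mI :: mneg mI :: mS :: mneg mS :: Mat 1 1 0 1 :: Mat (-1) (-1) 0 (-1) ::
      Mat (-1) (-1) 1 0 :: Mat 1 1 (-1) 0 :: Mat 0 (-1) 1 1 :: Mat 0 1 (-1) (-1) ::
      Mat 1 0 1 1 :: Mat (-1) 0 (-1) (-1) :: nil
    else mI :: mneg mI :: mS :: mneg mS :: nil
  else
    if Req_EM_T a (1/2) then mI :: mneg mI :: Mat 1 (-1) 0 1 :: Mat (-1) 1 0 (-1) :: nil
    else if Req_EM_T a (- (1/2)) then mI :: mneg mI :: Mat 1 1 0 1 :: Mat (-1) (-1) 0 (-1) :: nil
    else mI :: mneg mI :: nil.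

Lemma stab_list_NoDup t : NoDup (stab_list t).
Proof.
unfold stab_list, mI, mneg, mS; simpl.
destruct (Req_EM_T (Re t * Re t + Im t * Im t) 1), (Req_EM_T (Re t) (1/2)), (Req_EM_T (Re t) (-(1/2)));
  repeat (constructor; [simpl; intuition discriminate|]); constructor.
Qed.

Lemma stab_list_complete A t : SL2Z A -> 0 < Im t -> w t <> 0 -> w (mob A t) <> 0 -> In A (stab_list t).
Proof.
intros HA Ht H1 H2. assert (E := both_in_D A t HA Ht H1 H2).
destruct (small_entries A t HA Ht H1 H2) as [B1 [B2 B3]].
destruct (mob_unit_den A t HA Ht E) as [_ ER].
apply wD_neq0 in H1. apply wD_neq0 in H2. destruct H2 as [_ H2]. rewrite ER in H2. clear ER.
rewrite Cmod_den_sq in E. unfold stab_list.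
set (N := Re t * Re t + Im t * Im t) in *. set (a := Re t) in *.
destruct A as [p q r s]; unfold SL2Z, mdet in HA; simpl in *.
assert (r = -1 \/ r = 0 \/ r = 1)%Z as [-> | [-> | ->]] by lia;
assert (s = -1 \/ s = 0 \/ s = 1)%Z as [-> | [-> | ->]] by lia;
assert (p = -1 \/ p = 0 \/ p = 1)%Z as [-> | [-> | ->]] by lia; try (exfalso; lia);
(* The determinant fixes q unless r = 0. In that case the matrix acts as translation by q or -q,
   which is bounded because both real parts lie in [-1/2, 1/2]. *)
(assert (Hq : (-2 <= q <= 2)%Z) by (split; first [lia|apply le_IZR; lra]));
assert (q = -2 \/ q = -1 \/ q = 0 \/ q = 1 \/ q = 2)%Z as [-> | [-> | [-> | [-> | ->]]]] by lia;
try (exfalso; lia); try (exfalso; lra);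
unfold mI, mneg, mS; simpl;
destruct (Req_EM_T N 1), (Req_EM_T a (1/2)), (Req_EM_T a (-(1/2))); try (exfalso; lra);
simpl; auto 15.
Qed.

(** Each listed matrix keeps Im t and sends Re t to Re t or -Re t, and [wD] is even in the real
    part. *)
Lemma stab_list_sound A t : 0 < Im t -> w t <> 0 -> In A (stab_list t) -> SL2Z A /\ w (mob A t) = w t.
Proof.
intros Ht H1 I.
assert (HA : SL2Z A).
{ unfold stab_list in I.
  destruct (Req_EM_T (Re t * Re t + Im t * Im t) 1), (Req_EM_T (Re t) (1/2)), (Req_EM_T (Re t) (-(1/2)));
  simpl in I; repeat (destruct I as [<-|I]; [reflexivity|]); destruct I. }
split; [exact HA|].
assert (E : Cmod (den A t) * Cmod (den A t) = 1 /\
  (IZR (ma A) * IZR (mc A) * (Re t * Re t + Im t * Im t)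
     + (IZR (ma A) * IZR (md A) + IZR (mb A) * IZR (mc A)) * Re t + IZR (mb A) * IZR (md A) = Re t \/
   IZR (ma A) * IZR (mc A) * (Re t * Re t + Im t * Im t)
     + (IZR (ma A) * IZR (md A) + IZR (mb A) * IZR (mc A)) * Re t + IZR (mb A) * IZR (md A) = - Re t)).
{ rewrite Cmod_den_sq. unfold stab_list in I.
  set (N := Re t * Re t + Im t * Im t) in *. set (a := Re t) in *.
  destruct (Req_EM_T N 1), (Req_EM_T a (1/2)), (Req_EM_T a (-(1/2)));
  simpl in I; repeat (destruct I as [<-|I]; [simpl; split; [lra|first [left; lra|right; lra]]|]); destruct I. }
destruct E as [E1 E2]. destruct (mob_unit_den A t HA Ht E1) as [EI ER].
unfold w. rewrite EI, ER. destruct E2 as [-> | ->]; [reflexivity|apply wD_opp].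
Qed.

(** The list has 2, 4 or 12 members where the angle is 1, 1/2 or 1/6; both signs of each matrix are
    counted. *)
Lemma stab_list_length t : 0 < Im t -> w t <> 0 -> INR (length (stab_list t)) * w t = 2.
Proof.
intros Ht H1. apply wD_neq0 in H1. unfold stab_list, w, wD.
destruct (Rlt_dec (Re t * Re t + Im t * Im t) 1); [lra|]. destruct (Rlt_dec (1/2) (Re t)); [lra|].
destruct (Rlt_dec (Re t) (-(1/2))); [lra|].
destruct (Req_EM_T (Re t * Re t + Im t * Im t) 1), (Req_EM_T (Re t) (1/2)), (Req_EM_T (Re t) (-(1/2)));
  try lra; simpl; lra.
Qed.

Lemma argmin {A} (f : A -> R) (l : list A) : l <> nil -> exists x, In x l /\ forall y, In y l -> f x <= f y.
Proof.
induction l as [|a l IH]; [congruence|]. intros _.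
destruct l as [|b l].
- exists a. split; [now left|]. intros y [->|[]]. lra.
- destruct IH as [x [Hx Hm]]; [discriminate|]. destruct (Rle_dec (f a) (f x)) as [L|L].
  + exists a. split; [now left|]. intros y [->|Hy]; [lra|]. specialize (Hm y Hy). lra.
  + exists x. split; [now right|]. intros y [->|Hy]; [lra|auto].
Qed.

Definition zrange (n : nat) : list Z := map (fun k => (Z.of_nat k - Z.of_nat n)%Z) (seq 0 (2 * n + 1)).

Lemma in_zrange n z : (- Z.of_nat n <= z <= Z.of_nat n)%Z -> In z (zrange n).
Proof.
intros H. apply in_map_iff. exists (Z.to_nat (z + Z.of_nat n)). split; [lia|]. apply in_seq. lia.
Qed.

(** The quadratic form |ct + d|^2. *)
Definition qform (t : C) (cd : Z * Z) : R :=
  IZR (fst cd) * IZR (fst cd) * (Re t * Re t + Im t * Im t) + 2 * (IZR (fst cd) * IZR (snd cd)) * Re t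
  + IZR (snd cd) * IZR (snd cd).

Lemma qform_sq t c d : qform t (c, d) =
  (IZR c * Re t + IZR d) * (IZR c * Re t + IZR d) + (IZR c * Im t) * (IZR c * Im t).
Proof. unfold qform; simpl. ring. Qed.

(** The value at (0, 1) is 1, and a pair with a smaller value has |c'| Im t < 1 and |d'| at most 1 +
    |c'| |Re t|. So the minimum over a finite box is a global one. *)
Lemma qform_min t : 0 < Im t -> exists c d, (c, d) <> (0, 0)%Z /\
  forall c' d', (c', d') <> (0, 0)%Z -> qform t (c, d) <= qform t (c', d').
Proof.
intros Ht. destruct (INR_unbounded (1 + 1 / Im t + Rabs (Re t) / Im t)) as [n Hn].
assert (P1 : 0 < 1 / Im t) by (apply Rdiv_lt_0_compat; lra).
assert (P2 : 0 <= Rabs (Re t) / Im t) by (apply Rle_div_r; [exact Ht|]; rewrite Rmult_0_l; apply Rabs_pos).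
set (l := filter (fun cd => negb (Z.eqb (fst cd) 0 && Z.eqb (snd cd) 0)) (list_prod (zrange n) (zrange n))).
assert (Hl : forall c d, (- Z.of_nat n <= c <= Z.of_nat n)%Z -> (- Z.of_nat n <= d <= Z.of_nat n)%Z ->
  (c, d) <> (0, 0)%Z -> In (c, d) l).
{ intros c d Hc Hd N. apply filter_In. split; [apply in_prod; now apply in_zrange|]. simpl.
  destruct (Z.eqb_spec c 0), (Z.eqb_spec d 0); simpl; try reflexivity. subst. congruence. }
assert (Hn1 : (1 <= Z.of_nat n)%Z).
{ apply le_IZR. rewrite <- INR_IZR_INZ. lra. }
assert (I01 : In (0, 1)%Z l) by (apply Hl; [lia|lia|discriminate]).
destruct (argmin (qform t) l) as [[c d] [Hcd Hm]].
{ intros E. rewrite E in I01. destruct I01. }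
exists c, d. split.
- apply filter_In in Hcd. destruct Hcd as [_ B]. intros E. injection E as -> ->. discriminate.
- intros c' d' N. apply Rnot_lt_le. intros L. apply (Rlt_irrefl (qform t (c', d'))).
  eapply Rlt_le_trans; [exact L|]. apply Hm. assert (Q := Hm _ I01).
  rewrite (qform_sq t 0 1) in Q. assert (Q1 : qform t (c', d') < 1) by lra. rewrite qform_sq in Q1.
  set (u := IZR c' * Re t + IZR d') in *.
  assert (B1 : -1 < IZR c' * Im t < 1) by (split; nra). assert (B2 : -1 < u < 1) by (split; nra).
  assert (B3 : Rabs (IZR c') < 1 / Im t).
  { apply Rlt_div_r; [exact Ht|]. rewrite <- (Rabs_pos_eq (Im t)) by lra.
    rewrite <- Rabs_mult. apply Rabs_def1; lra. }
  assert (B4 : Rabs (IZR d') <= 1 + Rabs (Re t) / Im t).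
  { replace (IZR d') with (u + - (IZR c' * Re t)) by (unfold u; ring).
    eapply Rle_trans; [apply Rabs_triang|]. rewrite Rabs_Ropp, Rabs_mult.
    assert (Rabs u <= 1) by (apply Rabs_le; lra).
    assert (Rabs (IZR c') * Rabs (Re t) <= 1 / Im t * Rabs (Re t))
      by (apply Rmult_le_compat_r; [apply Rabs_pos|lra]).
    replace (Rabs (Re t) / Im t) with (1 / Im t * Rabs (Re t)) by (field; lra). lra. }
  rewrite INR_IZR_INZ in Hn. rewrite <- abs_IZR in B3, B4.
  assert (Z1 : (Z.abs c' <= Z.of_nat n)%Z) by (apply le_IZR; lra).
  assert (Z2 : (Z.abs d' <= Z.of_nat n)%Z) by (apply le_IZR; lra).
  apply Hl; [lia|lia|exact N].
Qed.

(** Minimal |ct + d| means maximal imaginary part in the orbit. A minimal pair is coprime, since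
    dividing out g > 1 divides the form by g^2. Bezout completes it to a matrix, a translation
    adjusts the real part, and minimality compared with S A gives |A t| at least 1. *)
Lemma reduction t : 0 < Im t -> exists A, SL2Z A /\ w (mob A t) <> 0.
Proof.
intros Ht. destruct (qform_min t Ht) as [c [d [N Hm]]].
assert (Pq : forall c' d', (c', d') <> (0, 0)%Z -> 0 < qform t (c', d')).
{ intros c' d' N'. rewrite qform_sq. destruct (Z.eq_dec c' 0) as [->|Hc].
  - assert (d' <> 0)%Z by congruence. assert (IZR d' <> 0) by now apply eq_IZR_contrapositive.
    assert (0 < IZR d' * IZR d') by now apply Rsqr_pos_lt. nra.
  - assert (IZR c' <> 0) by now apply eq_IZR_contrapositive.
    assert (K : 0 < (IZR c' * Im t) * (IZR c' * Im t)).
    { apply Rsqr_pos_lt. apply Rmult_integral_contrapositive. split; [assumption|lra]. }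
    pose proof (Rle_0_sqr (IZR c' * Re t + IZR d')) as S. unfold Rsqr in S. lra. }
assert (G : Z.gcd c d = 1%Z).
{ set (g := Z.gcd c d). assert (Hg0 : (0 <= g)%Z) by apply Z.gcd_nonneg.
  assert (Hg : g <> 0%Z).
  { intros E. apply N. f_equal; [now apply Z.gcd_eq_0_l in E|now apply Z.gcd_eq_0_r in E]. }
  destruct (Z.gcd_divide_l c d) as [c1 Hc1]. destruct (Z.gcd_divide_r c d) as [d1 Hd1]. fold g in Hc1, Hd1.
  destruct (Z.eq_dec g 1) as [E|E]; [exact E|exfalso].
  assert (N1 : (c1, d1) <> (0, 0)%Z).
  { intros Q. injection Q as -> ->. apply N. rewrite Hc1, Hd1. reflexivity. }
  specialize (Hm c1 d1 N1). specialize (Pq c1 d1 N1).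
  assert (EQ : qform t (c, d) = IZR g * IZR g * qform t (c1, d1)).
  { rewrite Hc1, Hd1. unfold qform; simpl. rewrite !mult_IZR. ring. }
  rewrite EQ in Hm. assert (Hg2 : 2 <= IZR g) by (apply IZR_le; lia).
  assert (Hg4 : 4 <= IZR g * IZR g) by nra. nra. }
destruct (Z.gcd_bezout c d 1 G) as [u [v Huv]].
set (A0 := Mat v (- u) c d).
assert (H0 : SL2Z A0) by (unfold SL2Z, mdet, A0; simpl; lia).
(* With x this real part, x - 1/2 < k and k is at most x + 1/2, so x - k lies in [-1/2, 1/2). *)
set (k := up (Re (mob A0 t) - 1/2)).
destruct (archimed (Re (mob A0 t) - 1/2)) as [K1 K2]. fold k in K1, K2.
set (A := mmul (Mat 1 (- k) 0 1) A0).
assert (HT : SL2Z (Mat 1 (- k) 0 1)) by (unfold SL2Z, mdet; cbn [ma mb mc md]; ring).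
assert (HA : SL2Z A) by now apply SL2Z_mmul.
exists A. split; [exact HA|].
assert (Im0 := Im_mob_pos A0 t H0 Ht).
assert (EA : mob A t = (mob A0 t - RtoC (IZR k))%C).
{ unfold A. rewrite mob_mmul by assumption. set (z := mob A0 t). unfold mob, ZtoC; simpl.
  rewrite opp_IZR, RtoC_opp. field. }
apply wD_neq0. split.
- apply Rnot_lt_le. intros L.
  assert (HS : SL2Z (mmul mS A)) by (apply SL2Z_mmul; [reflexivity|exact HA]).
  assert (Q : qform t (c, d) <= qform t (mc (mmul mS A), md (mmul mS A))).
  { apply Hm. intros E. assert (E1 := f_equal fst E). assert (E2 := f_equal snd E). cbn [fst snd] in E1, E2.
    apply SL2Z_eq in HS. rewrite E1, E2 in HS. lia. }
  assert (F1 : forall B, qform t (mc B, md B) = Cmod (den B t) * Cmod (den B t)).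
  { intros B. rewrite Cmod_den_sq. reflexivity. }
  assert (F2 : den (mmul mS A) t = (mob A t * den A t)%C).
  { rewrite den_mmul by assumption. f_equal. unfold den, mS, ZtoC; simpl. ring. }
  assert (F3 : qform t (c, d) = Cmod (den A t) * Cmod (den A t)).
  { rewrite <- F1. f_equal. unfold A, mmul, A0; cbn -[Z.mul Z.add]. f_equal; ring. }
  rewrite F1, F2, Cmod_mult in Q. rewrite F3 in Q.
  assert (0 < Cmod (den A t)) by now apply Cmod_gt_0, den_neq0.
  pose proof (Cmod_sq (mob A t)) as M. rewrite <- M in L.
  replace (Cmod (mob A t) * Cmod (den A t) * (Cmod (mob A t) * Cmod (den A t)))
    with ((Cmod (mob A t) * Cmod (mob A t)) * (Cmod (den A t) * Cmod (den A t))) in Q by ring.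
  assert (0 < Cmod (den A t) * Cmod (den A t)) by nra. nra.
- rewrite EA. replace (Re (mob A0 t - RtoC (IZR k))%C) with (Re (mob A0 t) - IZR k) by reflexivity. lra.
Qed.

Lemma mmul_cancel_r A B D : SL2Z D -> mmul A D = mmul B D -> A = B.
Proof.
intros HD E. rewrite <- (mmul_1_r A), <- (mmul_1_r B), <- (mmul_inv_r D HD), !mmul_assoc. now rewrite E.
Qed.

Lemma sumL_map {A B} (l : list A) (g : A -> B) f : sumL (map g l) f = sumL l (fun x => f (g x)).
Proof. induction l as [|a l IH]; simpl; [reflexivity|]. now rewrite IH. Qed.

Lemma sumL_const {A} (l : list A) k : sumL l (fun _ => k) = INR (length l) * k.
Proof.
induction l as [|a l IH]; [simpl; ring|]. simpl length. rewrite S_INR. simpl. rewrite IH. ring.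
Qed.

(** From one image z = B t in the domain all others are reached by [stab_list] z with the same
    weight, so the sum is the length of that list times w z. *)
Lemma orbit_weights t : 0 < Im t -> exists L : list mat, NoDup L /\
  (forall A, In A L -> SL2Z A /\ w (mob A t) <> 0) /\
  (forall A, SL2Z A -> w (mob A t) <> 0 -> In A L) /\
  sumL L (fun A => w (mob A t)) = 2.
Proof.
intros Ht. destruct (reduction t Ht) as [B [HB HW]]. set (z := mob B t) in *.
assert (Hz : 0 < Im z) by now apply Im_mob_pos.
exists (map (fun A => mmul A B) (stab_list z)). split; [|split; [|split]].
- apply Injective_map_NoDup; [|apply stab_list_NoDup].
  intros A A' E. now apply (mmul_cancel_r A A' B).
- intros A HA. apply in_map_iff in HA. destruct HA as [A' [<- I]].
  destruct (stab_list_sound A' z Hz HW I) as [S1 S2]. split; [now apply SL2Z_mmul|].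
  rewrite mob_mmul by assumption. fold z. now rewrite S2.
- intros A HA H. apply in_map_iff. exists (mmul A (minv B)). split.
  + now rewrite <- mmul_assoc, mmul_inv_l, mmul_1_r.
  + assert (S1 : SL2Z (mmul A (minv B))) by (apply SL2Z_mmul; [exact HA|now apply SL2Z_minv]).
    apply stab_list_complete; auto. unfold z. rewrite <- mob_mmul by assumption.
    now rewrite <- mmul_assoc, mmul_inv_l, mmul_1_r.
- rewrite sumL_map, (sumL_ext _ _ (fun _ => w z)).
  + rewrite sumL_const. now apply stab_list_length.
  + intros A I. destruct (stab_list_sound A z Hz HW I) as [S1 S2].
    rewrite mob_mmul by assumption. exact S2.
Qed.

(** * Expansions at infinity *)

Notation Cseries := (is_series (K:=C_AbsRing) (V:=C_NormedModule)).

Fixpoint psum (a : nat -> C) (n : nat) : C :=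
  match n with O => a O | S n => (psum a n + a (S n))%C end.

Lemma psum_sum_n a n : sum_n (G:=C_NormedModule) a n = psum a n.
Proof.
induction n as [|n IH]; [exact (sum_O (G:=C_NormedModule) a)|].
rewrite (sum_Sn (G:=C_NormedModule)), IH. reflexivity.
Qed.

Lemma Cseries_eps a S : Cseries a S ->
  forall e, 0 < e -> exists N, forall n, (N <= n)%nat -> Cmod (psum a n - S) < e.
Proof.
intros H e He.
destruct (proj1 (filterlim_locally_ball_norm (K:=C_AbsRing) (U:=C_NormedModule) _ S) H (mkposreal e He)) as [N HN].
exists N. intros n Hn. specialize (HN n Hn). rewrite psum_sum_n in HN. exact HN.
Qed.

Lemma finite_bound (f : nat -> R) N : exists B, forall n, (n <= N)%nat -> f n <= B.
Proof.
induction N as [|N [B HB]].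
- exists (f O). intros n Hn. replace n with O by lia. lra.
- exists (Rmax B (f (S N))). intros n Hn. destruct (Nat.eq_dec n (S N)) as [->|E]; [apply Rmax_r|].
  eapply Rle_trans; [apply HB; lia|apply Rmax_l].
Qed.

Lemma Cseries_terms_bounded a S : Cseries a S -> exists B, forall n, Cmod (a n) <= B.
Proof.
intros H. destruct (Cseries_eps a S H 1 Rlt_0_1) as [N HN].
destruct (finite_bound (fun n => Cmod (a n)) N) as [B HB].
exists (Rmax B 2). intros n. destruct (le_lt_dec n N) as [L|L].
- eapply Rle_trans; [now apply HB|apply Rmax_l].
- eapply Rle_trans; [|apply Rmax_r]. destruct n as [|n]; [lia|].
  replace (a (Datatypes.S n)) with ((psum a (Datatypes.S n) - S) + (S - psum a n))%C by (simpl; ring).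
  eapply Rle_trans; [apply Cmod_triangle|]. rewrite (Cmod_minus_sym S).
  pose proof (HN n ltac:(lia)). pose proof (HN (Datatypes.S n) ltac:(lia)). lra.
Qed.

(** Termwise errors k/2^n add up to at most 2k. In the application b has at most one nonzero
    term. *)
Lemma Cseries_close a S b v k N0 : Cseries a S ->
  (forall n, (N0 <= n)%nat -> psum b n = v) ->
  (forall n, Cmod (a n - b n) <= k * (1/2) ^ n) -> Cmod (S - v) <= 2 * k.
Proof.
intros H Hb Hk.
assert (P : forall n, Cmod (psum a n - psum b n) <= k * (2 - (1/2) ^ n)).
{ induction n as [|n IH].
  - simpl. specialize (Hk O). simpl in Hk. lra.
  - simpl psum. replace (psum a n + a (Datatypes.S n) - (psum b n + b (Datatypes.S n)))%C
      with ((psum a n - psum b n) + (a (Datatypes.S n) - b (Datatypes.S n)))%C by ring.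
    eapply Rle_trans; [apply Cmod_triangle|]. specialize (Hk (Datatypes.S n)). simpl pow in *. lra. }
assert (K0 : 0 <= k).
{ specialize (Hk O). simpl in Hk. pose proof (Cmod_ge_0 (a O - b O)). lra. }
apply Rle_plus_epsilon. intros e He. destruct (Cseries_eps a S H e He) as [N HN].
set (n := Nat.max N N0). specialize (HN n ltac:(lia)). specialize (P n).
rewrite Hb in P by lia.
replace (S - v)%C with ((S - psum a n) + (psum a n - v))%C by ring.
eapply Rle_trans; [apply Cmod_triangle|]. rewrite (Cmod_minus_sym S).
assert (0 < (1/2) ^ n) by (apply pow_lt; lra). nra.
Qed.

Lemma psum_delta (j : nat) (v : C) n : (j <= n)%nat -> psum (fun k => if Nat.eq_dec k j then v else (RtoC 0)) n = v.
Proof.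
assert (Z : forall n, (n < j)%nat -> psum (fun k => if Nat.eq_dec k j then v else (RtoC 0)) n = (RtoC 0)).
{ induction n0 as [|m IH]; intros Hm; cbn [psum].
  - destruct (Nat.eq_dec 0 j); [lia|reflexivity].
  - rewrite IH by lia. destruct (Nat.eq_dec (S m) j); [lia|ring]. }
induction n as [|n IH]; intros Hn; cbn [psum].
- destruct (Nat.eq_dec 0 j); [reflexivity|lia].
- destruct (Nat.eq_dec (S n) j) as [E|E].
  + rewrite Z by lia. ring.
  + rewrite IH by lia. ring.
Qed.

Lemma psum_0 n : psum (fun _ => (RtoC 0)) n = (RtoC 0).
Proof. induction n as [|n IH]; simpl; [reflexivity|]. rewrite IH. ring. Qed.

Lemma Z_min (P : Z -> Prop) B : (forall j, P j -> (B <= j)%Z) -> (exists j, P j) ->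
  exists j0, P j0 /\ forall j, P j -> (j0 <= j)%Z.
Proof.
intros HB [j Hj]. remember (Z.to_nat (j - B)) as n eqn:En. revert j Hj En.
induction n as [n IH] using (well_founded_induction lt_wf). intros j Hj En.
destruct (classic (exists j', P j' /\ (j' < j)%Z)) as [[j' [H1 H2]]|N].
- apply (IH (Z.to_nat (j' - B))) with j'; auto. pose proof (HB _ H1). lia.
- exists j. split; [exact Hj|]. intros j' H'. apply Z.nlt_ge. intros L. apply N. now exists j'.
Qed.

Lemma exp_INR m a : exp (INR m * a) = exp a ^ m.
Proof.
induction m as [|m IH]; [simpl; rewrite Rmult_0_l; apply exp_0|].
rewrite S_INR. replace ((INR m + 1) * a) with (a + INR m * a) by ring. rewrite exp_plus, IH. reflexivity.
Qed.

Lemma Cmod_eC (k : R) t : Cmod (eC (RtoC k * t)) = exp (- (2 * PI * k * Im t)).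
Proof.
unfold eC. rewrite Cmod_cexp. f_equal. destruct t; unfold Re, Im; simpl. ring.
Qed.

Lemma eC_mult_opp (k : R) t : (eC (RtoC k * t) * eC (RtoC (- k) * t))%C = 1%C.
Proof.
unfold eC. rewrite <- cexp_add, RtoC_opp. rewrite <- cexp_0. f_equal. ring.
Qed.

Lemma half_pow_le (x : R) m : 0 <= x <= 1/2 -> (1 <= m)%nat -> x ^ m <= x * (1/2) ^ (m - 1).
Proof.
intros Hx Hm. destruct m as [|m]; [lia|]. simpl. rewrite Nat.sub_0_r.
apply Rmult_le_compat_l; [lra|]. apply pow_incr. lra.
Qed.

(** Convergence at one height y1 bounds |c j| by B exp(2 pi (kappa + j/h) y1). At height y the terms
    after the leading one are then bounded by powers of x = exp(-2 pi (y - y1)/h), which tends to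
    0. *)
Lemma qexp_asympt g kappa h c : qexp g kappa h c -> (exists j, c j <> (RtoC 0)) ->
  exists j0, c j0 <> (RtoC 0) /\ (forall j, c j <> (RtoC 0) -> (j0 <= j)%Z) /\
    asympt g (kappa + IZR j0 / INR h) (c j0).
Proof.
intros [Hh [[L HL] [Y HY]]] Hne.
assert (Hh0 : 0 < INR h) by now apply lt_0_INR.
(* Only finitely many negative exponents have a nonzero coefficient, so a leading term exists. *)
assert (HB : exists B, forall j, c j <> (RtoC 0) -> (B <= j)%Z).
{ set (B0 := (- up (kappa * INR h))%Z).
  assert (HLB : exists B1, forall j, In j L -> (B1 <= j)%Z).
  { clear. induction L as [|a L [B1 IH]]; [exists 0%Z; intros j []|].
    exists (Z.min a B1). intros j [->|I]; [lia|]. specialize (IH j I). lia. }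
  destruct HLB as [B1 HB1]. exists (Z.min B0 B1). intros j Hj.
  destruct (Rlt_dec (kappa + IZR j / INR h) 0) as [S|S].
  - pose proof (HB1 j (HL j S Hj)). lia.
  - assert (Q : - (kappa * INR h) <= IZR j).
    { apply Rnot_lt_le in S. apply Rmult_le_compat_r with (r := INR h) in S; [|lra].
      replace ((kappa + IZR j / INR h) * INR h) with (kappa * INR h + IZR j) in S by (field; lra). lra. }
    destruct (archimed (kappa * INR h)) as [A1 _].
    assert (IZR B0 < IZR j) by (unfold B0; rewrite opp_IZR; lra). apply lt_IZR in H. lia. }
destruct HB as [B0 HB0]. destruct (Z_min _ B0 HB0 Hne) as [j0 [Hj0 Hmin]].
exists j0. split; [exact Hj0|]. split; [exact Hmin|].
set (r := kappa + IZR j0 / INR h).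
set (y1 := Y + 1).
assert (Mq : forall t j, Cmod (qterm kappa h c t j) = Cmod (c j) * exp (- (2 * PI * (kappa + IZR j / INR h) * Im t))).
{ intros t j. unfold qterm. now rewrite Cmod_mult, Cmod_eC. }
assert (Hbd : exists B, 0 < B /\ forall j, Cmod (c j) <= B * exp (2 * PI * (kappa + IZR j / INR h) * y1)).
{ destruct (HY (0, y1)) as [S1 [S2 [H1 [H2 _]]]]; [unfold y1, Im; simpl; lra|].
  destruct (Cseries_terms_bounded _ _ H1) as [B1 Hb1]. destruct (Cseries_terms_bounded _ _ H2) as [B2 Hb2].
  exists (1 + Rmax 0 (Rmax B1 B2)). pose proof (Rmax_l 0 (Rmax B1 B2)). pose proof (Rmax_r 0 (Rmax B1 B2)).
  pose proof (Rmax_l B1 B2). pose proof (Rmax_r B1 B2). split; [lra|]. intros j.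
  assert (K : Cmod (qterm kappa h c (0, y1) j) <= Rmax B1 B2).
  { destruct (Z_le_gt_dec 0 j) as [P|P].
    - specialize (Hb1 (Z.to_nat j)). rewrite Z2Nat.id in Hb1 by exact P. lra.
    - specialize (Hb2 (Z.to_nat (- j - 1))).
      replace (- Z.of_nat (S (Z.to_nat (- j - 1))))%Z with j in Hb2 by lia. lra. }
  rewrite Mq in K. unfold Im in K; simpl in K. rewrite exp_Ropp in K.
  assert (E := exp_pos (2 * PI * (kappa + IZR j / INR h) * y1)).
  apply Rle_div_l in K; [|exact E].
  eapply Rle_trans; [exact K|]. apply Rmult_le_compat_r; lra. }
destruct Hbd as [B [HBp HB]].
(* The series are indexed from 0 while the powers of x count from j0; M absorbs this shift and the
   factor x that is split off. *)
set (M := 2 ^ (Z.to_nat (Z.abs j0) + 1)).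
assert (HM : 0 < M) by (apply pow_lt; lra).
set (B' := B * exp (2 * PI * r * y1)).
assert (HB' : 0 < B') by (apply Rmult_lt_0_compat; [exact HBp|apply exp_pos]).
intros e He. set (e' := e / (4 * (B' * M) + 1)).
assert (HBM : 0 < B' * M) by now apply Rmult_lt_0_compat.
assert (He' : 0 < e') by (apply Rdiv_lt_0_compat; lra).
(* Since 2 pi > 1, above this height x is below both e' and 1/2. *)
exists (y1 + INR h * (Rabs (ln e') + 1)). intros t Ht. set (y := Im t) in *.
assert (Hla : 0 <= Rabs (ln e')) by apply Rabs_pos.
assert (Hyy : y1 < y) by nra.
assert (HtY : Y < Im t) by (fold y; unfold y1 in Hyy; lra).
destruct (HY t HtY) as [S1 [S2 [H1 [H2 Eg]]]].
set (x := exp (- (2 * PI / INR h * (y - y1)))).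
assert (Hx0 : 0 < x) by apply exp_pos.
assert (Hxe : x < Rmin e' (1/2)).
{ assert (Q : Rabs (ln e') + 1 < 2 * PI / INR h * (y - y1)).
  { assert (Q1 : Rabs (ln e') + 1 < (y - y1) / INR h) by (apply Rlt_div_r; nra).
    replace (2 * PI / INR h * (y - y1)) with (2 * PI * ((y - y1) / INR h)) by (field; lra).
    pose proof PI2_1. assert (0 < (y - y1) / INR h) by lra. nra. }
  assert (Q2 : x < exp (- Rabs (ln e') + - 1)) by (apply exp_increasing; lra).
  apply Rlt_le_trans with (1 := Q2). apply Rmin_glb.
  - apply Rle_trans with (exp (ln e')); [|rewrite exp_ln; lra]. left. apply exp_increasing.
    pose proof (Rle_abs (- ln e')) as A. rewrite Rabs_Ropp in A. lra.
  - apply Rle_trans with (exp (Ropp 1)).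
    + destruct Hla as [Hla|Hla]; [left; apply exp_increasing; lra|]. rewrite <- Hla. right. f_equal. ring.
    + rewrite exp_Ropp. replace (1/2) with (/ 2) by lra. apply Rinv_le_contravar; [lra|].
      pose proof (exp_ineq1_le 1). lra. }
assert (Hxe1 : x < e') by (eapply Rlt_le_trans; [exact Hxe|apply Rmin_l]).
assert (Hxe2 : x < 1/2) by (eapply Rlt_le_trans; [exact Hxe|apply Rmin_r]).
set (E := B * exp (- (2 * PI * r * (y - y1)))).
assert (HE : 0 < E) by (apply Rmult_lt_0_compat; [exact HBp|apply exp_pos]).
assert (Tb : forall j, (j0 < j)%Z -> Cmod (qterm kappa h c t j) <= E * x ^ (Z.to_nat (j - j0))).
{ intros j Hj. rewrite Mq. fold y.
  apply Rle_trans with (B * exp (2 * PI * (kappa + IZR j / INR h) * y1) * exp (- (2 * PI * (kappa + IZR j / INR h) * y))).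
  { apply Rmult_le_compat_r; [left; apply exp_pos|apply HB]. }
  right. unfold E, x. rewrite <- exp_INR, !Rmult_assoc, <- !exp_plus. f_equal. f_equal.
  rewrite (INR_IZR_INZ (Z.to_nat (j - j0))), Z2Nat.id by lia. rewrite minus_IZR. unfold r. field. lra. }
set (k := E * (x * M)).
assert (Hk : 0 < k) by exact (Rmult_lt_0_compat _ _ HE (Rmult_lt_0_compat _ _ Hx0 HM)).
assert (Hhalf : forall n, 0 < (1/2) ^ n) by (intros; apply pow_lt; lra).
assert (Hpp : forall n, 2 ^ n * (1/2) ^ n = 1) by (intros n; rewrite <- Rpow_mult_distr; replace (2 * (1/2)) with 1 by lra; apply pow1).
(* The leading term sits in one of the two series, according to the sign of j0; the other series is
   compared with 0. *)
assert (C1 : exists v1, Cmod (S1 - v1) <= 2 * k /\ v1 = if Z_le_gt_dec 0 j0 then qterm kappa h c t j0 else (RtoC 0)).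
{ eexists. split; [|reflexivity].
  set (v := qterm kappa h c t j0).
  apply (Cseries_close _ S1 (fun n => if Z_le_gt_dec 0 j0 then (if Nat.eq_dec n (Z.to_nat j0) then v else (RtoC 0)) else (RtoC 0))
     _ k (Z.to_nat j0) H1).
  - intros n Hn. destruct (Z_le_gt_dec 0 j0); [now apply psum_delta|apply psum_0].
  - intros n. destruct (Z.lt_trichotomy (Z.of_nat n) j0) as [T|[T|T]].
    + replace (qterm kappa h c t (Z.of_nat n)) with (RtoC 0).
      * destruct (Z_le_gt_dec 0 j0); [destruct (Nat.eq_dec n (Z.to_nat j0)); [lia|]|];
        rewrite Cminus_diag, Cmod_0; pose proof (Hhalf n); nra.
      * unfold qterm. replace (c (Z.of_nat n)) with (RtoC 0); [ring|].
        destruct (Ceq_dec (c (Z.of_nat n)) 0) as [->|Q]; [reflexivity|]. apply Hmin in Q. lia.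
    + destruct (Z_le_gt_dec 0 j0); [|lia]. destruct (Nat.eq_dec n (Z.to_nat j0)); [|lia].
      unfold v. rewrite T, Cminus_diag, Cmod_0. pose proof (Hhalf n). nra.
    + replace (if Z_le_gt_dec 0 j0 then if Nat.eq_dec n (Z.to_nat j0) then v else (RtoC 0) else (RtoC 0)) with (RtoC 0)
        by (destruct (Z_le_gt_dec 0 j0); [destruct (Nat.eq_dec n (Z.to_nat j0)); [lia|reflexivity]|reflexivity]).
      replace (qterm kappa h c t (Z.of_nat n) - 0)%C with (qterm kappa h c t (Z.of_nat n)) by ring.
      eapply Rle_trans; [now apply Tb|]. unfold k. rewrite !Rmult_assoc. apply Rmult_le_compat_l; [lra|].
      eapply Rle_trans; [apply half_pow_le; [lra|lia]|]. apply Rmult_le_compat_l; [lra|].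
      unfold M. set (m := (Z.to_nat (Z.of_nat n - j0) - 1)%nat). set (q := (Z.to_nat (Z.abs j0) + 1)%nat).
      assert (Hmq : (n <= m + q)%nat) by (unfold m, q; lia).
      apply Rle_trans with ((1/2) ^ m * (2 ^ q * (1/2) ^ q)); [rewrite Hpp; lra|].
      replace ((1/2) ^ m * (2 ^ q * (1/2) ^ q)) with (2 ^ q * (1/2) ^ (m + q)) by (rewrite pow_add; ring).
      apply Rmult_le_compat_l; [apply pow_le; lra|].
      replace (m + q)%nat with (n + (m + q - n))%nat by lia. rewrite pow_add.
      rewrite <- (Rmult_1_r ((1/2) ^ n)) at 2. apply Rmult_le_compat_l; [left; apply Hhalf|].
      apply Rle_trans with (1 ^ (m + q - n)); [apply pow_incr; lra|rewrite pow1; lra]. }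
assert (C2 : exists v2, Cmod (S2 - v2) <= 2 * k /\ v2 = if Z_le_gt_dec 0 j0 then (RtoC 0) else qterm kappa h c t j0).
{ eexists. split; [|reflexivity].
  set (v := qterm kappa h c t j0). set (q := Z.to_nat (- j0 - 1)).
  apply (Cseries_close _ S2 (fun n => if Z_le_gt_dec 0 j0 then (RtoC 0) else (if Nat.eq_dec n q then v else (RtoC 0)))
     _ k q H2).
  - intros n Hn. destruct (Z_le_gt_dec 0 j0); [apply psum_0|now apply psum_delta].
  - intros n. set (j := (- Z.of_nat (S n))%Z). destruct (Z.lt_trichotomy j j0) as [T|[T|T]].
    + replace (qterm kappa h c t j) with (RtoC 0).
      * destruct (Z_le_gt_dec 0 j0); [|destruct (Nat.eq_dec n q); [lia|]];
        rewrite Cminus_diag, Cmod_0; pose proof (Hhalf n); nra.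
      * unfold qterm. replace (c j) with (RtoC 0); [ring|].
        destruct (Ceq_dec (c j) 0) as [->|Q]; [reflexivity|]. apply Hmin in Q. lia.
    + destruct (Z_le_gt_dec 0 j0); [lia|]. destruct (Nat.eq_dec n q); [|lia].
      unfold v. rewrite T, Cminus_diag, Cmod_0. pose proof (Hhalf n). nra.
    + replace (if Z_le_gt_dec 0 j0 then (RtoC 0) else if Nat.eq_dec n q then v else (RtoC 0)) with (RtoC 0)
        by (destruct (Z_le_gt_dec 0 j0); [reflexivity|destruct (Nat.eq_dec n q); [lia|reflexivity]]).
      replace (qterm kappa h c t j - 0)%C with (qterm kappa h c t j) by ring.
      eapply Rle_trans; [now apply Tb|]. unfold k. rewrite !Rmult_assoc. apply Rmult_le_compat_l; [lra|].
      eapply Rle_trans; [apply half_pow_le; [lra|lia]|]. apply Rmult_le_compat_l; [lra|].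
      apply Rle_trans with 1.
      { apply Rle_trans with (1 ^ (Z.to_nat (j - j0) - 1)); [apply pow_incr; lra|rewrite pow1; lra]. }
      unfold M. apply Rle_trans with (2 ^ n * (1/2) ^ n); [rewrite Hpp; lra|]. apply Rmult_le_compat_r; [left; apply Hhalf|].
      apply Rle_pow; [lra|]. lia. }
destruct C1 as [v1 [C1 D1]]. destruct C2 as [v2 [C2 D2]].
assert (EV : (v1 + v2)%C = qterm kappa h c t j0) by (rewrite D1, D2; destruct (Z_le_gt_dec 0 j0); ring).
assert (Bd : Cmod (g t - qterm kappa h c t j0) <= 4 * k).
{ rewrite Eg, <- EV. replace (S1 + S2 - (v1 + v2))%C with ((S1 - v1) + (S2 - v2))%C by ring.
  eapply Rle_trans; [apply Cmod_triangle|]. lra. }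
assert (Er : qterm kappa h c t j0 = (c j0 * eC (RtoC r * t))%C) by reflexivity.
replace (g t * eC (RtoC (- r) * t) - c j0)%C with ((g t - qterm kappa h c t j0) * eC (RtoC (- r) * t))%C.
2:{ rewrite Er. transitivity (g t * eC (RtoC (- r) * t) - c j0 * (eC (RtoC r * t) * eC (RtoC (- r) * t)))%C; [ring|].
    rewrite eC_mult_opp. ring. }
rewrite Cmod_mult, Cmod_eC. fold y.
apply Rle_lt_trans with (4 * k * exp (- (2 * PI * - r * y))).
{ apply Rmult_le_compat_r; [left; apply exp_pos|exact Bd]. }
replace (4 * k * exp (- (2 * PI * - r * y))) with (4 * (B' * M) * x).
2:{ unfold k, E, B'.
    replace (2 * PI * r * y1) with (- (2 * PI * r * (y - y1)) + - (2 * PI * - r * y)) by ring.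
    rewrite exp_plus. ring. }
apply Rlt_trans with ((4 * (B' * M) + 1) * x); [lra|].
replace e with ((4 * (B' * M) + 1) * e') by (unfold e'; field; lra).
apply Rmult_lt_compat_l; lra.
Qed.

(** The moduli behave like exp(-2 pi r y) and exp(-2 pi r' y) times constants, so equality at
    arbitrarily high points of equal height compares exponents. Orders at infinity thus become
    comparable without uniqueness of expansions. *)
Lemma asympt_le F F' r r' (c c' : C) : asympt F r c -> asympt F' r' c' -> c <> 0 ->
  (forall Y, exists z z', Im z = Im z' /\ Y < Im z /\ Cmod (F z) = Cmod (F' z')) -> r' <= r.
Proof.
intros HF HF' Hc H. apply Rnot_lt_le. intros L.
assert (Mc : 0 < Cmod c) by now apply Cmod_gt_0.
destruct (HF (Cmod c / 2)) as [Y1 H1]; [lra|]. destruct (HF' 1 Rlt_0_1) as [Y2 H2].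
set (K := (Cmod c' + 1) / (Cmod c / 2)).
set (Y := Rmax (Rmax Y1 Y2) (K / (2 * PI * (r' - r)))).
destruct (H Y) as [z [z' [E1 [E2 E3]]]].
assert (B1 : Y1 < Im z) by (eapply Rle_lt_trans; [|exact E2]; unfold Y; eapply Rle_trans; [apply Rmax_l|apply Rmax_l]).
assert (B2 : Y2 < Im z') by (rewrite <- E1; eapply Rle_lt_trans; [|exact E2]; unfold Y; eapply Rle_trans; [apply Rmax_r|apply Rmax_l]).
assert (B3 : K / (2 * PI * (r' - r)) < Im z) by (eapply Rle_lt_trans; [|exact E2]; apply Rmax_r).
specialize (H1 z B1). specialize (H2 z' B2).
assert (A1 := Rabs_Cmod_sub (F z * eC (RtoC (- r) * z)) c). apply Rabs_le_between in A1.
assert (A2 := Rabs_Cmod_sub (F' z' * eC (RtoC (- r') * z')) c'). apply Rabs_le_between in A2.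
rewrite Cmod_mult, Cmod_eC in A1, A2. rewrite <- E3, <- E1 in A2.
set (y := Im z) in *. set (f := Cmod (F z)) in *.
pose proof PI_RGT_0 as Pi.
assert (Q1 : Cmod c / 2 < f * exp (- (2 * PI * - r * y))) by lra.
assert (Q2 : f * exp (- (2 * PI * - r' * y)) < Cmod c' + 1) by lra.
replace (- (2 * PI * - r' * y)) with (- (2 * PI * - r * y) + 2 * PI * (r' - r) * y) in Q2 by ring.
rewrite exp_plus, <- Rmult_assoc in Q2.
assert (P : 0 < 2 * PI * (r' - r)) by (apply Rmult_lt_0_compat; lra).
assert (Q3 : K < 2 * PI * (r' - r) * y) by (apply Rlt_div_l in B3; lra).
pose proof (exp_ineq1_le (2 * PI * (r' - r) * y)) as Q4.
set (X := exp (2 * PI * (r' - r) * y)) in *.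
assert (Q5 : K * (Cmod c / 2) = Cmod c' + 1) by (unfold K; field; lra).
pose proof (Cmod_ge_0 c').
assert (0 < K) by (unfold K; apply Rdiv_lt_0_compat; lra). nra.
Qed.

Lemma asympt_unique F F' r r' (c c' : C) : asympt F r c -> asympt F' r' c' -> c <> 0 -> c' <> 0 ->
  (forall Y, exists z z', Im z = Im z' /\ Y < Im z /\ Cmod (F z) = Cmod (F' z')) -> r = r'.
Proof.
intros H1 H2 H3 H4 H. apply Rle_antisym.
- apply (asympt_le F' F r' r c' c); auto. intros Y. destruct (H Y) as [z [z' [A [B D]]]].
  exists z', z. rewrite <- A. auto.
- now apply (asympt_le F F' r r' c c').
Qed.

Lemma ord_infty_asympt g r : ord_infty g r -> exists c : C, c <> 0 /\ asympt g r c.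
Proof.
intros [kappa [h [c [Hq [[j [Hj Er]] Hm]]]]].
destruct (qexp_asympt g kappa h c Hq (ex_intro _ j Hj)) as [j0 [H0 [Hmin HA]]].
exists (c j0). split; [exact H0|].
replace r with (kappa + IZR j0 / INR h); [exact HA|].
assert (Hh0 : 0 < INR h) by (apply lt_0_INR; apply Hq).
apply Rle_antisym; [|now apply Hm]. rewrite Er. apply Rplus_le_compat_l.
apply Rmult_le_compat_r; [left; now apply Rinv_0_lt_compat|]. apply IZR_le. now apply Hmin.
Qed.

(** If all coefficients vanished, g would be zero high up and could have no order there. *)
Lemma ord_infty_exists g : has_qexp g -> (forall t, 0 < Im t -> exists n, is_ord g t n) ->
  exists r, ord_infty g r.
Proof.
intros [kappa [h [c Hq]]] Ho.
assert (Hh0 : 0 < INR h) by (apply lt_0_INR; apply Hq).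
destruct (classic (exists j, c j <> (RtoC 0))) as [Hne|Hz].
- destruct (qexp_asympt g kappa h c Hq Hne) as [j0 [H0 [Hmin _]]].
  exists (kappa + IZR j0 / INR h), kappa, h, c. split; [exact Hq|]. split; [now exists j0|].
  intros j Hj. apply Rplus_le_compat_l. apply Rmult_le_compat_r; [left; now apply Rinv_0_lt_compat|].
  apply IZR_le. now apply Hmin.
- exfalso. destruct Hq as [_ [_ [Y HY]]].
  assert (Z : forall j, c j = (RtoC 0)).
  { intros j. destruct (Ceq_dec (c j) 0) as [E|E]; [exact E|]. exfalso. apply Hz. now exists j. }
  assert (Zs : forall a S, Cseries a S -> (forall n, a n = (RtoC 0)) -> S = (RtoC 0)).
  { intros a S HS Ha. assert (Q := Cseries_close a S (fun _ => (RtoC 0)) (RtoC 0) 0 O HS (fun n _ => psum_0 n)).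
    assert (Q' : Cmod (S - 0) <= 2 * 0).
    { apply Q. intros n. rewrite Ha, Cminus_diag, Cmod_0. lra. }
    pose proof (Cmod_ge_0 (S - 0)). assert (E : Cmod (S - 0) = 0) by lra. apply Cmod_eq_0 in E.
    replace S with (S - 0)%C by ring. exact E. }
  set (y := 1 + Rmax 0 Y). pose proof (Rmax_l 0 Y). pose proof (Rmax_r 0 Y).
  destruct (Ho (0, y)) as [n Hn]; [unfold y, Im; simpl; lra|].
  destruct (pnear_ex _ _ (pnear_and _ _ _ (is_ord_neq0 _ _ _ Hn) (near_pnear _ _
    (near_rcont_pos (fun w => Im w + - Y) (0, y) (rcont_plus _ _ _ (rcont_snd _) (rcont_const (- Y) _))
      ltac:(unfold y, Im; simpl; lra))))) as [v [_ [V1 V2]]].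
  apply V1. destruct (HY v ltac:(lra)) as [S1 [S2 [H1 [H2 ->]]]].
  rewrite (Zs _ _ H1), (Zs _ _ H2); [ring| |]; intros; unfold qterm; rewrite Z; apply Cmult_0_l.
Qed.

(** * Cosets *)

Definition pm_group (Hs : mat -> Prop) : Prop :=
  (forall A, Hs A -> SL2Z A) /\ Hs mI /\ (forall A B, Hs A -> Hs B -> Hs (mmul A B)) /\
  (forall A, Hs A -> Hs (minv A)) /\ (forall A, Hs A -> Hs (mneg A)).

Lemma pmG_group G : is_subgroup G -> pm_group (pmG G).
Proof.
intros [H1 [H2 [H3 H4]]]. unfold pmG. split; [|split; [|split; [|split]]].
- intros A [H|H]; [auto|]. rewrite <- (mneg_mneg A). now apply SL2Z_mneg, H1.
- now left.
- intros A B [HA|HA] [HB|HB].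
  + left; auto.
  + right. rewrite <- mmul_mneg_r. auto.
  + right. rewrite <- mmul_mneg_l. auto.
  + left. rewrite <- (mneg_mneg (mmul A B)), <- mmul_mneg_l, <- mmul_mneg_r. auto.
- intros A [H|H]; [left; auto|]. right. rewrite <- minv_mneg. auto.
- intros A [H|H]; [|now left]. right. now rewrite mneg_mneg.
Qed.

(** The function [idx] names the coset found by [is_index], so that right multiplication can act on
    indices. *)
Definition coset_reps (Hs : mat -> Prop) (m : nat) (r : nat -> mat) (idx : mat -> nat) : Prop :=
  (forall i, (i < m)%nat -> SL2Z (r i)) /\
  forall A, SL2Z A -> (idx A < m)%nat /\ Hs (mmul A (minv (r (idx A)))) /\
    forall i, (i < m)%nat -> Hs (mmul A (minv (r i))) -> i = idx A.

Lemma coset_reps_exist Hs m : is_index Hs SL2Z m -> exists r idx, coset_reps Hs m r idx.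
Proof.
intros [r [Hr HI]]. exists r.
assert (Ex : forall A, exists i, SL2Z A -> (i < m)%nat /\ Hs (mmul A (minv (r i))) /\
    forall j, (j < m)%nat -> Hs (mmul A (minv (r j))) -> j = i).
{ intros A. destruct (classic (SL2Z A)) as [HA|HA]; [|exists O; tauto].
  destruct (HI A HA) as [i [[Hi Hi'] U]]. exists i. intros _. split; [exact Hi|]. split; [exact Hi'|].
  intros j Hj Hj'. symmetry. now apply U. }
exists (fun A => proj1_sig (constructive_indefinite_description _ (Ex A))). split; [exact Hr|].
intros A HA. destruct (constructive_indefinite_description _ (Ex A)) as [i Hi]. simpl. auto.
Qed.

Lemma mcancel_l A B : SL2Z A -> mmul (minv A) (mmul A B) = B.
Proof. intros H. now rewrite mmul_assoc, mmul_inv_l, mmul_1_l. Qed.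
Lemma mcancel_r A B : SL2Z A -> mmul A (mmul (minv A) B) = B.
Proof. intros H. now rewrite mmul_assoc, mmul_inv_r, mmul_1_l. Qed.

Ltac sl2 := repeat first [assumption | apply SL2Z_mI | apply SL2Z_mmul | apply SL2Z_minv].
Ltac mnorm := repeat first
  [ rewrite minv_mmul | rewrite minv_inv | rewrite <- mmul_assoc
  | rewrite mcancel_l by sl2 | rewrite mcancel_r by sl2
  | rewrite mmul_inv_l by sl2 | rewrite mmul_inv_r by sl2 | rewrite mmul_1_l | rewrite mmul_1_r ].

Lemma idx_eq Hs m r idx A B : pm_group Hs -> coset_reps Hs m r idx -> SL2Z A -> SL2Z B ->
  (Hs (mmul A (minv B)) <-> idx A = idx B).
Proof.
intros [G1 [G2 [G3 [G4 _]]]] [R1 R2] HA HB.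
destruct (R2 A HA) as [A1 [A2 A3]]. destruct (R2 B HB) as [B1 [B2 B3]].
assert (SA := R1 _ A1). assert (SB := R1 _ B1).
split; intros H.
- symmetry. apply A3; [exact B1|].
  replace (mmul A (minv (r (idx B)))) with (mmul (mmul A (minv B)) (mmul B (minv (r (idx B))))) by (mnorm; reflexivity).
  auto.
- rewrite <- H in B2, SB.
  replace (mmul A (minv B)) with (mmul (mmul A (minv (r (idx A)))) (minv (mmul B (minv (r (idx A)))))).
  + auto.
  + mnorm. reflexivity.
Qed.

Lemma idx_r Hs m r idx i : pm_group Hs -> coset_reps Hs m r idx -> (i < m)%nat -> idx (r i) = i.
Proof.
intros [_ [G2 _]] [R1 R2] Hi. symmetry. apply R2; auto. rewrite mmul_inv_r by auto. exact G2.
Qed.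

(** Modularity in absolute value, free of character, cover index and branches. It passes from G to
    its extension by -I because |cz + d| does not see the sign. *)
Definition automorphic (Hs : mat -> Prop) (k : R) (f : C -> C) : Prop :=
  forall g t, Hs g -> 0 < Im t ->
    pnear t (fun z => Cmod (f (mob g z)) = exp (k * ln (Cmod (den g z))) * Cmod (f z)).

Lemma cpown_1 n : cpown 1 n = 1%C.
Proof. induction n as [|n IH]; simpl; [reflexivity|]. rewrite IH. ring. Qed.

Lemma den_pos A t : SL2Z A -> 0 < Im t -> 0 < Cmod (den A t).
Proof. intros. now apply Cmod_gt_0, den_neq0. Qed.

Lemma modular_automorphic G D kn chi f : (1 <= D)%nat -> is_subgroup G ->
  multiplier_system G D kn chi -> mero_modular_form G D kn chi f ->
  automorphic (pmG G) (weight D kn) f.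
Proof.
intros HD HG [HU _] [_ [HM _]].
assert (K : forall g t, G g -> 0 < Im t ->
    pnear t (fun z => Cmod (f (mob g z)) = exp (weight D kn * ln (Cmod (den g z))) * Cmod (f z))).
{ intros g t Hg Ht. assert (R1 : root_of_unity D 1) by apply cpown_1.
  assert (Sg : SL2Z g) by now apply HG.
  generalize (pnear_and _ _ _ (near_pnear _ _ (near_Im t Ht))
    (mero_eq_pnear _ _ t Ht (HM g 1%C Hg R1))). apply pnear_imp. intros z [Hz E].
  apply (f_equal Cmod) in E. rewrite Cmod_mult, (HU g 1%C Hg R1), Rmult_1_l in E.
  rewrite Cmod_slash in E by (auto; apply Cmod_1). rewrite <- E, <- Rmult_assoc, <- exp_plus.
  replace (weight D kn * ln (Cmod (den g z)) + - weight D kn * ln (Cmod (den g z))) with 0 by ring.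
  rewrite exp_0. ring. }
intros g t [Hg|Hg] Ht; [now apply K|].
assert (Sg : SL2Z (mneg g)) by now apply HG.
generalize (pnear_and _ _ _ (near_pnear _ _ (near_Im t Ht)) (K (mneg g) t Hg Ht)).
apply pnear_imp. intros z [Hz E]. rewrite den_mneg, Cmod_opp in E.
rewrite <- (mneg_mneg g) at 1. rewrite mob_mneg by assumption. exact E.
Qed.

Lemma modular_order_invariant G D kn chi f oF : (1 <= D)%nat -> is_subgroup G ->
  multiplier_system G D kn chi -> mero_modular_form G D kn chi f ->
  (forall t, 0 < Im t -> is_ord f t (oF t)) ->
  forall g t, pmG G g -> 0 < Im t -> oF (mob g t) = oF t.
Proof.
intros HD HG [HU _] [_ [HM _]] Ho.
assert (K : forall g t, G g -> 0 < Im t -> oF (mob g t) = oF t).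
{ intros g t Hg Ht. assert (R1 : root_of_unity D 1) by apply cpown_1.
  assert (Sg : SL2Z g) by now apply HG.
  apply (is_ord_unique (slash D kn g 1 f) t).
  - apply is_ord_slash; auto. apply Ho. now apply Im_mob_pos.
  - apply is_ord_ext with (fun z => chi g 1%C * f z)%C.
    + generalize (mero_eq_pnear _ _ t Ht (HM g 1%C Hg R1)). apply pnear_imp. auto.
    + replace (oF t) with (0 + oF t)%Z by ring. apply is_ord_mult; [|now apply Ho].
      apply is_ord_hol; [apply near_all; intros; apply hol_const|].
      apply Cmod_gt_0. rewrite (HU g 1%C Hg R1). lra. }
intros g t [Hg|Hg] Ht; [now apply K|].
rewrite <- (K (mneg g) t Hg Ht). f_equal. symmetry. rewrite <- (mneg_mneg g) at 2.
symmetry. apply mob_mneg; [now apply HG|exact Ht].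
Qed.

(* |f|_k A|, where k is a real weight *)
Definition phi (k : R) (f : C -> C) (A : mat) (z : C) : R :=
  exp (- k * ln (Cmod (den A z))) * Cmod (f (mob A z)).

Lemma phi_mul k f A B z : SL2Z A -> SL2Z B -> 0 < Im z ->
  phi k f A (mob B z) = exp (k * ln (Cmod (den B z))) * phi k f (mmul A B) z.
Proof.
intros HA HB Hz. unfold phi. rewrite den_mmul, mob_mmul, Cmod_mult by assumption.
pose proof (den_pos B z HB Hz). pose proof (den_pos A (mob B z) HA (Im_mob_pos B z HB Hz)).
rewrite ln_mult by assumption. rewrite <- Rmult_assoc, <- exp_plus. f_equal. f_equal. ring.
Qed.

(** Automorphy of f under g cancels the cocycle factor of g; so near each point, the centre
    excepted, [phi] depends only on the coset of A. *)
Lemma phi_left k f Hs g A t : automorphic Hs k f -> (forall A, Hs A -> SL2Z A) -> Hs g -> SL2Z A -> 0 < Im t ->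
  pnear t (fun z => phi k f (mmul g A) z = phi k f A z).
Proof.
intros HF HS Hg HA Ht. assert (Ht' := Im_mob_pos A t HA Ht).
generalize (pnear_and _ _ _ (near_pnear _ _ (near_Im t Ht)) (pnear_mob A t _ HA Ht (HF g _ Hg Ht'))).
apply pnear_imp. intros z [Hz E]. assert (Sg := HS g Hg). unfold phi.
rewrite den_mmul, mob_mmul, Cmod_mult, E by assumption.
pose proof (den_pos A z HA Hz). pose proof (den_pos g (mob A z) Sg (Im_mob_pos A z HA Hz)).
rewrite ln_mult by assumption. rewrite <- Rmult_assoc, <- exp_plus. f_equal. f_equal. ring.
Qed.

Definition prodR {A} (l : list A) (f : A -> R) : R := fold_right (fun i acc => f i * acc) 1 l.
Definition prodC {A} (l : list A) (f : A -> C) : C := fold_right (fun i acc => (f i * acc)%C) 1%C l.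
Definition sumZ {A} (l : list A) (f : A -> Z) : Z := fold_right (fun i acc => (f i + acc)%Z) 0%Z l.

Lemma prodR_perm {A} (l l' : list A) f : Permutation l l' -> prodR l f = prodR l' f.
Proof.
intros P. induction P; simpl; [reflexivity|now rewrite IHP|ring|now rewrite IHP1, IHP2].
Qed.

Lemma prodR_map {A B} (l : list A) (g : A -> B) f : prodR (map g l) f = prodR l (fun x => f (g x)).
Proof. induction l as [|a l IH]; simpl; [reflexivity|]. now rewrite IH. Qed.

Lemma Cmod_prodC {A} (l : list A) f : Cmod (prodC l f) = prodR l (fun i => Cmod (f i)).
Proof. induction l as [|a l IH]; simpl; [apply Cmod_1|]. now rewrite Cmod_mult, IH. Qed.

Lemma IZR_sumZ {A} (l : list A) f : IZR (sumZ l f) = sumL l (fun i => IZR (f i)).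
Proof. induction l as [|a l IH]; simpl; [reflexivity|]. now rewrite plus_IZR, IH. Qed.

Lemma is_ord_prodC {A} (l : list A) (F : A -> C -> C) t (o : A -> Z) :
  (forall i, In i l -> is_ord (F i) t (o i)) -> is_ord (fun z => prodC l (fun i => F i z)) t (sumZ l o).
Proof.
induction l as [|a l IH]; simpl; intros H.
- apply is_ord_hol; [apply near_all; intros; apply hol_const|apply C1_nz].
- apply (is_ord_mult (F a) (fun z => prodC l (fun i => F i z))); [apply H; auto|apply IH; auto].
Qed.

Lemma asympt_mult F G r s (c d : C) : asympt F r c -> asympt G s d ->
  asympt (fun z => F z * G z)%C (r + s) (c * d)%C.
Proof.
intros HF HG e He.
set (M := Cmod c + Cmod d + 1). pose proof (Cmod_ge_0 c). pose proof (Cmod_ge_0 d).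
assert (HM : 0 < M) by (unfold M; lra).
set (e' := Rmin 1 (e / (2 * M))).
assert (He' : 0 < e') by (unfold e'; apply Rmin_glb_lt; [lra|apply Rdiv_lt_0_compat; lra]).
assert (E1 : e' <= 1) by apply Rmin_l.
assert (E2 : e' * (2 * M) <= e).
{ apply Rle_trans with (e / (2 * M) * (2 * M)); [|right; field; lra].
  apply Rmult_le_compat_r; [lra|apply Rmin_r]. }
destruct (HF e' He') as [Y1 H1]. destruct (HG e' He') as [Y2 H2].
exists (Rmax Y1 Y2). intros z Hz. pose proof (Rmax_l Y1 Y2). pose proof (Rmax_r Y1 Y2).
specialize (H1 z ltac:(lra)). specialize (H2 z ltac:(lra)).
set (x := (F z * eC (RtoC (- r) * z) - c)%C) in *. set (y := (G z * eC (RtoC (- s) * z) - d)%C) in *.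
replace (F z * G z * eC (RtoC (- (r + s)) * z) - c * d)%C with (x * y + x * d + c * y)%C.
- eapply Rle_lt_trans; [apply Cmod_triangle3|]. rewrite !Cmod_mult.
  pose proof (Cmod_ge_0 x). pose proof (Cmod_ge_0 y).
  apply Rle_lt_trans with (e' * 1 + e' * Cmod d + Cmod c * e').
  + apply Rplus_le_compat; [apply Rplus_le_compat|]; apply Rmult_le_compat; lra.
  + unfold M in E2. nra.
- assert (Ee : eC (RtoC (- (r + s)) * z) = (eC (RtoC (- r) * z) * eC (RtoC (- s) * z))%C).
  { unfold eC. rewrite <- cexp_add. f_equal. rewrite Ropp_plus_distr, RtoC_plus. ring. }
  rewrite Ee. unfold x, y. ring.
Qed.

Lemma asympt_prodC {A} (l : list A) (F : A -> C -> C) (r : A -> R) (c : A -> C) :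
  (forall i, In i l -> asympt (F i) (r i) (c i) /\ c i <> 0%R) ->
  asympt (fun z => prodC l (fun i => F i z)) (sumL l r) (prodC l c) /\ prodC l c <> 0%R.
Proof.
induction l as [|a l IH]; simpl; intros H.
- split; [|apply C1_nz]. intros e He. exists 0. intros z _. unfold eC.
  replace (RtoC 1 * cexp ((0, (2 * PI)%R) * (RtoC (- 0) * z)) - RtoC 1)%C with (RtoC 0).
  + now rewrite Cmod_0.
  + replace ((0, (2 * PI)%R) * (RtoC (- 0) * z))%C with (RtoC 0); [rewrite cexp_0; ring|].
    rewrite Ropp_0. ring.
- destruct (H a (or_introl eq_refl)) as [A1 A2]. destruct IH as [I1 I2]; [auto|].
  split; [|now apply Cmult_neq_0]. now apply asympt_mult.
Qed.

Lemma pnear_list {A} (l : list A) t (P : A -> C -> Prop) :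
  (forall i, In i l -> pnear t (P i)) -> pnear t (fun z => forall i, In i l -> P i z).
Proof.
induction l as [|a l IH]; intros H.
- apply near_pnear, near_all. intros z i [].
- generalize (pnear_and _ _ _ (H a (or_introl eq_refl)) (IH (fun i Hi => H i (or_intror Hi)))).
  apply pnear_imp. intros z [A1 A2] i [<-|Hi]; auto.
Qed.

Lemma prodR_ext {A} (l : list A) f g : (forall i, In i l -> f i = g i) -> prodR l f = prodR l g.
Proof. induction l as [|a l IH]; simpl; intros H; [reflexivity|]. rewrite H, IH; auto. Qed.

Lemma prodR_exp {A} (l : list A) x f : prodR l (fun i => exp x * f i) = exp (INR (length l) * x) * prodR l f.
Proof.
induction l as [|a l IH]; [simpl; rewrite Rmult_0_l, exp_0; ring|].
simpl length. rewrite S_INR. replace ((INR (length l) + 1) * x) with (x + INR (length l) * x) by ring.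
rewrite exp_plus. simpl. rewrite IH. ring.
Qed.

(** Right multiplication acts injectively on the finite set of right cosets. *)
Lemma coset_shift_perm Hs m r idx g : pm_group Hs -> coset_reps Hs m r idx -> SL2Z g ->
  Permutation (map (fun i => idx (mmul (r i) g)) (seq 0 m)) (seq 0 m).
Proof.
intros HG HR Hg. destruct (HR) as [R1 R2].
assert (Hm : forall i, In i (seq 0 m) -> (i < m)%nat) by (intros i Hi; apply in_seq in Hi; lia).
apply NoDup_Permutation_bis.
- assert (Inj : forall i j, In i (seq 0 m) -> In j (seq 0 m) ->
    idx (mmul (r i) g) = idx (mmul (r j) g) -> i = j).
  { intros i j Hi Hj E. apply Hm in Hi. apply Hm in Hj.
    assert (Si := R1 _ Hi). assert (Sj := R1 _ Hj).
    apply (idx_eq Hs m r idx _ _ HG HR) in E; [|sl2|sl2].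
    revert E. mnorm. intros E.
    rewrite <- (idx_r Hs m r idx i HG HR Hi), <- (idx_r Hs m r idx j HG HR Hj).
    now apply (idx_eq Hs m r idx). }
  clear Hm. revert Inj. generalize (seq_NoDup m 0). generalize (seq 0 m). intros l N Inj.
  induction N as [|a l Na N IH]; simpl; constructor.
  + intros I. apply in_map_iff in I. destruct I as [b [E I]]. apply Na.
    rewrite <- (Inj b a); auto; [now right|now left].
  + apply IH. intros; apply Inj; auto; now right.
- rewrite length_map. lia.
- intros j Hj. apply in_map_iff in Hj. destruct Hj as [i [<- Hi]]. apply Hm in Hi.
  apply in_seq. split; [lia|]. apply R2. apply SL2Z_mmul; auto.
Qed.

(** The product over cosets is a norm to SL_2(Z): g permutes the m factors, and each contributes |cz
    + d|^k. *)
Lemma product_invariant Hs m r idx k f g t : pm_group Hs -> coset_reps Hs m r idx ->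
  automorphic Hs k f -> SL2Z g -> 0 < Im t ->
  pnear t (fun z => prodR (seq 0 m) (fun i => phi k f (r i) (mob g z)) =
     exp (INR m * k * ln (Cmod (den g z))) * prodR (seq 0 m) (fun i => phi k f (r i) z)).
Proof.
intros HG HR HF Hg Ht. assert (GS := proj1 HG). destruct (HR) as [R1 R2].
assert (K : pnear t (fun z => forall i, In i (seq 0 m) ->
   phi k f (mmul (r i) g) z = phi k f (r (idx (mmul (r i) g))) z)).
{ apply (pnear_list (seq 0 m) t (fun i z => phi k f (mmul (r i) g) z = phi k f (r (idx (mmul (r i) g))) z)).
  intros i Hi. apply in_seq in Hi. assert (Si : SL2Z (r i)) by (apply R1; lia).
  assert (S1 : SL2Z (mmul (r i) g)) by sl2. destruct (R2 _ S1) as [I1 [I2 _]].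
  assert (Sj := R1 _ I1). set (j := idx (mmul (r i) g)) in *.
  generalize (phi_left k f Hs _ (r j) t HF GS I2 Sj Ht). apply pnear_imp. intros z <-.
  f_equal. mnorm. reflexivity. }
generalize (pnear_and _ _ _ (near_pnear _ _ (near_Im t Ht)) K). apply pnear_imp. intros z [Hz E].
rewrite (prodR_ext _ _ (fun i => exp (k * ln (Cmod (den g z))) * phi k f (r (idx (mmul (r i) g))) z)).
- rewrite prodR_exp, length_seq. f_equal; [f_equal; ring|].
  rewrite <- (prodR_map (seq 0 m) (fun i => idx (mmul (r i) g)) (fun j => phi k f (r j) z)).
  apply prodR_perm. now apply (coset_shift_perm Hs).
- intros i Hi. rewrite <- E by exact Hi. apply phi_mul; auto. apply in_seq in Hi. apply R1. lia.
Qed.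

(** * Orbits and cusps *)

Lemma Cmod_slash_phi D kn A f z : (1 <= D)%nat -> SL2Z A -> 0 < Im z ->
  Cmod (slash D kn A 1 f z) = phi (weight D kn) f A z.
Proof. intros. rewrite Cmod_slash; auto. apply Cmod_1. Qed.

(** The argument principle for the norm of f, whose order at t is the sum of the orders of f at the
    points r_i t and whose exponent at infinity is the sum of the rho i. *)
Lemma product_formula Hs m r idx D kn f oF rho : (1 <= D)%nat ->
  pm_group Hs -> coset_reps Hs m r idx -> automorphic Hs (weight D kn) f ->
  (forall t, 0 < Im t -> is_ord f t (oF t)) ->
  (forall i, (i < m)%nat -> ord_infty (slash D kn (r i) 1 f) (rho i)) ->
  forall Z : list C, NoDup Z -> (forall t, In t Z -> 0 < Im t) ->
  (forall t i, 0 < Im t -> w t <> 0 -> (i < m)%nat -> oF (mob (r i) t) <> 0%Z -> In t Z) ->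
  sumL Z (fun t => sumL (seq 0 m) (fun i => IZR (oF (mob (r i) t))) * w t) + sumL (seq 0 m) rho =
  INR m * weight D kn / 12.
Proof.
intros HD HG HR HF Ho Hrho Z NZ HZ1 HZ2. destruct (HR) as [R1 R2].
assert (Hm : forall i, In i (seq 0 m) -> (i < m)%nat) by (intros i Hi; apply in_seq in Hi; lia).
assert (Exc : forall i, exists c : C, (i < m)%nat -> c <> 0%R /\ asympt (slash D kn (r i) 1 f) (rho i) c).
{ intros i. destruct (lt_dec i m) as [L|L]; [|exists 0%R; lia].
  destruct (ord_infty_asympt _ _ (Hrho i L)) as [c Hc]. now exists c. }
set (c := fun i => proj1_sig (constructive_indefinite_description _ (Exc i))).
assert (Hc : forall i, (i < m)%nat -> c i <> 0%R /\ asympt (slash D kn (r i) 1 f) (rho i) (c i)).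
{ intros i. unfold c. destruct (constructive_indefinite_description _ (Exc i)). auto. }
set (F := fun z => prodC (seq 0 m) (fun i => slash D kn (r i) 1 f z)).
set (oFF := fun t => sumZ (seq 0 m) (fun i => oF (mob (r i) t))).
destruct (asympt_prodC (seq 0 m) (fun i => slash D kn (r i) 1 f) rho c) as [HA Hne].
{ intros i Hi. apply Hm in Hi. destruct (Hc i Hi). auto. }
assert (MF : forall z, 0 < Im z -> Cmod (F z) = prodR (seq 0 m) (fun i => phi (weight D kn) f (r i) z)).
{ intros z Hz. unfold F. rewrite Cmod_prodC. apply prodR_ext. intros i Hi. apply Cmod_slash_phi; auto. }
assert (Inv : forall g t, SL2Z g -> 0 < Im t -> pnear t (fun z =>
   Cmod (F (mob g z)) = exp (INR m * weight D kn * ln (Cmod (den g z))) * Cmod (F z))).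
{ intros g t Hg Ht. generalize (pnear_and _ _ _ (near_pnear _ _ (near_Im t Ht))
    (product_invariant Hs m r idx (weight D kn) f g t HG HR HF Hg Ht)).
  apply pnear_imp. intros z [Hz E]. rewrite !MF by (auto using Im_mob_pos). exact E. }
rewrite <- (level_one F oFF (INR m * weight D kn) (sumL (seq 0 m) rho) (prodC (seq 0 m) c)) with (Z := Z).
- f_equal. apply sumL_ext. intros t Ht. unfold oFF. rewrite IZR_sumZ. reflexivity.
- intros t Ht. apply (is_ord_prodC (seq 0 m) (fun i => slash D kn (r i) 1 f)).
  intros i Hi. apply is_ord_slash; auto. apply Ho. apply Im_mob_pos; auto.
- intros t Ht. generalize (Inv mT t eq_refl Ht). apply pnear_imp. intros z ->.
  replace (den mT z) with (RtoC 1) by (unfold den, mT, ZtoC; simpl; ring).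
  rewrite Cmod_1, ln_1, Rmult_0_r, exp_0. ring.
- intros t Ht. generalize (Inv mS t eq_refl Ht). apply pnear_imp. intros z ->.
  replace (den mS z) with z by (unfold den, mS, ZtoC; simpl; ring). reflexivity.
- exact Hne.
- exact HA.
- exact NZ.
- intros t Ht Hw Hne'. unfold oFF in Hne'.
  assert (Q : exists i, In i (seq 0 m) /\ oF (mob (r i) t) <> 0%Z).
  { apply NNPP. intros N. apply Hne'.
    assert (K : forall i, In i (seq 0 m) -> oF (mob (r i) t) = 0%Z).
    { intros i Hi. apply NNPP. intros E. apply N. now exists i. }
    clear -K. induction (seq 0 m) as [|a l IH]; simpl; [reflexivity|]. rewrite K, IH; simpl; auto. intros; apply K; now right. }
  destruct Q as [i [Hi Q]]. apply (HZ2 t i); auto.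
- exact HZ1.
Qed.

Definition indic (P : Prop) : R := if excluded_middle_informative P then 1 else 0.

Lemma indic_true (P : Prop) : P -> indic P = 1.
Proof. intros H. unfold indic. destruct (excluded_middle_informative P); tauto. Qed.
Lemma indic_false (P : Prop) : ~ P -> indic P = 0.
Proof. intros H. unfold indic. destruct (excluded_middle_informative P); tauto. Qed.

Lemma sumL_swap {A B} (l : list A) (l' : list B) (f : A -> B -> R) :
  sumL l (fun a => sumL l' (fun b => f a b)) = sumL l' (fun b => sumL l (fun a => f a b)).
Proof.
induction l as [|a l IH]; simpl.
- symmetry. now apply sumL_0.
- now rewrite IH, sumL_plus.
Qed.

Lemma sumL_ind_eq {A} (l : list A) a (f : A -> R) : NoDup l -> In a l ->
  sumL l (fun b => indic (a = b) * f b) = f a.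
Proof.
intros N. induction N as [|b l Nb N IH]; simpl; [tauto|]. intros [->|I].
- rewrite indic_true by reflexivity. rewrite sumL_0; [ring|]. intros t Ht.
  rewrite indic_false; [ring|]. intros ->. tauto.
- rewrite IH by exact I. rewrite indic_false; [ring|]. intros ->. tauto.
Qed.

Definition fltr {A} (P : A -> Prop) (l : list A) : list A :=
  filter (fun a => if excluded_middle_informative (P a) then true else false) l.

Lemma in_fltr {A} (P : A -> Prop) l a : In a (fltr P l) <-> In a l /\ P a.
Proof.
unfold fltr. rewrite filter_In. destruct (excluded_middle_informative (P a)); intuition discriminate.
Qed.

Lemma sumL_ind {A} (P : A -> Prop) l : sumL l (fun a => indic (P a)) = INR (length (fltr P l)).
Proof.
induction l as [|a l IH]; [reflexivity|]. unfold fltr in *; simpl. unfold indic at 1.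
destruct (excluded_middle_informative (P a)); [simpl length; rewrite S_INR|]; rewrite IH; ring.
Qed.

Lemma length_eq_of_members {A} (l l' : list A) : NoDup l -> NoDup l' ->
  (forall x, In x l <-> In x l') -> length l = length l'.
Proof. intros N N' H. now apply Permutation_length, NoDup_Permutation. Qed.

Lemma NoDup_map_in {A B} (g : A -> B) l : NoDup l ->
  (forall a b, In a l -> In b l -> g a = g b -> a = b) -> NoDup (map g l).
Proof.
intros N. induction N as [|a l Na N IH]; simpl; intros H; constructor.
- intros I. apply in_map_iff in I. destruct I as [b [E I]]. apply Na. rewrite <- (H b a); auto.
- apply IH. auto.
Qed.

Lemma mneg_neq A : SL2Z A -> A <> mneg A.
Proof.
intros H E. destruct A as [a b c d]. unfold mneg in E. injection E as E1 E2 E3 E4.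
unfold SL2Z, mdet in H; simpl in H. assert (a = 0 /\ b = 0)%Z as [-> ->] by lia. lia.
Qed.

(** A and -A are distinct matrices, so the stabilizer has twice as many elements as its image in
    PSL_2(Z). *)
Lemma stab_card_list G t n : (forall A, pmG G A -> SL2Z A) -> 0 < Im t -> stab_card G t n ->
  exists S : list mat, NoDup S /\ length S = (2 * n)%nat /\
    forall A, In A S <-> pmG G A /\ mob A t = t.
Proof.
intros HS Ht [r [H1 H2]].
assert (Hm : forall i, In i (seq 0 n) -> (i < n)%nat) by (intros i Hi; apply in_seq in Hi; lia).
assert (Hneg : forall A, pmG G A -> pmG G (mneg A)).
{ intros A [H|H]; [right; now rewrite mneg_mneg|now left]. }
assert (U : forall i j A, (i < n)%nat -> (j < n)%nat -> (A = r i \/ A = mneg (r i)) ->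
   (A = r j \/ A = mneg (r j)) -> i = j).
{ intros i j A Hi Hj Ei Ej. destruct (H1 i Hi) as [K1 K2].
  assert (PA : pmG G A) by (destruct Ei as [-> | ->]; auto).
  assert (MA : mob A t = t) by (destruct Ei as [-> | ->]; [|rewrite mob_mneg]; auto).
  destruct (H2 A PA MA) as [u [_ Hu]]. rewrite <- (Hu i), <- (Hu j); auto. }
exists (map r (seq 0 n) ++ map (fun i => mneg (r i)) (seq 0 n)). split; [|split].
- apply NoDup_app.
  + apply NoDup_map_in; [apply seq_NoDup|]. intros i j Hi Hj E.
    apply (U i j (r i)); auto.
  + apply NoDup_map_in; [apply seq_NoDup|]. intros i j Hi Hj E.
    apply (U i j (mneg (r i))); auto.
  + intros A I J. apply in_map_iff in I. destruct I as [i [<- Hi]].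
    apply in_map_iff in J. destruct J as [j [E Hj]].
    assert (i = j) by (apply (U i j (r i)); auto). subst j.
    apply (mneg_neq (r i)); [apply HS; apply H1; auto|auto].
- rewrite length_app, !length_map, length_seq. lia.
- intros A. rewrite in_app_iff, !in_map_iff. split.
  + intros [[i [<- Hi]]|[i [<- Hi]]]; destruct (H1 i (Hm i Hi)) as [K1 K2]; [auto|].
    split; [auto|]. rewrite mob_mneg; auto.
  + intros [PA MA]. destruct (H2 A PA MA) as [i [[Hi [E|E]] _]].
    * left. exists i. split; [auto|apply in_seq; lia].
    * right. exists i. split; [auto|apply in_seq; lia].
Qed.

(** Double counting of the matrices A with A t0 in the domain, sorted by t = A t0 and the coset i of
    the inverse of A. If r_i t is equivalent to t0, the matrices for (t, i) form a torsor under the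
    stabilizer of t0, of order 2 st; otherwise there are none. Their total weight is 2. *)
Lemma orbit_sum G m r idx t0 st L : is_subgroup G -> coset_reps (pmG G) m r idx -> 0 < Im t0 ->
  stab_card G t0 st ->
  NoDup L -> (forall A, In A L -> SL2Z A /\ w (mob A t0) <> 0) ->
  (forall A, SL2Z A -> w (mob A t0) <> 0 -> In A L) -> sumL L (fun A => w (mob A t0)) = 2 ->
  forall Z : list C, NoDup Z -> (forall t, In t Z -> 0 < Im t /\ w t <> 0) ->
  (forall A, In A L -> In (mob A t0) Z) ->
  INR st * sumL Z (fun t => sumL (seq 0 m) (fun i => indic (H_equiv G (mob (r i) t) t0)) * w t) = 1.
Proof.
intros HGs HR Ht0 Hst NL L1 L2 L3 Z NZ HZ HLZ.
assert (HG := pmG_group G HGs). destruct (HG) as [G1 [G2 [G3 [G4 G5]]]]. destruct (HR) as [R1 R2].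
destruct (stab_card_list G t0 st G1 Ht0 Hst) as [S [NS [LS HS]]].
assert (Heq : forall z g, 0 < Im z -> pmG G g -> mob g z = t0 -> H_equiv G z t0).
{ intros z g Hz [Hg|Hg] E; [now exists g|]. exists (mneg g). split; [exact Hg|].
  rewrite mob_mneg; auto. apply G1. now right. }
assert (Count : forall t i, In t Z -> In i (seq 0 m) ->
  sumL L (fun A => indic (mob A t0 = t /\ idx (minv A) = i)) = 2 * INR st * indic (H_equiv G (mob (r i) t) t0)).
{ intros t i It Ii. apply in_seq in Ii. assert (Si : SL2Z (r i)) by (apply R1; lia).
  destruct (HZ t It) as [Ht Hw]. assert (Ht' := Im_mob_pos (r i) t Si Ht).
  rewrite sumL_ind.
  assert (Char : forall A, SL2Z A -> mob A t0 = t -> idx (minv A) = i ->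
     pmG G (mmul (minv A) (minv (r i))) /\ mob (mmul (minv A) (minv (r i))) (mob (r i) t) = t0).
  { intros A SA E1 E2. destruct (R2 (minv A) (SL2Z_minv A SA)) as [_ [K _]]. rewrite E2 in K.
    split; [exact K|]. rewrite <- mob_mmul by sl2. mnorm. rewrite <- E1. now apply mob_minv_l. }
  destruct (classic (H_equiv G (mob (r i) t) t0)) as [E|E].
  - rewrite indic_true by exact E. destruct E as [g0 [Hg0 E0]].
    assert (P0 : pmG G g0) by now left. assert (S0 := G1 _ P0).
    assert (Et : t = mob (minv (mmul g0 (r i))) t0).
    { rewrite <- E0, <- (mob_mmul g0 (r i)) by sl2. now rewrite mob_minv_l by sl2. }
    (* With g0 r_i t = t0, the matrices counted are the inverses of s g0 r_i for s in the
       stabilizer. *)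
    rewrite Rmult_1_r. rewrite (length_eq_of_members _ (map (fun s => minv (mmul s (mmul g0 (r i)))) S)).
    + rewrite length_map, LS, mult_INR. simpl (INR 2). ring.
    + now apply NoDup_filter.
    + apply NoDup_map_in; [exact NS|]. intros a b _ _ Eab. apply (f_equal minv) in Eab.
      rewrite !minv_inv in Eab. apply mmul_cancel_r in Eab; [exact Eab|sl2].
    + intros A. rewrite in_fltr, in_map_iff. split.
      * intros [IA [E1 E2]]. destruct (L1 A IA) as [SA _]. destruct (Char A SA E1 E2) as [K1 K2].
        exists (mmul (mmul (minv A) (minv (r i))) (minv g0)). split.
        -- mnorm. reflexivity.
        -- apply HS. split; [auto|]. assert (Sk := G1 _ K1).
           rewrite mob_mmul by sl2. rewrite <- E0 at 1. rewrite mob_minv_l by sl2. exact K2.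
      * intros [s [<- Is]]. apply HS in Is. destruct Is as [Ps Fs]. assert (Ss := G1 _ Ps).
        assert (Em : mob (minv (mmul s (mmul g0 (r i)))) t0 = t).
        { rewrite Et. rewrite minv_mmul, mob_mmul by sl2. f_equal.
          rewrite <- Fs at 1. now apply mob_minv_l. }
        split; [apply L2; [sl2|now rewrite Em]|]. split; [exact Em|].
        rewrite minv_inv. symmetry. apply R2; [sl2|lia|]. mnorm. auto.
  - rewrite indic_false by exact E. rewrite Rmult_0_r. change 0 with (INR 0). f_equal.
    destruct (fltr _ L) as [|A l] eqn:EF; [reflexivity|]. exfalso. apply E.
    assert (I : In A (fltr (fun A => mob A t0 = t /\ idx (minv A) = i) L)) by (rewrite EF; now left).
    apply in_fltr in I. destruct I as [IA [E1 E2]]. destruct (L1 A IA) as [SA _].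
    destruct (Char A SA E1 E2) as [K1 K2]. now apply (Heq _ _ Ht' K1). }
assert (Tot : sumL Z (fun t => sumL (seq 0 m) (fun i =>
    sumL L (fun A => indic (mob A t0 = t /\ idx (minv A) = i))) * w t) = 2).
{ rewrite <- L3.
  transitivity (sumL Z (fun t => sumL L (fun A => indic (mob A t0 = t) * w t))).
  - apply sumL_ext. intros t It. rewrite sumL_swap, Rmult_comm, <- sumL_scal. apply sumL_ext.
    intros A IA. destruct (L1 A IA) as [SA _]. rewrite (Rmult_comm (indic _)). f_equal.
    rewrite (sumL_ext _ _ (fun i => indic (idx (minv A) = i) * indic (mob A t0 = t))).
    + apply (sumL_ind_eq (seq 0 m) (idx (minv A)) (fun _ => indic (mob A t0 = t))); [apply seq_NoDup|].
      apply in_seq. split; [lia|]. apply R2. sl2.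
    + intros i _. unfold indic. repeat destruct (excluded_middle_informative _); try tauto; ring.
  - rewrite sumL_swap. apply sumL_ext. intros A IA. apply sumL_ind_eq; auto. }
apply Rmult_eq_reg_l with 2; [|lra].
transitivity 2; [|ring].
rewrite <- Tot at 2. rewrite <- Rmult_assoc, <- sumL_scal. apply sumL_ext. intros t It.
rewrite <- Rmult_assoc, <- sumL_scal. f_equal. apply sumL_ext. intros i Ii. rewrite Count by assumption. ring.
Qed.

Lemma rsum_sumL N F : rsum N F = sumL (seq 0 N) F.
Proof.
induction N as [|N IH]; [reflexivity|]. rewrite seq_S, sumL_app. simpl. rewrite IH. ring.
Qed.

Lemma H_equiv_sym G t t' : is_subgroup G -> 0 < Im t -> H_equiv G t t' -> H_equiv G t' t.
Proof.
intros HG Ht [A [HA <-]]. exists (minv A). split; [now apply HG|]. apply mob_minv_l; [now apply HG|exact Ht].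
Qed.

Lemma H_equiv_trans G t t' t'' : is_subgroup G -> 0 < Im t -> H_equiv G t t' -> H_equiv G t' t'' -> H_equiv G t t''.
Proof.
intros HG Ht [A [HA <-]] [B [HB <-]]. exists (mmul B A). split; [now apply HG|].
apply mob_mmul; auto; now apply HG.
Qed.

(** Z consists of the points of the domain in the SL_2(Z)-orbits of the tau l. The order at r_i t is
    the sum of the ordt l over those l with tau l equivalent to r_i t, and [orbit_sum] evaluates the
    coefficient of ordt l as 1/st l. *)
Lemma points_sum G m r idx f oF N tau ordt st :
  is_subgroup G -> coset_reps (pmG G) m r idx ->
  (forall t, 0 < Im t -> is_ord f t (oF t)) ->
  (forall g t, pmG G g -> 0 < Im t -> oF (mob g t) = oF t) ->
  (forall i, (i < N)%nat ->
     0 < Im (tau i) /\ is_order f (tau i) (ordt i) /\ stab_card G (tau i) (st i)) ->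
  (forall i j, (i < N)%nat -> (j < N)%nat -> i <> j -> ~ H_equiv G (tau i) (tau j)) ->
  (forall t n, 0 < Im t -> is_order f t n -> n <> 0%Z ->
     exists i, (i < N)%nat /\ H_equiv G t (tau i)) ->
  exists Z : list C, NoDup Z /\ (forall t, In t Z -> 0 < Im t) /\
    (forall t i, 0 < Im t -> w t <> 0 -> (i < m)%nat -> oF (mob (r i) t) <> 0%Z -> In t Z) /\
    sumL Z (fun t => sumL (seq 0 m) (fun i => IZR (oF (mob (r i) t))) * w t) =
    rsum N (fun l => IZR (ordt l) / INR (st l)).
Proof.
intros HGs HR Ho Hinv Ht Hneq Hall. destruct (HR) as [R1 R2].
assert (GS : forall A, G A -> SL2Z A) by apply HGs.
assert (HN : forall i, In i (seq 0 N) -> (i < N)%nat) by (intros i Hi; apply in_seq in Hi; lia).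
assert (Hm : forall i, In i (seq 0 m) -> (i < m)%nat) by (intros i Hi; apply in_seq in Hi; lia).
assert (ExL : forall l, exists L : list mat, (l < N)%nat -> NoDup L /\
  (forall A, In A L -> SL2Z A /\ w (mob A (tau l)) <> 0) /\
  (forall A, SL2Z A -> w (mob A (tau l)) <> 0 -> In A L) /\
  sumL L (fun A => w (mob A (tau l))) = 2).
{ intros l. destruct (lt_dec l N) as [Hl|Hl]; [|exists nil; lia].
  destruct (orbit_weights (tau l)) as [L HL]; [now apply Ht|]. exists L. auto. }
set (LL := fun l => proj1_sig (constructive_indefinite_description _ (ExL l))).
assert (HLL : forall l, (l < N)%nat -> NoDup (LL l) /\
  (forall A, In A (LL l) -> SL2Z A /\ w (mob A (tau l)) <> 0) /\
  (forall A, SL2Z A -> w (mob A (tau l)) <> 0 -> In A (LL l)) /\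
  sumL (LL l) (fun A => w (mob A (tau l))) = 2).
{ intros l. unfold LL. destruct (constructive_indefinite_description _ (ExL l)). auto. }
set (Z := nodup Ceq_dec (flat_map (fun l => map (fun A => mob A (tau l)) (LL l)) (seq 0 N))).
assert (InZ : forall t, In t Z <-> exists l A, (l < N)%nat /\ In A (LL l) /\ t = mob A (tau l)).
{ intros t. unfold Z. rewrite nodup_In, in_flat_map. split.
  - intros [l [Hl I]]. apply in_map_iff in I. destruct I as [A [E I]]. exists l, A. auto.
  - intros [l [A [Hl [I E]]]]. exists l. split; [apply in_seq; lia|]. apply in_map_iff. exists A. auto. }
assert (HZ : forall t, In t Z -> 0 < Im t /\ w t <> 0).
{ intros t I. apply InZ in I. destruct I as [l [A [Hl [I ->]]]].
  destruct (HLL l Hl) as [_ [K _]]. destruct (K A I) as [K1 K2]. split; [|exact K2].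
  apply Im_mob_pos; [exact K1|now apply Ht]. }
assert (Eo : forall l, (l < N)%nat -> ordt l = oF (tau l)).
{ intros l Hl. destruct (Ht l Hl) as [T1 [T2 _]]. apply (is_ord_unique f (tau l)); auto.
  now apply is_order_is_ord. }
exists Z. split; [apply NoDup_nodup|]. split; [intros t I; now apply HZ|]. split.
- intros t i Hti Hw Hi Hne. assert (Si := R1 i Hi). assert (Hti' := Im_mob_pos (r i) t Si Hti).
  destruct (Hall (mob (r i) t) (oF (mob (r i) t))) as [l [Hl [g [Hg E]]]]; auto.
  { apply is_order_is_ord; auto. }
  assert (Sg := GS g Hg). apply InZ. exists l, (minv (mmul g (r i))).
  assert (Em : mob (minv (mmul g (r i))) (tau l) = t).
  { rewrite <- E, <- (mob_mmul g (r i)) by sl2. apply mob_minv_l; sl2. }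
  split; [exact Hl|]. split; [|now symmetry]. apply (HLL l Hl); [sl2|]. now rewrite Em.
- assert (Pt : forall z, 0 < Im z -> IZR (oF z) = sumL (seq 0 N) (fun l => IZR (ordt l) * indic (H_equiv G z (tau l)))).
  { intros z Hz. destruct (classic (exists l, (l < N)%nat /\ H_equiv G z (tau l))) as [[l0 [H0 E0]]|Nn].
    - rewrite (sumL_ext _ _ (fun l => indic (l0 = l) * IZR (ordt l))).
      + rewrite sumL_ind_eq; [|apply seq_NoDup|apply in_seq; lia]. rewrite Eo by exact H0. f_equal.
        destruct E0 as [g [Hg <-]]. symmetry. apply Hinv; [now left|exact Hz].
      + intros l Hl. apply HN in Hl. rewrite Rmult_comm. f_equal.
        destruct (Nat.eq_dec l0 l) as [->|Nl].
        * now rewrite !indic_true.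
        * rewrite !indic_false; auto. intros E. apply (Hneq l0 l H0 Hl Nl).
          apply (H_equiv_trans G _ z); auto; [now apply Ht|]. now apply H_equiv_sym.
    - rewrite sumL_0.
      + replace (oF z) with 0%Z; [reflexivity|]. symmetry. apply NNPP. intros E. apply Nn.
        apply (Hall z (oF z)); auto. apply is_order_is_ord; auto.
      + intros l Hl. rewrite indic_false; [ring|]. intros E. apply Nn. exists l. auto. }
  rewrite (sumL_ext Z _ (fun t => sumL (seq 0 N) (fun l => IZR (ordt l) *
     (sumL (seq 0 m) (fun i => indic (H_equiv G (mob (r i) t) (tau l))) * w t)))).
  + rewrite sumL_swap, rsum_sumL. apply sumL_ext. intros l Hl. apply HN in Hl. rewrite sumL_scal.
    destruct (HLL l Hl) as [K1 [K2 [K3 K4]]]. destruct (Ht l Hl) as [T1 [_ T3]].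
    assert (Q := orbit_sum G m r idx (tau l) (st l) (LL l) HGs HR T1 T3 K1 K2 K3 K4 Z (NoDup_nodup _ _) HZ).
    rewrite <- (Rmult_1_r (IZR (ordt l) / INR (st l))), <- Q.
    (* The identity Q itself shows that st l is nonzero. *)
    * field. intros E. rewrite E, Rmult_0_l in Q. apply R1_neq_R0. symmetry. apply Q.
      intros A IA. apply InZ. exists l, A. auto.
    * intros A IA. apply InZ. exists l, A. auto.
  + intros t It. destruct (HZ t It) as [Hti _].
    rewrite (sumL_ext (seq 0 m) _ (fun i => sumL (seq 0 N) (fun l => IZR (ordt l) * indic (H_equiv G (mob (r i) t) (tau l))))).
    * rewrite sumL_swap, Rmult_comm, <- sumL_scal. apply sumL_ext. intros l _. rewrite sumL_scal. ring.
    * intros i Hi. apply Pt. apply Im_mob_pos; auto.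
Qed.

(** The cusp A(i oo) is carried to B(i oo) by g exactly when the matrix B^-1 g A fixes i oo, that
    is, has lower left entry 0. *)
Lemma cusp_equiv_mc G A B : cusp_equiv G (cusp_of A) (cusp_of B) <->
  exists g, G g /\ mc (mmul (minv B) (mmul g A)) = 0%Z.
Proof.
unfold cusp_equiv, proj_eq, pact, cusp_of. destruct A as [a b c d], B as [a' b' c' d'].
cbn [fst snd ma mb mc md mmul minv].
split; intros [g [Hg E]]; exists g; (split; [exact Hg|]); lia.
Qed.

Lemma cusp_stab_mc A B : cusp_stab (cusp_of B) A <-> SL2Z A /\ mc (mmul (minv B) (mmul A B)) = 0%Z.
Proof.
unfold cusp_stab, proj_eq, pact, cusp_of. destruct B as [a' b' c' d'].
cbn [fst snd ma mb mc md mmul minv]. split; intros [H E]; (split; [exact H|]); lia.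
Qed.

Lemma mc_mmul_0 A B : mc A = 0%Z -> mc B = 0%Z -> mc (mmul A B) = 0%Z.
Proof. unfold mmul; simpl. intros -> ->. ring. Qed.
Lemma mc_minv_0 A : mc A = 0%Z -> mc (minv A) = 0%Z.
Proof. simpl. intros ->. reflexivity. Qed.
Lemma mc_mneg_0 A B g : mc (mmul B (mmul (mneg g) A)) = 0%Z <-> mc (mmul B (mmul g A)) = 0%Z.
Proof. rewrite mmul_mneg_l, mmul_mneg_r. simpl. lia. Qed.

Lemma cusp_equiv_pm G A B g : pmG G g -> mc (mmul (minv B) (mmul g A)) = 0%Z ->
  cusp_equiv G (cusp_of A) (cusp_of B).
Proof.
intros [H|H] E; apply cusp_equiv_mc; [now exists g|]. exists (mneg g). split; [exact H|]. now apply mc_mneg_0.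
Qed.

Lemma cusp_equiv_sym G A B : is_subgroup G -> SL2Z A -> SL2Z B ->
  cusp_equiv G (cusp_of A) (cusp_of B) -> cusp_equiv G (cusp_of B) (cusp_of A).
Proof.
intros HG HA HB H. apply cusp_equiv_mc in H. destruct H as [g [Hg E]]. apply cusp_equiv_mc.
exists (minv g). split; [now apply HG|]. apply mc_minv_0 in E. revert E. mnorm. auto.
Qed.

Lemma cusp_equiv_trans G A B E : is_subgroup G -> SL2Z A -> SL2Z B -> SL2Z E ->
  cusp_equiv G (cusp_of A) (cusp_of B) -> cusp_equiv G (cusp_of B) (cusp_of E) ->
  cusp_equiv G (cusp_of A) (cusp_of E).
Proof.
intros HG HA HB HE H H'. apply cusp_equiv_mc in H. destruct H as [g [Hg E1]].
apply cusp_equiv_mc in H'. destruct H' as [g' [Hg' E2]]. apply cusp_equiv_mc.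
exists (mmul g' g). split; [now apply HG|]. generalize (mc_mmul_0 _ _ E2 E1). mnorm. auto.
Qed.

(** Write B = g A p with p fixing i oo. As den p is 1 or -1, the transform by B at z has the modulus
    of the transform by A at p z, a point of the same height, and [asympt_unique] applies. *)
Lemma ord_infty_cusp Hs D kn f A B g ra rb : (1 <= D)%nat -> pm_group Hs ->
  automorphic Hs (weight D kn) f -> SL2Z A -> SL2Z B -> Hs g -> mc (mmul (minv B) (mmul g A)) = 0%Z ->
  ord_infty (slash D kn A 1 f) ra -> ord_infty (slash D kn B 1 f) rb -> ra = rb.
Proof.
intros HD HG HF HA HB Hg E Ha Hb.
assert (GS := proj1 HG). assert (Sg := GS g Hg).
destruct (ord_infty_asympt _ _ Ha) as [ca [Ca Aa]]. destruct (ord_infty_asympt _ _ Hb) as [cb [Cb Ab]].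
apply (asympt_unique _ _ ra rb ca cb Aa Ab Ca Cb). intros Y.
set (p := minv (mmul (minv B) (mmul g A))).
assert (Sp : SL2Z p) by (unfold p; sl2). assert (Ep : mc p = 0%Z) by now apply mc_minv_0.
assert (EB : B = mmul g (mmul A p)) by (unfold p; mnorm; reflexivity).
set (t := (0, 1 + Rmax 0 Y) : C).
pose proof (Rmax_l 0 Y). pose proof (Rmax_r 0 Y).
assert (Ht : 0 < Im t) by (unfold t, Im; simpl; lra).
assert (SAp : SL2Z (mmul A p)) by sl2.
destruct (pnear_ex _ _ (pnear_and _ _ _ (phi_left _ f Hs g (mmul A p) t HF GS Hg SAp Ht) (near_pnear _ _
    (near_rcont_pos (fun w => Im w + - Rmax 0 Y) t (rcont_plus _ _ _ (rcont_snd _) (rcont_const (- Rmax 0 Y) _))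
      ltac:(unfold t, Im; simpl; lra))))) as [z [_ [Z1 Z2]]].
assert (Hz : 0 < Im z) by lra.
assert (Dp : Cmod (den p z) = 1).
{ unfold den. rewrite Ep. unfold ZtoC at 1. apply SL2Z_eq in Sp. rewrite Ep in Sp.
  replace (RtoC 0 * z + ZtoC (md p))%C with (ZtoC (md p)) by ring. unfold ZtoC. rewrite Cmod_R, <- abs_IZR.
  f_equal. assert (md p = 1 \/ md p = -1)%Z as [-> | ->]; [|reflexivity|reflexivity].
  apply Z.mul_eq_1 with (ma p). lia. }
exists (mob p z), z. split; [rewrite Im_mob, Dp by assumption; field|].
split; [rewrite Im_mob, Dp by assumption; lra|].
rewrite !Cmod_slash_phi by (auto using Im_mob_pos).
rewrite phi_mul, Dp, ln_1, Rmult_0_r, exp_0, Rmult_1_l by assumption.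
rewrite <- Z1, <- EB. reflexivity.
Qed.

(** Multiplication by gam on the right carries the cosets of the stabilizers at the cusp bijectively
    to the cosets of the whole groups whose cusp is equivalent to it. This is how widths arise from
    a sum over cosets. *)
Lemma cusp_count G m r idx gam wd : is_subgroup G -> coset_reps (pmG G) m r idx -> SL2Z gam ->
  cusp_width G (cusp_of gam) wd ->
  length (fltr (fun i => cusp_equiv G (cusp_of (r i)) (cusp_of gam)) (seq 0 m)) = wd.
Proof.
intros HGs HR Hgam [rho [W1 W2]].
assert (HG := pmG_group G HGs). destruct (HG) as [G1 [G2 [G3 [G4 G5]]]]. destruct (HR) as [R1 R2].
assert (W1' : forall u, (u < wd)%nat -> SL2Z (rho u) /\ mc (mmul (minv gam) (mmul (rho u) gam)) = 0%Z).
{ intros u Hu. apply cusp_stab_mc. auto. }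
rewrite <- (length_seq wd 0), <- (length_map (fun u => idx (mmul (rho u) gam)) (seq 0 wd)).
apply length_eq_of_members.
- apply NoDup_filter, seq_NoDup.
- apply NoDup_map_in; [apply seq_NoDup|]. intros u v Hu Hv E. apply in_seq in Hu. apply in_seq in Hv.
  destruct (W1' u) as [Su Cu]; [lia|]. destruct (W1' v) as [Sv Cv]; [lia|].
  apply (idx_eq (pmG G) m r idx _ _ HG HR) in E; [|sl2|sl2]. revert E. mnorm. intros E.
  destruct (W2 (rho u) ltac:(apply cusp_stab_mc; auto)) as [x [_ Hx]]. transitivity x; [symmetry|]; apply Hx.
  + split; [lia|]. rewrite mmul_inv_r by sl2. split; [exact G2|]. apply cusp_stab_mc.
    split; [sl2|]. mnorm. reflexivity.
  + split; [lia|]. split; [exact E|]. apply cusp_stab_mc. split; [sl2|].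
    generalize (mc_mmul_0 _ _ Cu (mc_minv_0 _ Cv)). mnorm. auto.
- intros i. rewrite in_fltr, in_map_iff. split.
  + intros [Hi E]. apply in_seq in Hi. assert (Si : SL2Z (r i)) by (apply R1; lia).
    apply cusp_equiv_mc in E. destruct E as [g [Hg E]]. assert (Pg : pmG G g) by now left.
    assert (Sg := G1 g Pg). set (s := mmul g (mmul (r i) (minv gam))).
    assert (Ss : SL2Z s) by (unfold s; sl2).
    destruct (W2 s) as [u [[Hu [Pu _]] _]].
    { apply cusp_stab_mc. split; [exact Ss|]. unfold s. revert E. mnorm. auto. }
    destruct (W1' u Hu) as [Su Cu]. exists u. split; [|apply in_seq; lia].
    symmetry. apply R2; [sl2|lia|].
    replace (mmul (mmul (rho u) gam) (minv (r i))) with (mmul (minv (mmul s (minv (rho u)))) g).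
    * auto.
    * unfold s. mnorm. reflexivity.
  + intros [u [<- Hu]]. apply in_seq in Hu. destruct (W1' u) as [Su Cu]; [lia|].
    assert (Sx : SL2Z (mmul (rho u) gam)) by sl2. destruct (R2 _ Sx) as [I1 [I2 _]].
    assert (Si := R1 _ I1). split; [apply in_seq; lia|].
    apply (cusp_equiv_pm G _ _ _ I2). revert Cu. mnorm. auto.
Qed.

Lemma cusp_sum G m r idx D kn f rho M gam ordc wd : (1 <= D)%nat ->
  is_subgroup G -> coset_reps (pmG G) m r idx -> automorphic (pmG G) (weight D kn) f ->
  (forall i, (i < m)%nat -> ord_infty (slash D kn (r i) 1 f) (rho i)) ->
  (forall j, (j < M)%nat ->
     SL2Z (gam j) /\ ord_infty (slash D kn (gam j) (RtoC 1) f) (ordc j) /\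
     cusp_width G (cusp_of (gam j)) (wd j)) ->
  (forall i j, (i < M)%nat -> (j < M)%nat -> i <> j ->
     ~ cusp_equiv G (cusp_of (gam i)) (cusp_of (gam j))) ->
  (forall A, SL2Z A -> exists j, (j < M)%nat /\ cusp_equiv G (cusp_of A) (cusp_of (gam j))) ->
  sumL (seq 0 m) rho = rsum M (fun j => ordc j * INR (wd j)).
Proof.
intros HD HGs HR HF Hrho Hg Hneq Hall. destruct (HR) as [R1 R2].
assert (HM : forall i, In i (seq 0 M) -> (i < M)%nat) by (intros i Hi; apply in_seq in Hi; lia).
rewrite (sumL_ext _ _ (fun i => sumL (seq 0 M) (fun j => ordc j * indic (cusp_equiv G (cusp_of (r i)) (cusp_of (gam j)))))).
- rewrite sumL_swap, rsum_sumL. apply sumL_ext. intros j Hj. apply HM in Hj. rewrite sumL_scal, sumL_ind.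
  destruct (Hg j Hj) as [S1 [_ S3]]. now rewrite (cusp_count G m r idx (gam j) (wd j)).
- intros i Hi. apply in_seq in Hi. assert (Si : SL2Z (r i)) by (apply R1; lia).
  destruct (Hall (r i) Si) as [j0 [H0 E0]]. destruct (Hg j0 H0) as [S0 [O0 _]].
  rewrite (sumL_ext _ _ (fun j => indic (j0 = j) * ordc j)).
  + rewrite sumL_ind_eq; [|apply seq_NoDup|apply in_seq; lia].
    apply cusp_equiv_mc in E0. destruct E0 as [g [Pg E]].
    apply (ord_infty_cusp (pmG G) D kn f (r i) (gam j0) g); auto.
    * now apply pmG_group.
    * now left.
    * apply Hrho. lia.
  + intros j Hj. apply HM in Hj. rewrite Rmult_comm. f_equal. destruct (Nat.eq_dec j0 j) as [->|N].
    * now rewrite !indic_true.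
    * rewrite !indic_false; auto. intros E. apply (Hneq j0 j H0 Hj N). destruct (Hg j Hj) as [Sj _].
      apply (cusp_equiv_trans G _ (r i)); auto. now apply cusp_equiv_sym.
Qed.

(** * Existence of a description of the divisor *)

Lemma select_reps {A} (d : A) (P : A -> Prop) (Rl : A -> A -> Prop) (l : list A) :
  (forall x, P x -> Rl x x) -> (forall x y, P x -> P y -> Rl x y -> Rl y x) -> (forall x, In x l -> P x) ->
  exists l', (forall x, In x l' -> In x l) /\
    (forall i j, (i < length l')%nat -> (j < length l')%nat -> i <> j -> ~ Rl (nth i l' d) (nth j l' d)) /\
    (forall x, In x l -> exists y, In y l' /\ Rl x y).
Proof.
intros Hrefl Hsym. induction l as [|a l IH]; intros HP.
- exists nil. split; [auto|]. split; [simpl; intros; lia|]. intros x [].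
- destruct IH as [l' [I1 [I2 I3]]]; [intros; apply HP; now right|].
  assert (Pl : forall x, In x l' -> P x) by (intros; apply HP; right; auto).
  assert (Pa : P a) by (apply HP; now left).
  destruct (classic (exists y, In y l' /\ Rl a y)) as [E|E].
  + exists l'. split; [intros; right; auto|]. split; [exact I2|]. intros x [<-|Hx]; auto.
  + exists (a :: l'). split; [intros x [<-|Hx]; [now left|right; auto]|]. split.
    * intros i j Hi Hj Nij H. simpl in Hi, Hj.
      destruct i as [|i], j as [|j]; simpl in H; [lia| | |].
      -- apply E. exists (nth j l' d). split; [apply nth_In; lia|exact H].
      -- apply E. exists (nth i l' d). assert (I : In (nth i l' d) l') by (apply nth_In; lia). auto.
      -- apply (I2 i j); auto; lia.
    * intros x [<-|Hx]; [exists a; split; [now left|auto]|].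
      destruct (I3 x Hx) as [y [Y1 Y2]]. exists y. split; [now right|exact Y2].
Qed.

(** The cosets inside the stabilizer of the cusp inject into the finitely many cosets of SL_2(Z); a
    stabilizing matrix is chosen in each coset that contains one. *)
Lemma width_exists G m r idx gam : is_subgroup G -> coset_reps (pmG G) m r idx -> SL2Z gam ->
  exists wd, cusp_width G (cusp_of gam) wd.
Proof.
intros HGs HR Hgam. assert (HG := pmG_group G HGs). destruct (HG) as [G1 [G2 [G3 [G4 G5]]]]. destruct (HR) as [R1 R2].
set (K0 := cusp_stab (cusp_of gam)).
assert (KS : forall A, K0 A -> SL2Z A) by (intros A H; apply H).
assert (Kdiv : forall A B, K0 A -> K0 B -> K0 (mmul A (minv B))).
{ intros A B HA HB. assert (SA := KS A HA). assert (SB := KS B HB).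
  apply cusp_stab_mc in HA. apply cusp_stab_mc in HB. apply cusp_stab_mc. split; [sl2|].
  generalize (mc_mmul_0 _ _ (proj2 HA) (mc_minv_0 _ (proj2 HB))). mnorm. auto. }
set (cand := flat_map (fun i => match excluded_middle_informative (exists A, K0 A /\ idx A = i) with
   | left h => proj1_sig (constructive_indefinite_description _ h) :: nil | right _ => nil end) (seq 0 m)).
assert (C1 : forall A, In A cand -> K0 A).
{ intros A I. apply in_flat_map in I. destruct I as [i [_ I]].
  destruct (excluded_middle_informative _) as [h|]; [|destruct I].
  destruct (constructive_indefinite_description _ h) as [B HB]. simpl in I. destruct I as [<-|[]]. apply HB. }
assert (C2 : forall A, K0 A -> exists B, In B cand /\ idx B = idx A).
{ intros A HA. destruct (R2 A (KS A HA)) as [Hi _].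
  assert (E : exists B, K0 B /\ idx B = idx A) by (exists A; auto).
  set (F := fun i => match excluded_middle_informative (exists A, K0 A /\ idx A = i) with
   | left h => proj1_sig (constructive_indefinite_description _ h) :: nil | right _ => nil end).
  assert (Q : exists B, In B (F (idx A)) /\ idx B = idx A).
  { unfold F. destruct (excluded_middle_informative _) as [h|]; [|contradiction].
    destruct (constructive_indefinite_description _ h) as [B HB]. exists B. simpl. tauto. }
  destruct Q as [B [I EB]]. exists B. split; [|exact EB]. apply in_flat_map. exists (idx A).
  split; [apply in_seq; lia|exact I]. }
destruct (select_reps mI K0 (fun A B => pmG G (mmul A (minv B))) cand) as [l' [I1 [I2 I3]]].
- intros A HA. rewrite mmul_inv_r by auto. exact G2.
- intros A B HA HB H. apply G4 in H. rewrite minv_mmul, minv_inv in H. exact H.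
- exact C1.
- exists (length l'), (fun i => nth i l' mI). split.
  + intros i Hi. apply C1, I1. now apply nth_In.
  + intros A HA. assert (SA := KS A HA). destruct (C2 A HA) as [B [IB EB]]. assert (KB := C1 B IB). assert (SB := KS B KB).
    destruct (I3 B IB) as [y [Iy Py]]. assert (Ky := C1 y (I1 y Iy)). assert (Sy := KS y Ky).
    assert (PA : pmG G (mmul A (minv B))) by (apply (idx_eq (pmG G) m r idx _ _ HG HR); auto).
    assert (PAy : pmG G (mmul A (minv y))).
    { generalize (G3 _ _ PA Py). mnorm. auto. }
    destruct (In_nth l' y mI Iy) as [i [Hi Ei]]. exists i. split.
    * rewrite Ei. split; [exact Hi|]. split; [exact PAy|now apply Kdiv].
    * intros j [Hj [Pj _]]. apply NNPP. intros Nij. apply (I2 i j Hi Hj Nij). rewrite Ei.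
      assert (Kj : K0 (nth j l' mI)) by (apply C1, I1; now apply nth_In). assert (Sj := KS _ Kj).
      generalize (G3 _ _ (G4 _ PAy) Pj). mnorm. auto.
Qed.

(** If B t is in the domain and A fixes t, then B A belongs to the finite list of [orbit_weights].
    The predicate [pos] selects one of A and -A. *)
Lemma stab_card_exists G t : is_subgroup G -> 0 < Im t -> exists n, stab_card G t n.
Proof.
intros HGs Ht. assert (HG := pmG_group G HGs). destruct (HG) as [G1 [G2 [G3 [G4 G5]]]].
destruct (reduction t Ht) as [B [HB HW]].
destruct (orbit_weights t Ht) as [L [NL [L1 [L2 _]]]].
set (pos := fun A => (0 < mc A \/ mc A = 0 /\ 0 < md A)%Z).
set (S1 := fltr (fun A => (pmG G A /\ mob A t = t) /\ pos A) (map (mmul (minv B)) L)).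
assert (InS : forall A, In A S1 <-> (pmG G A /\ mob A t = t) /\ pos A).
{ intros A. unfold S1. rewrite in_fltr. split; [tauto|]. intros H. split; [|exact H].
  destruct H as [[PA FA] _]. assert (SA := G1 A PA). apply in_map_iff. exists (mmul B A). split; [now apply mcancel_l|].
  apply L2; [sl2|]. rewrite mob_mmul, FA by assumption. exact HW. }
assert (NS : NoDup S1).
{ apply NoDup_filter. apply NoDup_map_in; [exact NL|]. intros a b _ _ E.
  apply (f_equal (mmul B)) in E. now rewrite !mcancel_r in E by assumption. }
assert (Pn : forall A, SL2Z A -> pos A \/ pos (mneg A)).
{ intros A HA. apply SL2Z_eq in HA. unfold pos; simpl.
  destruct (Z.lt_trichotomy 0 (mc A)) as [?|[E|?]]; [left; lia| |right; lia].
  rewrite <- E in HA. assert (md A <> 0)%Z by (intros Q; rewrite Q in HA; lia).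
  destruct (Z.lt_trichotomy 0 (md A)) as [?|[?|?]]; lia. }
assert (Pnn : forall A, pos A -> pos (mneg A) -> False) by (unfold pos; simpl; intros; lia).
exists (length S1), (fun i => nth i S1 mI). split.
- intros i Hi. assert (I : In (nth i S1 mI) S1) by now apply nth_In. now apply InS in I.
- intros A PA FA. assert (SA := G1 A PA).
  assert (Q : exists A', In A' S1 /\ (A = A' \/ A = mneg A')).
  { destruct (Pn A SA) as [Q|Q].
    - exists A. split; [apply InS; auto|auto].
    - exists (mneg A). split; [|right; now rewrite mneg_mneg]. apply InS. split; [|exact Q].
      split; [auto|]. rewrite mob_mneg; auto. }
  destruct Q as [A' [IA' E]]. destruct (In_nth S1 A' mI IA') as [i [Hi Ei]]. exists i. split.
  + rewrite Ei. auto.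
  + intros j [Hj Ej]. assert (Ij : In (nth j S1 mI) S1) by now apply nth_In.
    assert (Eq : nth j S1 mI = A').
    { apply InS in IA'. apply InS in Ij. destruct IA' as [_ P1], Ij as [_ P2]. set (X := nth j S1 mI) in *.
      destruct E as [E|E], Ej as [Ej|Ej]; rewrite E in Ej.
      - auto.
      - exfalso. apply (Pnn X P2). rewrite <- Ej. exact P1.
      - exfalso. apply (Pnn A' P1). rewrite Ej. exact P2.
      - apply (f_equal mneg) in Ej. rewrite !mneg_mneg in Ej. auto. }
    apply (proj1 (NoDup_nth S1 mI) NS); auto. rewrite Ei, Eq. reflexivity.
Qed.

(** The asymptotics bound the height of zeros and poles, and the part of the domain below that
    height lies in a rectangle. *)
Lemma finite_zeros_in_D F (oF : C -> Z) r (c : C) : c <> 0 -> asympt F r c ->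
  (forall t, 0 < Im t -> is_ord F t (oF t)) ->
  exists L : list C, (forall t, In t L -> 0 < Im t) /\
    forall t, 0 < Im t -> w t <> 0 -> oF t <> 0%Z -> In t L.
Proof.
intros Hc HA Ho. destruct (asympt_ord_0 F r c Hc HA) as [Y HY].
destruct (finite_zeros F (- (1/2)) (1/2) (1/4) Y) as [L [_ [L1 L2]]].
{ intros t [_ Ht]. exists (oF t). apply Ho. lra. }
exists L. split; [intros t I; apply L1 in I; destruct I as [_ I]; lra|].
intros t Ht Hw Hne. apply NNPP. intros N. apply Hne. apply (is_ord_unique F t); [now apply Ho|].
apply L2; [|exact N]. apply wD_neq0 in Hw. destruct Hw as [W1 W2]. split; [exact W2|].
split; [nra|]. apply Rnot_lt_le. intros Q. apply Hne. apply (HY t); auto.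
Qed.

Lemma choose {A} (P : nat -> A -> Prop) N (a0 : A) : (forall i, (i < N)%nat -> exists x, P i x) ->
  exists F : nat -> A, forall i, (i < N)%nat -> P i (F i).
Proof.
intros H.
assert (Ex : forall i, exists x, (i < N)%nat -> P i x).
{ intros i. destruct (lt_dec i N) as [L|L]; [|exists a0; lia]. destruct (H i L) as [x Hx]. now exists x. }
exists (fun i => proj1_sig (constructive_indefinite_description _ (Ex i))). intros i.
destruct (constructive_indefinite_description _ (Ex i)). auto.
Qed.

(** Every orbit of nonzero order meets the image under some r_i of the fundamental domain, and there
    the candidates are finite in number. Every cusp is equivalent to some r_i(i oo). Inequivalent
    representatives are then extracted from both lists. *)
Lemma div_repr_exists G m r idx D kn f oF : (1 <= D)%nat -> is_subgroup G -> coset_reps (pmG G) m r idx ->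
  (forall t, 0 < Im t -> is_ord f t (oF t)) ->
  (forall g t, pmG G g -> 0 < Im t -> oF (mob g t) = oF t) ->
  (forall A, SL2Z A -> exists rho, ord_infty (slash D kn A 1 f) rho) ->
  exists N tau ordt st M gam ordc wd, div_repr G D kn f N tau ordt st M gam ordc wd.
Proof.
intros HD HGs HR Ho Hinv Hord.
assert (HG := pmG_group G HGs). destruct (HG) as [G1 [G2 [G3 [G4 G5]]]]. destruct (HR) as [R1 R2].
assert (ExL : exists LL : nat -> list C, forall i, (i < m)%nat -> (forall t, In t (LL i) -> 0 < Im t) /\
   forall t, 0 < Im t -> w t <> 0 -> oF (mob (r i) t) <> 0%Z -> In t (LL i)).
{ apply (choose (fun i L => (forall t, In t L -> 0 < Im t) /\
   forall t, 0 < Im t -> w t <> 0 -> oF (mob (r i) t) <> 0%Z -> In t L) m nil).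
  intros i Hi. assert (Si := R1 i Hi). destruct (Hord (r i) Si) as [rho Hrho].
  destruct (ord_infty_asympt _ _ Hrho) as [c [Hc HA]].
  apply (finite_zeros_in_D (slash D kn (r i) 1 f) (fun t => oF (mob (r i) t)) rho c Hc HA).
  intros t Ht. apply is_ord_slash; auto. apply Ho. now apply Im_mob_pos. }
destruct ExL as [LL HLL].
set (cand := flat_map (fun i => map (mob (r i)) (LL i)) (seq 0 m)).
destruct (select_reps (0, 1) (fun t => 0 < Im t) (H_equiv G) cand) as [l [I1 [I2 I3]]].
{ intros t Ht. exists mI. split; [apply HGs|apply mob_mI]. }
{ intros t t' Ht _. now apply H_equiv_sym. }
{ intros t I. apply in_flat_map in I. destruct I as [i [Hi I]]. apply in_seq in Hi.
  apply in_map_iff in I. destruct I as [t' [<- I]]. apply Im_mob_pos; [apply R1; lia|]. apply (HLL i); [lia|exact I]. }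
assert (Pl : forall i, (i < length l)%nat -> 0 < Im (nth i l (0, 1))).
{ intros i Hi. assert (I := I1 _ (nth_In l (0, 1) Hi)). apply in_flat_map in I. destruct I as [j [Hj I]].
  apply in_seq in Hj. apply in_map_iff in I. destruct I as [t' [<- I]].
  apply Im_mob_pos; [apply R1; lia|]. apply (HLL j); [lia|exact I]. }
destruct (choose (fun i n => stab_card G (nth i l (0, 1)) n) (length l) O) as [st Hst].
{ intros i Hi. apply stab_card_exists; auto. }
destruct (select_reps mI SL2Z (fun A B => cusp_equiv G (cusp_of A) (cusp_of B)) (map r (seq 0 m)))
  as [lc [J1 [J2 J3]]].
{ intros A HA. apply cusp_equiv_mc. exists mI. split; [apply HGs|]. now rewrite mmul_1_l, mmul_inv_l. }
{ intros A B HA HB. now apply cusp_equiv_sym. }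
{ intros A I. apply in_map_iff in I. destruct I as [i [<- Hi]]. apply in_seq in Hi. apply R1. lia. }
assert (Slc : forall j, (j < length lc)%nat -> SL2Z (nth j lc mI)).
{ intros j Hj. assert (I := J1 _ (nth_In lc mI Hj)). apply in_map_iff in I. destruct I as [i [<- Hi]].
  apply in_seq in Hi. apply R1. lia. }
destruct (choose (fun j x => ord_infty (slash D kn (nth j lc mI) 1 f) x) (length lc) 0) as [ordc Hordc].
{ intros j Hj. apply Hord. auto. }
destruct (choose (fun j x => cusp_width G (cusp_of (nth j lc mI)) x) (length lc) O) as [wd Hwd].
{ intros j Hj. apply (width_exists G m r idx); auto. }
exists (length l), (fun i => nth i l (0, 1)), (fun i => oF (nth i l (0, 1))), st,
  (length lc), (fun j => nth j lc mI), ordc, wd.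
split; [|split; [|split; [|split; [|split]]]].
- intros i Hi. split; [auto|]. split; [apply is_order_is_ord; auto|auto].
- exact I2.
- intros t n Ht Hn Hne.
  assert (En : n = oF t) by (apply (is_ord_unique f t); [now apply is_order_is_ord|auto]).
  destruct (reduction t Ht) as [A [HA HW]]. assert (SA := SL2Z_minv A HA).
  destruct (R2 _ SA) as [Hi [Pi _]]. set (i := idx (minv A)) in *. assert (Si := R1 i Hi).
  set (g := mmul (minv A) (minv (r i))) in *. assert (Sg := G1 g Pi).
  assert (Hd := Im_mob_pos A t HA Ht). set (d := mob A t) in *.
  assert (Hrd := Im_mob_pos (r i) d Si Hd).
  assert (Et : mob g (mob (r i) d) = t).
  { rewrite <- mob_mmul by sl2. unfold g. mnorm. unfold d. now apply mob_minv_l. }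
  assert (Id : In d (LL i)).
  { apply (HLL i Hi); auto. rewrite <- (Hinv g _ Pi Hrd), Et, <- En. exact Hne. }
  assert (Ic : In (mob (r i) d) cand).
  { apply in_flat_map. exists i. split; [apply in_seq; lia|now apply in_map]. }
  destruct (I3 _ Ic) as [y [Iy Ey]]. destruct (In_nth l y (0, 1) Iy) as [j [Hj Ej]].
  exists j. split; [exact Hj|]. cbv beta. rewrite Ej. apply (H_equiv_trans G t (mob (r i) d) y); auto.
  assert (Ed : mob (minv g) t = mob (r i) d) by (rewrite <- Et; now apply mob_minv_l).
  destruct (G4 _ Pi) as [Q|Q].
  + exists (minv g). split; [exact Q|exact Ed].
  + exists (mneg (minv g)). split; [exact Q|]. rewrite mob_mneg by sl2. exact Ed.
- intros j Hj. auto.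
- exact J2.
- intros A HA. destruct (R2 A HA) as [Hi [Pi _]]. set (i := idx A) in *. assert (Si := R1 i Hi).
  assert (Ic : In (r i) (map r (seq 0 m))) by (apply in_map, in_seq; lia).
  destruct (J3 _ Ic) as [y [Iy Ey]]. destruct (In_nth lc y mI Iy) as [j [Hj Ej]].
  exists j. split; [exact Hj|]. cbv beta. rewrite Ej. assert (Sy : SL2Z y) by (rewrite <- Ej; auto).
  apply (cusp_equiv_trans G A (r i) y); auto.
  apply (cusp_equiv_pm G _ _ (minv (mmul A (minv (r i))))); [auto|]. mnorm. reflexivity.
Qed.

(** The first conjunct keeps the second from being vacuous; the second also shows that the degree
    does not depend on the description of the divisor. *)
Theorem theorem3p2 (G : mat -> Prop) (D : nat) (kn : Z) (chi : mat -> C -> C)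
    (f : C -> C) (m : nat) :
  is_subgroup G ->
  (exists n, is_index G SL2Z n) ->
  (1 <= D)%nat ->
  multiplier_system G D kn chi ->
  mero_modular_form G D kn chi f ->
  mero_nonzero f ->
  is_index (pmG G) SL2Z m ->
  (exists N tau ordt st M gam ordc wd, div_repr G D kn f N tau ordt st M gam ordc wd) /\
  (forall N tau ordt st M gam ordc wd, div_repr G D kn f N tau ordt st M gam ordc wd ->
     div_degree N ordt st M ordc wd = INR m * weight D kn / 12).
Proof.
intros HGs _ HD Hchi Hf Hnz Hm.
destruct (coset_reps_exist _ _ Hm) as [r [idx HR]].
assert (HG := pmG_group G HGs).
assert (HF := modular_automorphic G D kn chi f HD HGs Hchi Hf).
assert (Hall := all_ord f (proj1 Hf) Hnz).
assert (ExO : forall t, exists n, 0 < Im t -> is_ord f t n).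
{ intros t. destruct (Rlt_dec 0 (Im t)) as [Ht|Ht]; [|exists 0%Z; lra].
  destruct (Hall t Ht) as [n Hn]. now exists n. }
set (oF := fun t => proj1_sig (constructive_indefinite_description _ (ExO t))).
assert (Ho : forall t, 0 < Im t -> is_ord f t (oF t)).
{ intros t. unfold oF. destruct (constructive_indefinite_description _ (ExO t)). auto. }
assert (Hinv := modular_order_invariant G D kn chi f oF HD HGs Hchi Hf Ho).
assert (Hord : forall A, SL2Z A -> exists rho, ord_infty (slash D kn A 1 f) rho).
{ intros A HA. apply ord_infty_exists; [now apply Hf|]. intros t Ht. exists (oF (mob A t)).
  apply is_ord_slash; auto. apply Ho. now apply Im_mob_pos. }
split; [now apply (div_repr_exists G m r idx D kn f oF)|].
intros N tau ordt st M gam ordc wd [D1 [D2 [D3 [D4 [D5 D6]]]]].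
(* These are orders at the coset representatives r_i, which need not be among the cusp
   representatives gam; [cusp_sum] relates the two. *)
destruct (choose (fun i rho => ord_infty (slash D kn (r i) 1 f) rho) m 0) as [rho Hrho].
{ intros i Hi. apply Hord. now apply HR. }
destruct (points_sum G m r idx f oF N tau ordt st HGs HR Ho Hinv D1 D2 D3) as [Z [NZ [Z1 [Z2 Z3]]]].
unfold div_degree. rewrite <- Z3.
rewrite <- (cusp_sum G m r idx D kn f rho M gam ordc wd HD HGs HR HF Hrho D4 D5 D6).
exact (product_formula (pmG G) m r idx D kn f oF rho HD HG HR HF Ho Hrho Z NZ Z1 Z2).
Qed.
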